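(* Let $K$ be a number field or a function field, $f\in K[X]$ a polynomial of degree at least $2$, $n\geq2$, and $\varphi=(f,\ldots,f)\colon(\mathbb{P}^1_K)^n\to(\mathbb{P}^1_K)^n$. Let $V$ be a zero-dimensional closed subvariety of $(\mathbb{P}^1_K)^n$. Then: (a) For every $P\in(\mathbb{P}^1)^n(K)$ with $V(K)\cap\mathcal{O}_\varphi(P)=\emptyset$, there exist infinitely many primes $\mathfrak{p}$ of $K$ such that $V(K_\mathfrak{p})$ does not intersect the $\mathfrak{p}$-adic closure of $\mathcal{O}_\varphi(P)$. (b) For every finite set $S$ of places of $K$ containing all archimedean places and every $P\in(\mathbb{P}^1)^n(K)$, $V(K)\cap\mathcal{O}_\varphi(P)=V(K,S)\cap\mathcal{C}(\mathcal{O}_\varphi(P))$. (c) If moreover $f$ is special and $V$ is $\varphi$-preperiodic, then for every $P\in(\mathbb{P}^1)^n(K)$ with $V(K)\cap\mathcal{O}_\varphi(P)=\emptyset$, for all but finitely many primes $\mathfrak{p}$ of $K$, $V(K_\mathfrak{p})$ does not intersect the $\mathfrak{p}$-adic closure of $\mathcal{O}_\varphi(P)$.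
   Context: A function field is a finitely generated field of transcendence degree 1 over a characteristic 0 field $\kappa$ (relatively algebraically closed in $K$); places are valuations trivial on $\kappa$; primes are non-archimedean places; $K_v$ is the completion. $\mathcal{O}_\varphi(P)=\{\varphi^m(P):m\geq0\}$. For a variety $X$ over $K$, $X(K,S)=\prod_{v\notin S}X(K_v)$ with the product of the $v$-adic topologies, $X(K)$ embedded diagonally; for $T\subseteq X(K,S)$, $\mathcal{C}(T)$ is its closure in $X(K,S)$ (here $X=(\mathbb{P}^1)^n$). A polynomial of degree $d\geq2$ is special if it is conjugate by some $L\in\mathrm{Aut}(\mathbb{P}^1(\bar K))$ to $X^d$, $C_d$ or $-C_d$, where $C_d(X+1/X)=X^d+1/X^d$. $V$ is preperiodic if $\varphi^{k+M}(V)=\varphi^k(V)$ for some $k\geq0$, $M\geq1$. *)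

(* Defs.v *)
From HB Require Import structures.
From mathcomp Require Import all_boot all_order all_algebra all_field.
From mathcomp Require Import all_classical all_reals all_analysis.
(* Required but not imported: its notations clash with those of analysis. *)
From mathcomp Require mpoly.
Set Implicit Arguments.
Unset Strict Implicit.
Unset Printing Implicit Defensive.
Import Order.TTheory GRing.Theory Num.Theory.
Local Open Scope classical_set_scope.
Local Open Scope ring_scope.

Section BaseField.
Variable K : fieldType.

Definition number_field : Prop :=
  exists (L : fieldExtType rat) (i : {rmorphism L -> K}), bijective i.

Definition is_subfield (k : set K) : Prop :=
  [/\ k 1, forall x y, k x -> k y -> k (x - y)
    & forall x y, k x -> k y -> k (x / y)].

Definition subfield_gen (A : set K) : set K := smallest is_subfield A.

Definition algebraic_over (k : set K) (x : K) : Prop :=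
  exists p : {poly K}, [/\ p != 0, forall i, k p`_i & root p x].

Definition finitely_generated_over (k : set K) : Prop :=
  exists s : seq K, subfield_gen (k `|` [set` s]) = setT.

Definition trdeg1_over (k : set K) : Prop :=
  exists2 t, ~ algebraic_over k t
           & forall x, algebraic_over (subfield_gen (k `|` [set t])) x.

Definition function_field (kappa : set K) : Prop :=
  [/\ [pchar K] =i pred0,
      is_subfield kappa,
      forall x, algebraic_over kappa x -> kappa x,
      finitely_generated_over kappa
    & trdeg1_over kappa].

Variant global_field : Type :=
| NumberField of number_field
| FunctionField (kappa : set K) of function_field kappa.

(* The elements on which every place is required to be trivial. *)
Definition constants (B : global_field) : set K :=
  match B with
  | NumberField _ => set0
  | FunctionField kappa _ => kappa
  end.

End BaseField.

Record absval (R : realType) (F : fieldType) := AbsVal {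
  absval_fun :> F -> R;
  absval_ge0 : forall x, 0 <= absval_fun x;
  absval_eq0 : forall x, (absval_fun x == 0) = (x == 0);
  absvalM : forall x y, absval_fun (x * y) = absval_fun x * absval_fun y;
  absvalD : forall x y, absval_fun (x + y) <= absval_fun x + absval_fun y
}.

Section AbsVal.
Variables (R : realType) (F : fieldType).
Implicit Type v w : absval R F.

Lemma absval0 v : v 0 = 0.
Proof. by apply/eqP; rewrite absval_eq0. Qed.

Lemma absvalN v x : v (- x) = v x.
Proof.
apply/eqP; rewrite -(@eqrXn2 _ 2) ?absval_ge0//.
by rewrite !expr2 -!absvalM mulrNN.
Qed.

Definition absval_nontrivial v : Prop := exists2 x, x != 0 & v x != 1.

Definition ultrametric v : Prop :=
  forall x y, v (x + y) <= Num.max (v x) (v y).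

Definition absval_equiv v w : Prop :=
  exists2 s : R, 0 < s & forall x, w x = v x `^ s.

Section Pullback.
Variables (L : fieldType) (i : {rmorphism F -> L}) (v : absval R L).

Lemma pullback_ge0 x : 0 <= (v \o i) x.
Proof. exact: absval_ge0. Qed.

Lemma pullback_eq0 x : ((v \o i) x == 0) = (x == 0).
Proof. by rewrite /= absval_eq0 fmorph_eq0. Qed.

Lemma pullbackM x y : (v \o i) (x * y) = (v \o i) x * (v \o i) y.
Proof. by rewrite /= rmorphM absvalM. Qed.

Lemma pullbackD x y : (v \o i) (x + y) <= (v \o i) x + (v \o i) y.
Proof. by rewrite /= rmorphD absvalD. Qed.

Definition absval_pullback : absval R F :=
  AbsVal pullback_ge0 pullback_eq0 pullbackM pullbackD.

End Pullback.

End AbsVal.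

(* Places are equivalence classes of absolute values. In a function field of
   transcendence degree 1, every nontrivial valuation trivial on the constants
   is discrete of rank 1, hence comes from a real absolute value. *)
Record place (R : realType) (K : fieldType) (B : global_field K) := Place {
  place_class : set (absval R K);
  place_classP : exists2 v : absval R K,
    absval_nontrivial v /\ (forall x, constants B x -> x != 0 -> v x = 1)
    & place_class = [set w | absval_equiv v w]
}.

Definition is_prime (R : realType) (K : fieldType) (B : global_field K)
  (v : place R B) : Prop := forall a, place_class v a -> ultrametric a.

(* A copy of F carrying the metric a (x - y). *)
Definition adic (R : realType) (F : fieldType) (a : absval R F) : Type := F.

Section AdicMetric.
Variables (R : realType) (F : fieldType) (a : absval R F).

HB.instance Definition _ := GRing.Field.copy (adic a) F.

Definition adic_dist (x y : adic a) : R := a (x - y).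

Lemma adic_distxx x : adic_dist x x = 0.
Proof. by rewrite /adic_dist subrr absval0. Qed.

Lemma adic_dist_positivity x y : adic_dist x y = 0 -> x = y.
Proof. by move/eqP; rewrite absval_eq0 subr_eq0 => /eqP. Qed.

Lemma adic_dist_sym x y : adic_dist x y = adic_dist y x.
Proof. by rewrite /adic_dist -absvalN opprB. Qed.

Lemma adic_dist_triangle y x z :
  adic_dist x z <= adic_dist x y + adic_dist y z.
Proof. by rewrite /adic_dist -[x - z](subrKA y) absvalD. Qed.

HB.instance Definition _ := @isMetric.Build R (adic a) adic_dist
  adic_distxx adic_dist_positivity adic_dist_sym adic_dist_triangle.

End AdicMetric.

(* Unique up to a unique isomorphism of topological K-algebras. *)
Record completion (R : realType) (K : fieldType) (B : global_field K)
    (v : place R B) := Completion {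
  compl_field : fieldType;
  compl_abs : absval R compl_field;
  compl_emb : {rmorphism K -> compl_field};
  compl_place : place_class v (absval_pullback compl_emb compl_abs);
  compl_dense : dense (range compl_emb : set (adic compl_abs));
  compl_complete : forall G : set_system (adic compl_abs),
    ProperFilter G -> cauchy G -> exists l : adic compl_abs, G --> l
}.

(* P^1(F) = F together with a point at infinity: [x : 1] is Some x and
   [1 : 0] is None. *)
Definition P1 (F : Type) : Type := option F.

Section ProjectiveLine.
Variable F : fieldType.

(* The point [x : y], for (x, y) != (0, 0). *)
Definition P1_of_coord (x y : F) : P1 F :=
  if y == 0 then None else Some (x / y).

Definition P1_coord (P : P1 F) : F * F :=
  if P is Some x then (x, 1) else (1, 0).

Definition poly_P1 (f : {poly F}) (P : P1 F) : P1 F :=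
  if P is Some x then Some f.[x] else None.

Definition mobius (a b c d : F) (P : P1 F) : P1 F :=
  let: (x, y) := P1_coord P in P1_of_coord (a * x + b * y) (c * x + d * y).

End ProjectiveLine.

Definition adic_P1 (R : realType) (F : fieldType) (a : absval R F) : Type :=
  P1 F.

Section AdicP1Topology.
Variables (R : realType) (F : fieldType) (a : absval R F).

HB.instance Definition _ := Choice.copy (adic_P1 a) (option F).

(* The topology glued from the two affine charts t |-> [t : 1], [1 : t]. *)
Definition adic_P1_open (U : set (adic_P1 a)) : Prop :=
  open [set t : adic a | U (P1_of_coord (t : F) 1)] /\
  open [set t : adic a | U (P1_of_coord 1 (t : F))].

Lemma adic_P1_openT : adic_P1_open setT.
Proof. by split; exact: openT. Qed.

Lemma adic_P1_openI : setI_closed adic_P1_open.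
Proof. by move=> U W [U1 U2] [W1 W2]; split; exact: openI. Qed.

Lemma adic_P1_open_bigU (I : Type) (f : I -> set (adic_P1 a)) :
  (forall i, adic_P1_open (f i)) -> adic_P1_open (\bigcup_i f i).
Proof.
move=> fo; split.
  apply: (@bigcup_open _ _ setT
    (fun i => [set t : adic a | f i (P1_of_coord (t : F) 1)])) => i _.
  by case: (fo i).
apply: (@bigcup_open _ _ setT
  (fun i => [set t : adic a | f i (P1_of_coord 1 (t : F))])) => i _.
by case: (fo i).
Qed.

HB.instance Definition _ := isOpenTopological.Build (adic_P1 a)
  adic_P1_openT adic_P1_openI adic_P1_open_bigU.

End AdicP1Topology.

(* (P^1)^n(F). *)
Definition P1n (n : nat) (F : Type) : Type := 'I_n -> P1 F.

Definition P1n_map (n : nat) (F L : Type) (i : F -> L) (P : P1n n F) :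
  P1n n L := fun k => omap i (P k).

Definition diag_map (n : nat) (F : fieldType) (f : {poly F}) (P : P1n n F) :
  P1n n F := fun k => poly_P1 f (P k).

Definition forward_orbit (T : Type) (phi : T -> T) (P : T) : set T :=
  [set iter m phi P | m in [set: nat]].

(* Closed subsets of (P^1_K)^n, as zero loci of multihomogeneous polynomials in
   the n pairs of homogeneous coordinates (x_k, y_k): x_k is the variable of
   index lshift n k, and y_k that of index rshift n k. *)
Section Subvarieties.
Variables (n : nat) (K : fieldType).

Definition multihomogeneous (F : mpoly.mpoly (n + n) K) : Prop :=
  exists d : 'I_n -> nat, forall m, mpoly.mcoeff m F != 0 -> forall k : 'I_n,
    (mpoly.fun_of_multinom m (lshift n k)
     + mpoly.fun_of_multinom m (rshift n k))%N = d k.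

Record subvariety := Subvariety {
  equations : set (mpoly.mpoly (n + n) K);
  equations_mhom : forall F, equations F -> multihomogeneous F
}.

Definition P1n_coord (L : fieldType) (P : P1n n L) (k : 'I_(n + n)) : L :=
  match fintype.split k with
  | inl k => (P1_coord (P k)).1
  | inr k => (P1_coord (P k)).2
  end.

(* V(L), for a field extension i : K -> L. *)
Definition points (V : subvariety) (L : fieldType) (i : {rmorphism K -> L}) :
  set (P1n n L) :=
  [set P | forall F, equations V F -> mpoly.mmap i (P1n_coord P) F = 0].

End Subvarieties.

(* Krull dimension for the Zariski topology. The points over an algebraic
   closure Kbar of K, with the topology whose closed sets are defined over K,
   have the same lattice of closed sets as the K-scheme (P^1_K)^n. *)
Section Dimension.
Variables (n : nat) (K : fieldType) (Kbar : fieldType).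
Variable j : {rmorphism K -> Kbar}.
Implicit Types Z : set (P1n n Kbar).

Definition zariski_closed Z : Prop :=
  exists V : subvariety n K, Z = points V j.

Definition irreducible_closed Z : Prop :=
  [/\ zariski_closed Z, Z !=set0
    & forall Z1 Z2, zariski_closed Z1 -> zariski_closed Z2 ->
        Z `<=` Z1 `|` Z2 -> Z `<=` Z1 \/ Z `<=` Z2].

Definition has_chain Z (d : nat) : Prop :=
  exists C : nat -> set (P1n n Kbar),
    (forall i, (i <= d)%N -> irreducible_closed (C i) /\ C i `<=` Z) /\
    (forall i, (i < d)%N -> C i `<` C i.+1).

Definition krull_dim Z (d : nat) : Prop :=
  has_chain Z d /\ ~ has_chain Z d.+1.

Definition dimension_zero (V : subvariety n K) : Prop :=
  krull_dim (points V j) 0.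

(* phi^(k+M)(V) = phi^k(V) as closed subsets: the images are closed, hence
   determined by their Kbar-points. *)
Definition preperiodic (f : {poly K}) (V : subvariety n K) : Prop :=
  let phi := diag_map (map_poly j f) in
  exists k M : nat, (1 <= M)%N /\
    iter (k + M) phi @` points V j = iter k phi @` points V j.

End Dimension.

Section Special.
Variable F : fieldType.

(* C_d(X + 1/X) = X^d + 1/X^d; F is infinite in all uses, so that this
   determines C. *)
Definition is_chebyshev (d : nat) (C : {poly F}) : Prop :=
  forall x : F, x != 0 -> C.[x + x^-1] = x ^+ d + (x ^+ d)^-1.

Definition conjugate (f g : {poly F}) : Prop :=
  exists a b c d : F, a * d - b * c != 0 /\
    forall P : P1 F,
      mobius a b c d (poly_P1 f P) = poly_P1 g (mobius a b c d P).

End Special.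

Definition special (K Kbar : fieldType) (j : {rmorphism K -> Kbar})
    (f : {poly K}) : Prop :=
  let d := (size f).-1 in
  let fbar := map_poly j f in
  conjugate fbar 'X^d \/
  exists2 C : {poly Kbar}, is_chebyshev d C
    & conjugate fbar C \/ conjugate fbar (- C).

Definition algebraic_closure (K : fieldType) (Kbar : closedFieldType)
  (j : {rmorphism K -> Kbar}) : Prop := forall x, algebraicOver j x.

Section AdelicPoints.
Variables (R : realType) (K : fieldType) (B : global_field K).
Variable Kv : forall v : place R B, completion v.
Variable n : nat.

(* (P^1)^n(K_v) with the v-adic topology. *)
Definition adic_P1n (v : place R B) : topologicalType :=
  prod_topology (fun _ : 'I_n => adic_P1 (compl_abs (Kv v))).

Definition embed_at (v : place R B) (P : P1n n K) : adic_P1n v :=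
  P1n_map (compl_emb (Kv v)) P.

Definition points_at (V : subvariety n K) (v : place R B) :
  set (adic_P1n v) := points V (compl_emb (Kv v)).

Definition adic_closure (v : place R B) (T : set (P1n n K)) :
  set (adic_P1n v) := closure (@embed_at v @` T).

(* X(K, S), the product over the places outside S, for X = (P^1)^n. *)
Definition adelic_P1n (S : set (place R B)) : topologicalType :=
  prod_topology (fun v : {v | ~ S v} => adic_P1n (sval v)).

Definition embed_diag (S : set (place R B)) (P : P1n n K) : adelic_P1n S :=
  fun v => embed_at (sval v) P.

Definition adelic_points (V : subvariety n K) (S : set (place R B)) :
  set (adelic_P1n S) := [set x | forall v, points_at V (x v)].

Definition adelic_closure (S : set (place R B)) (T : set (P1n n K)) :
  set (adelic_P1n S) := closure (@embed_diag S @` T).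

End AdelicPoints.

Arguments embed_at {R K B} Kv {n} v P.
Arguments points_at {R K B} Kv {n} V v.
Arguments adic_closure {R K B} Kv {n} v T.
Arguments embed_diag {R K B} Kv {n} S P.
Arguments adelic_points {R K B} Kv {n} V S.
Arguments adelic_closure {R K B} Kv {n} S T.

(* Main.v *)
(* A wandering coordinate x_m = f^m(alpha) is studied through a polynomial h over K with
   h o f = h q and h, q coprime: the minimal polynomial of a fixed point of f at which f' does
   not vanish.  At almost every prime p, once |h(x_m)|_p < 1 the value |h(x_m)|_p no longer
   changes, so x_m stays away from the zeros of h, and from every b with h(b) a unit.  If only
   finitely many primes divided the values h(x_m), the product formula for h(x_m) would
   contradict the growth of log |h(x_m)|, of order deg(f)^m at a place where the orbit is
   unbounded: near a zero of h the absolute value |h(x_m)| changes by bounded factors only, so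
   no place can be small at all late times.  If the orbit is bounded at every place, the product
   formula for x_k - x_l bounds the p-adic distances of distinct orbit points from below.  So at
   infinitely many primes the orbit does not accumulate at the coordinates of V, which are
   algebraic over K since dim V = 0.

   When f is special and V preperiodic, those coordinates are zeros of f^(a+N) - f^a, and
   H = f^N - X satisfies H o f = H T with T equal to f' at the zeros of H.  For Chebyshev
   polynomials no periodic point is critical, so H and T are coprime; for powers
   f = c (X - e)^d + e the only critical periodic point is e. *)
Require Import Defs.
From HB Require Import structures.
From mathcomp Require Import all_boot all_order all_algebra all_field.
From mathcomp Require Import all_classical all_reals all_analysis.
From mathcomp Require Import (canonicals, coercions) mpoly.
From mathcomp Require Import (canonicals, coercions) complex.
From mathcomp Require Import zify ring lra.
Import Order.TTheory GRing.Theory Num.Theory.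
Local Open Scope classical_set_scope.
Local Open Scope ring_scope.
Set Implicit Arguments.
Unset Strict Implicit.
Unset Printing Implicit Defensive.

(** * The Nullstellensatz *)

Section Nullstellensatz.

(** The bounded case is genuine: over a function field an infinite orbit may consist of constants,
    all of whose differences are units, so that neither growth nor divisibility of the values of [h]
    gives anything. The polynomial [h] is chosen independently of [V], because coordinates of [V]
    need not be periodic and provide no relation with [f]; a fixed point with nonzero multiplier
    always exists, and [q] takes that multiplier as its value there. No theory of ramification or
    local degrees enters the product formula over [K]. Absolute values of [K] are indexed by an
    absolute value of the base field together with an embedding of [K] into a closed field, and the
    product over the embeddings is the absolute value of a norm. A place may then occur several
    times, but only finitely often, which is all that counting places requires. The points of [V] to
    be avoided live in completions, while dimension is measured over [Kbar]; the Nullstellensatz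
    moves equations of coordinates from one to the other. For (b), infinitely many good primes are
    more than enough: a single one outside [S] controls the whole product. *)

Definition prime_ideal (A : comNzRingType) (I : A -> Prop) : Prop :=
  [/\ I 0, ~ I 1, forall a b, I a -> I b -> I (a + b),
      forall a b, I b -> I (a * b) & forall a b, I (a * b) -> I a \/ I b].

(* Quantifying over the rings A over K lets the variables be adjoined one at a time. *)
Definition separates_primes (K A : comNzRingType) (Kbar : fieldType)
    (j : {rmorphism K -> Kbar}) (e : {rmorphism K -> A}) : Prop :=
  forall (I : A -> Prop) (G : A), prime_ideal I -> ~ I G ->
  exists psi : {rmorphism A -> Kbar},
    [/\ forall c, psi (e c) = j c, forall a, I a -> psi a = 0 & psi G != 0].

(** [A] is only a ring, so dividing by [H] costs powers of its leading coefficient. The bound on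
    [size Q] serves when a polynomial of minimal size is divided by a nonconstant one: the quotient
    then falls below the minimum. *)
Lemma pseudo_division (A : comNzRingType) (H F : {poly A}) : H != 0 ->
  exists e Q R, [/\ lead_coef H ^+ e *: F = Q * H + R, (size R < size H)%N
    & (size Q <= (size F).+1 - size H)%N].
Proof.
move=> H0; have sH : (0 < size H)%N by rewrite size_poly_gt0.
have [n] := ubnP (size F); elim: n F => // n IHn F sFn.
have [sFH|sHF] := ltnP (size F) (size H).
  by exists 0%N, 0, F; rewrite expr0 scale1r mul0r add0r size_poly0.
set F' := lead_coef H *: F - lead_coef F *: 'X^(size F - size H) * H.
have sF' : (size F' < size F)%N.
  have sF : (0 < size F)%N by exact: leq_trans sH sHF.
  rewrite -(prednK sF) ltnS; apply/leq_sizeP => i; rewrite leq_eqVlt.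
  rewrite /F' coefB coefZ -scalerAl coefZ coefXnM /lead_coef.
  have FE : forall k, (size F <= k)%N -> F`_k = 0 by move=> k; exact: nth_default.
  have HE : forall k, (size H <= k)%N -> H`_k = 0 by move=> k; exact: nth_default.
  move: (size F) (size H) sF sH sHF FE HE => s t sF sH sHF FE HE.
  move=> /orP[/eqP <-|iF].
    rewrite ifF; last by lia.
    have -> : (s.-1 - (s - t) = t.-1)%N by clear -sF sH sHF; lia.
    by rewrite mulrC subrr.
  rewrite [F`_i]FE; last by clear -iF; lia.
  rewrite ifF; last by clear -iF; lia.
  rewrite [H`_(i - _)]HE; last by clear -iF sHF sH sF; lia.
  by rewrite !mulr0 subrr.
have [e [Q [R [E sR sQ]]]] := IHn F' (leq_trans sF' sFn).
exists e.+1, (Q + lead_coef H ^+ e *: (lead_coef F *: 'X^(size F - size H))), R.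
split=> //.
  rewrite exprSr -scalerA -(subrK (lead_coef F *: 'X^(size F - size H) * H) (lead_coef H *: F)).
  by rewrite scalerDr -/F' E mulrDl addrAC scalerAl.
rewrite (leq_trans (size_polyD _ _)) // geq_max; apply/andP; split.
  by rewrite (leq_trans sQ) // ; lia.
rewrite (leq_trans (size_scale_leq _ _)) // (leq_trans (size_scale_leq _ _)) //.
by rewrite size_polyXn; lia.
Qed.

Section Step.
Variables (A : comNzRingType) (I : {poly A} -> Prop).
Hypothesis Ip : prime_ideal I.

Lemma prime_ideal_const : prime_ideal (fun a : A => I a%:P).
Proof.
case: Ip => I_0 I_1 ID IM IP; split => //.
- by move=> a b; rewrite polyCD; exact: ID.
- by move=> a b; rewrite polyCM; exact: IM.
- by move=> a b; rewrite polyCM; exact: IP.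
Qed.

Lemma prime_ideal_sum (J : eqType) (r : seq J) (F : J -> {poly A}) :
  (forall i, i \in r -> I (F i)) -> I (\sum_(i <- r) F i).
Proof.
case: Ip => I_0 _ ID _ _; elim: r => [|x r IHr] h; first by rewrite big_nil.
rewrite big_cons; apply: ID; first by apply: h; rewrite mem_head.
by apply: IHr => i ir; apply: h; rewrite inE ir orbT.
Qed.

Lemma prime_ideal_coef (p : {poly A}) : (forall i, I (p`_i)%:P) -> I p.
Proof.
case: Ip => _ _ _ IM _ h; rewrite -[p]coefK poly_def.
apply: prime_ideal_sum => i _; rewrite -mul_polyC mulrC; exact/IM/h.
Qed.

Lemma prime_ideal_opp (p : {poly A}) : I p -> I (- p).
Proof. by case: Ip => _ _ _ IM _ h; rewrite -mulN1r; exact: IM. Qed.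

Lemma prime_ideal_exp (a : A) e : ~ I a%:P -> ~ I (a ^+ e)%:P.
Proof.
case: Ip => _ I_1 _ _ IP h; elim: e => [|e IHe]; first by rewrite expr0.
by rewrite exprS polyCM => /IP[].
Qed.

(** Leading terms with coefficient in [I] are removed one at a time. The size of the result is the
    degree modulo the contraction of [I] to [A], so the quotient of [A] by that ideal need not be
    formed. *)
Lemma strip_lead (p : {poly A}) : ~ (forall i, I (p`_i)%:P) ->
  exists p', [/\ I (p - p'), ~ I (lead_coef p')%:P & (size p' <= size p)%N].
Proof.
case: (Ip) => I_0 I_1 ID IM IP.
have [n] := ubnP (size p); elim: n p => // n IHn p sp h.
have [lp|lp] := pselect (I (lead_coef p)%:P); last first.
  by exists p; rewrite subrr.
have p0 : p != 0.
  by apply: contra_notN h => /eqP-> i; rewrite coef0.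
have sp0 : (0 < size p)%N by rewrite size_poly_gt0.
set p1 := p - lead_coef p *: 'X^((size p).-1).
have sp1 : (size p1 < size p)%N.
  rewrite -(prednK sp0) ltnS; apply/leq_sizeP => i; rewrite leq_eqVlt.
  rewrite coefB coefZ coefXn => /orP[/eqP <-|ip].
    by rewrite eqxx mulr1 subrr.
  by rewrite gtn_eqF // mulr0 subr0 [p`_i]nth_default // -(prednK sp0).
case: (IHn p1).
- by lia.
- move=> h1; apply: h => i; have := h1 i.
  rewrite coefB coefZ coefXn; case: eqP => [->|_]; rewrite ?mulr0 ?subr0 //.
- move=> p' [Ip' lp' sp']; exists p'; split=> //; last by lia.
  rewrite -(subrK p1 p) -addrA; apply: ID => //.
  by rewrite /p1 opprB addrC subrK -mul_polyC mulrC; exact: IM.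
Qed.

End Step.

(** If all elements of [I] have their coefficients in the contraction of [I] to [A], the new
    variable is transcendental modulo [I] and may be sent to any non-root of the image of [G].
    Otherwise it must go to a root of the image of an [H] in [I] of least degree; [G] does not
    vanish there because the ideal generated by [G] and [I] contains a constant outside [I]. *)
Lemma separates_primes_poly (K A : comNzRingType) (Kbar : closedFieldType)
    (j : {rmorphism K -> Kbar}) (e : {rmorphism K -> A}) :
  separates_primes j e -> separates_primes j (polyC \o e : {rmorphism K -> {poly A}}).
Proof.
move=> sepA I G Ip IG; case: (Ip) => I_0 I_1 ID IM IP.
have I0p := prime_ideal_const Ip.
pose ev (psi : {rmorphism A -> Kbar}) (xi : Kbar) : {rmorphism {poly A} -> Kbar} :=
  horner_eval xi \o map_poly psi.
have evC psi xi c : ev psi xi c%:P = psi c.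
  by rewrite /ev /= /horner_eval map_polyC hornerC.
have ev_coef (psi : {rmorphism A -> Kbar}) xi (p : {poly A}) : (forall a, I a%:P -> psi a = 0) ->
    (forall i, I (p`_i)%:P) -> ev psi xi p = 0.
  move=> psi0 h; rewrite /ev /= /horner_eval; suff -> : map_poly psi p = 0.
    by rewrite horner0.
  by apply/polyP => i; rewrite coef_map coef0; exact: psi0.
have [trans|] := pselect (forall H, I H -> forall i, I (H`_i)%:P).
  have [i Gi] : exists i, ~ I (G`_i)%:P.
    apply/not_existsP => h; apply: IG; apply: prime_ideal_coef => // i.
    exact: contrapT (h i).
  have [psi [psie psi0 psiG]] := sepA _ _ I0p Gi.
  have mG : map_poly psi G != 0.
    by apply: contra_neq psiG => /polyP/(_ i); rewrite coef_map coef0.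
  have /closed_nonrootP[xi xiP] := mG.
  exists (ev psi xi); split=> // [c|a Ia].
  - by exact: etrans (evC _ _ _) (psie _).
  - by apply: ev_coef => //; exact: trans.
move=> /existsNP[H1 /not_implyP[IH1 nH1]].
pose T (n : nat) := `[< exists H, [/\ I H, ~ I (lead_coef H)%:P & size H = n] >].
have exT : exists n, T n.
  have [H' [h1 h2 h3]] := strip_lead Ip nH1.
  exists (size H'); apply/asboolP; exists H'; split=> //.
  have := ID _ _ (prime_ideal_opp Ip h1) IH1.
  by rewrite opprB subrK.
have [n /asboolP[H [IH lH sH]] nmin] := ex_minnP exT.
have small B : I B -> (size B < size H)%N -> forall i, I (B`_i)%:P.
  move=> IB sB; apply: contrapT => /(strip_lead Ip)[B' [h1 h2 h3]].
  have : T (size B').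
    apply/asboolP; exists B'; split=> //.
    have := ID _ _ (prime_ideal_opp Ip h1) IB.
    by rewrite opprB subrK.
  by move=> /nmin; lia.
have H0 : H != 0.
  by apply: contra_notN lH => /eqP->; rewrite lead_coef0.
have sH2 : (1 < size H)%N.
  rewrite ltnNge; apply: contra_notN lH => /size1_polyC HE.
  by rewrite HE lead_coefC -HE.
(* [J] is the ideal generated by [G] and [I]. Its element of least degree outside [I] will turn out
   to be constant. *)
pose J (D : {poly A}) := exists u B, I B /\ D = u * G + B.
have JI D B : J D -> I B -> J (D + B).
  move=> [u [B' [IB' ->]]] IB; exists u, (B' + B); split; last by rewrite addrA.
  exact: ID.
have JM a D : J D -> J (a * D).
  move=> [u [B' [IB' ->]]]; exists (a * u), (a * B'); split; last by ring.
  exact: IM.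
pose T2 (m : nat) := `[< exists D, [/\ J D, ~ I D, ~ I (lead_coef D)%:P & size D = m] >].
have toT2 D : J D -> ~ I D -> exists2 m, T2 m & (m <= size D)%N.
  move=> JD nID; have : ~ (forall i, I (D`_i)%:P).
    by apply: contra_not nID; exact: prime_ideal_coef.
  move=> /(strip_lead Ip)[D' [h1 h2 h3]]; exists (size D') => //.
  apply/asboolP; exists D'; split=> //.
    have := JI _ _ JD (prime_ideal_opp Ip h1).
    by rewrite opprB addrC subrK.
  by apply: contra_not nID => h; rewrite -(subrK D' D); exact: ID.
have exT2 : exists m, T2 m.
  have JG : J G by exists 1, 0; rewrite mul1r addr0.
  by have [m ? _] := toT2 G JG IG; exists m.
have [m /asboolP[D [JD nID lD sD]] mmin] := ex_minnP exT2.
have D0 : D != 0 by apply: contra_notN nID => /eqP->.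
have sD1 : (size D <= 1)%N.
  rewrite leqNgt; apply/negP => sD2.
  have sDH : (size D < size H)%N.
    rewrite ltnNge; apply/negP => sHD.
    have [a [Q [R [E sR _]]]] := pseudo_division D H0.
    have RE : R = (lead_coef H ^+ a)%:P * D + (- (Q * H)).
      by rewrite mul_polyC E addrAC subrr add0r.
    have nR : ~ I R.
      move=> IR; have : I ((lead_coef H ^+ a)%:P * D).
        by rewrite mul_polyC E; apply: ID => //; exact: IM.
      by move=> /IP[] // /(prime_ideal_exp Ip (e := a) lH).
    have JR : J R.
      by rewrite RE; apply: JI; [exact: JM|apply: prime_ideal_opp => //; exact: IM].
    by have [m' /mmin] := toT2 R JR nR; lia.
  (* The remainder lies in [J] and is smaller than [D], hence lies in [I]; then so does the quotient
     [B], as [D] does not. Being smaller than [H], both have all their coefficients in [I], and the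
     identity puts a product of powers of the leading coefficients of [D] and [H] in [I]. *)
  have [a [B [R [E sR sB]]]] := pseudo_division H D0.
  have IR : I R.
    apply: contrapT => nR.
    have RE : R = (- B) * D + (lead_coef D ^+ a)%:P * H.
      by rewrite mul_polyC E mulNr addKr.
    have JR : J R by rewrite RE; apply: JI; [exact: JM|exact: IM].
    by have [m' /mmin] := toT2 R JR nR; lia.
  have IB : I B.
    have : I (B * D).
      have -> : B * D = (lead_coef D ^+ a)%:P * H + (- R).
        by rewrite mul_polyC E addrK.
      by apply: ID; [exact: IM|exact: prime_ideal_opp].
    by move=> /IP[].
  have hB : forall i, I ((B * D)`_i)%:P.
    have hB := small B IB _; move=> i; rewrite coefM rmorph_sum /=.
    apply: prime_ideal_sum => // k _; rewrite polyCM mulrC; apply: IM.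
    by apply: hB; lia.
  have hR := small R IR (ltn_trans sR sDH).
  have : I (lead_coef D ^+ a * lead_coef H)%:P.
    rewrite [lead_coef H]lead_coefE -coefZ E coefD polyCD.
    by apply: ID.
  rewrite polyCM => /IP[] //; exact: prime_ideal_exp.
have [c cE] : exists c, D = c%:P by exists D`_0; exact: size1_polyC.
have nc : ~ I c%:P by rewrite -cE.
have [u [B [IB DE]]] := JD.
have ncH : ~ I (c * lead_coef H)%:P by rewrite polyCM => /IP[].
(* A nonzero image of the leading coefficient of [H] gives the image of [H] a root, and lets
   pseudo-division by [H] show that all of [I] vanishes at that root. *)
have [psi [psie psi0]] := sepA _ _ I0p ncH.
rewrite rmorphM mulf_eq0 negb_or => /andP[psic psiH].
have /closed_rootP[xi] : size (map_poly psi H) != 1.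
  by rewrite size_map_poly_id0 //; lia.
move=> /rootP Hxi.
have psiI F : I F -> ev psi xi F = 0.
  move=> IF; have [a [Q [R [E sR _]]]] := pseudo_division F H0.
  have IR : I R.
    have -> : R = (lead_coef H ^+ a)%:P * F + (- (Q * H)).
      by rewrite mul_polyC E addrAC subrr add0r.
    by apply: ID; [exact: IM|apply: prime_ideal_opp => //; exact: IM].
  have : ev psi xi (lead_coef H ^+ a *: F) = 0.
    rewrite E rmorphD rmorphM [ev psi xi H]Hxi mulr0 add0r.
    by apply: ev_coef => //; exact: small.
  rewrite -mul_polyC rmorphM evC rmorphXn => /eqP.
  by rewrite mulf_eq0 expf_eq0 (negbTE psiH) andbF => /eqP.
exists (ev psi xi); split=> // [k|]; first by exact: etrans (evC _ _ _) (psie _).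
apply: contra_neq psic => psiG; rewrite -(evC psi xi c) -cE DE rmorphD rmorphM.
by rewrite psiG mulr0 add0r psiI.
Qed.

End Nullstellensatz.

Section NullstellensatzMpoly.

Lemma separates_primes_field (K : fieldType) (Kbar : fieldType)
    (j : {rmorphism K -> Kbar}) : separates_primes j (idfun : {rmorphism K -> K}).
Proof.
move=> I G [I_0 I_1 ID IM IP] IG; exists j; split=> // [a Ia|].
  have [->|a0] := eqVneq a 0; first by rewrite rmorph0.
  by case: I_1; rewrite -(mulVf a0); exact: IM.
by rewrite fmorph_eq0; apply: contra_notN IG => /eqP->.
Qed.

(** The ring is an iterated univariate polynomial ring, exposed only through its universal property,
    which is enough to map it onto [mpoly] and pull prime ideals back. *)
Lemma polynomial_ring_separates_primes (K : fieldType) (Kbar : closedFieldType)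
    (j : {rmorphism K -> Kbar}) (N : nat) :
  exists (A : comNzRingType) (e : {rmorphism K -> A}) (X : 'I_N -> A),
    separates_primes j e /\
    forall (B : comNzRingType) (g : {rmorphism K -> B}) (b : 'I_N -> B),
      exists tau : {rmorphism A -> B},
        (forall c, tau (e c) = g c) /\ (forall i, tau (X i) = b i).
Proof.
elim: N => [|N [A [e [X [sepA univ]]]]].
  exists K, idfun, (fun=> 0); split; first exact: separates_primes_field.
  by move=> B g b; exists g; split => // -[].
exists {poly A}, (polyC \o e : {rmorphism K -> {poly A}}).
exists (fun i => if unlift ord0 i is Some k then (X k)%:P else 'X).
split; first exact: separates_primes_poly.
move=> B g b; have [tau [tauC tauX]] := univ B g (fun k => b (lift ord0 k)).
exists (horner_eval (b ord0) \o map_poly tau : {rmorphism {poly A} -> B}).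
split=> [c|i] /=; rewrite /horner_eval.
  by rewrite map_polyC hornerC /= tauC.
by case: unliftP => [k|] ->; rewrite ?map_polyC ?hornerC ?map_polyX ?hornerX //= tauX.
Qed.

Lemma rmorph_mmap (N : nat) (R S T : comNzRingType) (f : {rmorphism R -> S})
    (g : {rmorphism S -> T}) (h : 'I_N -> S) (p : mpoly.mpoly N R) :
  g (mpoly.mmap f h p) = mpoly.mmap (g \o f) (g \o h) p.
Proof.
rewrite /mpoly.mmap rmorph_sum; apply: eq_bigr => m _.
rewrite rmorphM; congr (_ * _); rewrite /mpoly.mmap1 rmorph_prod.
by apply: eq_bigr => i _; rewrite rmorphXn.
Qed.

Lemma nullstellensatz (N : nat) (K : fieldType) (Kbar : closedFieldType)
    (j : {rmorphism K -> Kbar}) (I : mpoly.mpoly N K -> Prop) G :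
  prime_ideal I -> ~ I G ->
  exists r : 'I_N -> Kbar,
    (forall F, I F -> mpoly.mmap j r F = 0) /\ mpoly.mmap j r G != 0.
Proof.
move=> Ip IG.
have [A [e [X [sepA univ]]]] := polynomial_ring_separates_primes j N.
have [tau [tauC tauX]] := univ _ (mpoly.mpolyC N (R := K) : {rmorphism _ -> _})
  (fun i => mpoly.mpolyX K (mpoly.mnm1 i)).
have tauK F : tau (mpoly.mmap e X F) = F.
  rewrite rmorph_mmap [RHS]mpoly.mpolyE /mpoly.mmap; apply: eq_bigr => m _ /=.
  rewrite tauC mpoly.mul_mpolyC; congr (_ *: _).
  by rewrite -mpoly.mmap1_id; apply: mpoly.mmap1_eq.
have I'p : prime_ideal (fun a => I (tau a)).
  case: Ip => I_0 I_1 ID IM IP; split; rewrite ?rmorph0 ?rmorph1 //.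
  - by move=> a b; rewrite rmorphD; exact: ID.
  - by move=> a b; rewrite rmorphM; exact: IM.
  - by move=> a b; rewrite rmorphM; exact: IP.
have I'G : ~ I (tau (mpoly.mmap e X G)) by rewrite tauK.
have [psi [psie psi0 psiG]] := sepA _ _ I'p I'G.
have psiE F : psi (mpoly.mmap e X F) = mpoly.mmap j (psi \o X) F.
  rewrite rmorph_mmap; apply: eq_bigr => m _ /=; by rewrite psie.
exists (psi \o X); split=> [F IF|]; last by rewrite -psiE.
by rewrite -psiE psi0 // tauK.
Qed.

End NullstellensatzMpoly.

(** * Zero-dimensional subvarieties *)

Section ZeroDimensional.
Variables (n : nat) (K : fieldType).
Local Notation mp := (mpoly.mpoly (n + n) K).

Definition mvarX (k : 'I_n) : mp := mpoly.mpolyX K (mpoly.mnm1 (lshift n k)).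
Definition mvarY (k : 'I_n) : mp := mpoly.mpolyX K (mpoly.mnm1 (rshift n k)).

Lemma P1n_coord_lshift (L : fieldType) (P : P1n n L) k :
  P1n_coord P (lshift n k) = (P1_coord (P k)).1.
Proof. by rewrite /P1n_coord (unsplitK (inl k)). Qed.

Lemma P1n_coord_rshift (L : fieldType) (P : P1n n L) k :
  P1n_coord P (rshift n k) = (P1_coord (P k)).2.
Proof. by rewrite /P1n_coord (unsplitK (inr k)). Qed.

Lemma mmap_ext (L : fieldType) (i : {rmorphism K -> L}) (r s : 'I_(n + n) -> L) F :
  r =1 s -> mpoly.mmap i r F = mpoly.mmap i s F.
Proof.
by move=> rs; apply: eq_bigr => m _; congr (_ * _); apply: mpoly.mmap1_eq.
Qed.

Lemma mmap_mvarX (L : fieldType) (i : {rmorphism K -> L}) r k :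
  mpoly.mmap i r (mvarX k) = r (lshift n k).
Proof. by rewrite mpoly.mmapX mpoly.mmap1U. Qed.

Lemma mmap_mvarY (L : fieldType) (i : {rmorphism K -> L}) r k :
  mpoly.mmap i r (mvarY k) = r (rshift n k).
Proof. by rewrite mpoly.mmapX mpoly.mmap1U. Qed.

Definition mhomog_mon (k : 'I_n) (a b : nat) : mpoly.multinom (n + n) :=
  mpoly.mnm_add (mpoly.mnm_muln (mpoly.mnm1 (lshift n k)) a)
    (mpoly.mnm_muln (mpoly.mnm1 (rshift n k)) b).

Definition homogenize (k : 'I_n) (g : {poly K}) : mp :=
  \sum_(i < size g) g`_i *: mpoly.mpolyX K (mhomog_mon k i ((size g).-1 - i)).

Lemma homogenize_mhom k g : multihomogeneous (homogenize k g).
Proof.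
exists (fun k' => (k == k') * (size g).-1)%N => m.
rewrite /homogenize raddf_sum /= => h.
have [i /eqP mE] : exists i : 'I_(size g), mhomog_mon k i ((size g).-1 - i) == m.
  apply/existsP; apply: contraNT h; rewrite negb_exists => /forallP h.
  by rewrite big1 // => i _; rewrite mpoly.mcoeffZ mpoly.mcoeffX (negbTE (h i)) mulr0.
move=> k'; rewrite -mE /mhomog_mon !mpoly.mnmDE !mpoly.mulmnE !mpoly.mnm1E.
rewrite !eq_lshift !eq_rshift eq_lrshift eq_rlshift !mul0n addn0 add0n -mulnDr.
by rewrite subnKC // -ltnS prednK ?ltn_ord // (leq_ltn_trans _ (ltn_ord i)).
Qed.

Lemma mmap_homogenize_Some (L : fieldType) (i : {rmorphism K -> L})
    (Q : P1n n L) k g (b : L) : Q k = Some b ->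
  mpoly.mmap i (P1n_coord Q) (homogenize k g) = (map_poly i g).[b].
Proof.
move=> Qk; rewrite /homogenize raddf_sum /= horner_coef size_map_poly.
apply: eq_bigr => l _.
rewrite mpoly.mmapZ coef_map; congr (_ * _).
rewrite /mhomog_mon mpoly.mpolyXD rmorphM /= -!mpoly.mpolyXn !rmorphXn /=.
rewrite -/(mvarX k) -/(mvarY k) mmap_mvarX mmap_mvarY P1n_coord_lshift P1n_coord_rshift.
by rewrite Qk /= expr1n mulr1.
Qed.

(** Points have coordinates normalised to (x, 1) or (1, 0). These inhomogeneous relations force
    every common zero of the ideal in affine space to be the coordinate vector of a point of the
    product of lines, so the affine Nullstellensatz applies. *)
Definition normalized_ideal (I : mp -> Prop) : Prop :=
  forall k, I (mvarY k - 1) \/ (I (mvarY k) /\ I (mvarX k - 1)).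

Definition subvariety_of (I : mp -> Prop) : subvariety n K :=
  @Subvariety n K [set F | multihomogeneous F /\ I F]
    (fun F h => proj1 h).

Definition point_ideal (L : fieldType) (i : {rmorphism K -> L}) (Q : P1n n L) (F : mp) :=
  mpoly.mmap i (P1n_coord Q) F = 0.

Lemma point_ideal_prime (L : fieldType) (i : {rmorphism K -> L}) (Q : P1n n L) :
  prime_ideal (point_ideal i Q).
Proof.
rewrite /point_ideal; split.
- exact: rmorph0.
- by rewrite rmorph1; apply/eqP/oner_neq0.
- by move=> a b ha hb; rewrite rmorphD /= ha hb addr0.
- by move=> a b hb; rewrite rmorphM /= hb mulr0.
- by move=> a b /eqP; rewrite rmorphM mulf_eq0 => /orP[]/eqP; [left|right].
Qed.

Lemma point_ideal_normalized (L : fieldType) (i : {rmorphism K -> L}) (Q : P1n n L) :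
  normalized_ideal (point_ideal i Q).
Proof.
move=> k; rewrite /point_ideal !rmorphB !rmorph1 /= !(mmap_mvarY, mmap_mvarX).
rewrite P1n_coord_lshift P1n_coord_rshift.
by case: (Q k) => [x|] /=; [left|right]; rewrite ?subrr.
Qed.

Section Filter.
Variables (Kbar : fieldType) (j : {rmorphism K -> Kbar}).

(** The ideal of the point that [U] defines in the ultrapower of [Kbar]: a generic point made out of
    points over [Kbar]. *)
Definition ae_ideal (U : set_system (P1n n Kbar)) (F : mp) : Prop :=
  U [set Q | point_ideal j Q F].

Variables (U : set_system (P1n n Kbar)) (UU : UltraFilter U).

Lemma ultra_or (A B : set (P1n n Kbar)) : U (A `|` B) -> U A \/ U B.
Proof.
move=> UAB; have [?|UA] := in_ultra_setVsetC A UU; [by left|right].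
by apply: filterS (filterI UAB UA) => x [[]].
Qed.

Lemma ae_ideal_prime : prime_ideal (ae_ideal U).
Proof.
have P Q := point_ideal_prime j Q.
rewrite /ae_ideal; split.
- by apply: filterE => Q; have [] := P Q.
- have -> : [set Q | point_ideal j Q 1] = set0.
    by rewrite -subset0 => Q /=; have [] := P Q.
  exact: filter_not_empty.
- by move=> a b Ua Ub; apply: filterS (filterI Ua Ub) => Q [] /=; case: (P Q) => _ _ D _ _; exact: D.
- by move=> a b; apply: filterS => Q /=; case: (P Q) => _ _ _ M _; exact: M.
- move=> a b Uab; apply: ultra_or; apply: filterS Uab => Q /=.
  by case: (P Q) => _ _ _ _; exact.
Qed.

Lemma ae_ideal_normalized : normalized_ideal (ae_ideal U).
Proof.
move=> k; have : U ([set Q | point_ideal j Q (mvarY k - 1)] `|`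
   [set Q | point_ideal j Q (mvarY k) /\ point_ideal j Q (mvarX k - 1)]).
  by apply: filterE => Q /=; exact: point_ideal_normalized.
move=> /ultra_or[|h]; [by left|right].
by split; apply: filterS h => Q [].
Qed.

End Filter.

Section Closure.
Variables (Kbar : closedFieldType) (j : {rmorphism K -> Kbar}).

Lemma normalized_nullstellensatz (I : mp -> Prop) G :
  prime_ideal I -> normalized_ideal I -> ~ I G ->
  exists R : P1n n Kbar, (forall F, I F -> point_ideal j R F) /\ ~ point_ideal j R G.
Proof.
move=> Ip In IG; have [r [r0 rG]] := nullstellensatz j Ip IG.
pose R : P1n n Kbar := fun k => if r (rshift n k) == 1 then Some (r (lshift n k)) else None.
have rR i : P1n_coord R i = r i.
  case: (fintype.splitP i) => k.
    move=> ik; have -> : i = lshift n k by exact: val_inj.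
    rewrite P1n_coord_lshift /R; case: eqP => //= h.
    have [/r0|[_ /r0]] := In k; rewrite rmorphB rmorph1 /=.
      by rewrite mmap_mvarY => /eqP; rewrite subr_eq0 => /eqP.
    by rewrite mmap_mvarX => /eqP; rewrite subr_eq0 => /eqP.
  move=> ik; have -> : i = rshift n k by exact: val_inj.
  rewrite P1n_coord_rshift /R; case: eqP => //= h.
  have [/r0|[/r0 + _]] := In k; first rewrite rmorphB rmorph1 /=.
    by rewrite mmap_mvarY => /eqP; rewrite subr_eq0 => /eqP.
  by rewrite mmap_mvarY => ->.
exists R; rewrite /point_ideal; split=> [F IF|]; rewrite (mmap_ext _ _ rR); first exact: r0.
exact/eqP.
Qed.

(** If two closed sets covered it and neither did alone, each would have an equation outside [I].
    The product of the two is outside [I] by primality, and the Nullstellensatz gives a point where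
    it does not vanish. *)
Lemma subvariety_of_irreducible (I : mp -> Prop) :
  prime_ideal I -> normalized_ideal I ->
  irreducible_closed j (points (subvariety_of I) j).
Proof.
move=> Ip In; case: (Ip) => I_0 I_1 ID IM IP; split.
- by exists (subvariety_of I).
- have [R [R0 _]] := normalized_nullstellensatz Ip In I_1.
  by exists R => F [_ /R0].
- move=> Z1 Z2 [V1 ->] [V2 ->] sub.
  apply: contrapT => /not_orP[/nonsubset[Q1 [ZQ1 nQ1]] /nonsubset[Q2 [ZQ2 nQ2]]].
  move: nQ1 => /existsNP[F1 /not_implyP[E1 nF1]].
  move: nQ2 => /existsNP[F2 /not_implyP[E2 nF2]].
  have nI1 : ~ I F1.
    by apply: contra_not nF1 => IF1; apply: ZQ1; split => //; exact: equations_mhom E1.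
  have nI2 : ~ I F2.
    by apply: contra_not nF2 => IF2; apply: ZQ2; split => //; exact: equations_mhom E2.
  have [R [R0 RF]] : exists R, (forall F, I F -> point_ideal j R F) /\
      ~ point_ideal j R (F1 * F2).
    by apply: normalized_nullstellensatz => // /IP[].
  have : points (subvariety_of I) j R by move=> F [_ /R0].
  rewrite /point_ideal rmorphM /= in RF.
  move=> /sub[] h; apply: RF; first by rewrite (h F1 E1) mul0r.
  by rewrite (h F2 E2) mulr0.
Qed.

(** The closure of the point [R] over [K] lies strictly inside the zero set of [I]: [F] vanishes on
    the former, and by the Nullstellensatz not on all of the latter. *)
Lemma has_chain1 (V : subvariety n K) (I : mp -> Prop) (F : mp) (R : P1n n Kbar) :
  prime_ideal I -> normalized_ideal I -> (forall E, equations V E -> I E) ->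
  multihomogeneous F -> ~ I F -> (forall E, I E -> point_ideal j R E) ->
  point_ideal j R F -> has_chain j (points V j) 1.
Proof.
move=> Ip In VI Fh IF RI RF.
have IR := subvariety_of_irreducible (point_ideal_prime j R) (point_ideal_normalized j R).
have II := subvariety_of_irreducible Ip In.
have sub : points (subvariety_of (point_ideal j R)) j `<=` points (subvariety_of I) j.
  by move=> Q h E [Eh IE]; apply: h; split=> //; exact: RI.
have subV : points (subvariety_of I) j `<=` points V j.
  by move=> Q h E EV; apply: h; split; [exact: equations_mhom EV|exact: VI].
exists (fun i => if i is 0 then points (subvariety_of (point_ideal j R)) j
  else points (subvariety_of I) j); split.
  by move=> [|i] _; split => //; exact: subset_trans subV.
case=> // _; split=> // sub'.
have [R' [R'I R'F]] := normalized_nullstellensatz Ip In IF.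
apply: R'F; apply: (sub' R') => [E [_ /R'I]//|]; by split.
Qed.

(* If no g works, an ultrafilter on V avoiding the zero sets of all g (Q k) has a prime ideal of
   limit equations containing no equation of the k-th coordinate: a chain of length 1. *)
Lemma dimension_zero_coord_algebraic (V : subvariety n K) (k : 'I_n) :
  algebraic_closure j -> dimension_zero j V ->
  exists2 g : {poly K}, g != 0 &
    forall Q, points V j Q -> forall b, Q k = Some b -> root (map_poly j g) b.
Proof.
move=> hj [_ nch]; apply: contrapT => ng; apply: nch.
pose A (g : {poly K}) : set (P1n n Kbar) :=
  [set Q | points V j Q /\ exists2 b, Q k = Some b & ~~ root (map_poly j g) b].
have A0 (g : {poly K}) : g != 0 -> A g !=set0.
  move=> g0; apply: contrapT => nA; apply: ng; exists g => // Q VQ b Qb.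
  by apply: contrapT => /negP rb; apply: nA; exists Q; split=> //; exists b.
pose FF : set_system (P1n n Kbar) := [set B | exists2 g, g != 0 & A g `<=` B].
have FFF : ProperFilter FF.
  apply: Build_ProperFilter_ex => [B [g /A0[Q AQ] /(_ Q AQ)] hQ|]; first by exists Q.
  split; first by exists 1; rewrite ?oner_neq0.
  - move=> B1 B2 [g1 g10 s1] [g2 g20 s2]; exists (g1 * g2); first by rewrite mulf_neq0.
    move=> Q [VQ [b Qb]]; rewrite rmorphM rootM negb_or => /andP[r1 r2].
    by split; [apply: s1|apply: s2]; split => //; exists b.
  - by move=> B1 B2 B12 [g g0 s]; exists g => //; exact: subset_trans B12.
have [U [UU FU]] := ultraFilterLemma FFF.
have Ip := ae_ideal_prime j UU; have In := ae_ideal_normalized j UU.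
have [R [RI _]] : exists R, (forall F, ae_ideal j U F -> point_ideal j R F) /\ ~ point_ideal j R 1.
  by case: (Ip) => _ I_1 _ _ _; exact: normalized_nullstellensatz.
have Usome : U [set Q | point_ideal j Q (mvarY k - 1)].
  apply: FU; exists 1; first exact: oner_neq0.
  move=> Q [_ [b Qb _]]; rewrite /= /point_ideal rmorphB rmorph1 /= mmap_mvarY.
  by rewrite P1n_coord_rshift Qb /= subrr.
have [b Rb] : exists b, R k = Some b.
  have := RI _ Usome; rewrite /point_ideal rmorphB rmorph1 /= mmap_mvarY P1n_coord_rshift.
  case: (R k) => [b|] /=; first by exists b.
  by rewrite sub0r => /eqP; rewrite oppr_eq0 oner_eq0.
(* [Kbar] is algebraic over [K], so [b] satisfies an equation [g], which the limit ideal cannot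
   contain because [A g] belongs to [U]. *)
have [g g0 gb] := hj b.
apply: (@has_chain1 V (ae_ideal j U) (homogenize k g) R) => //.
- move=> E EV; apply: FU; exists 1; first exact: oner_neq0.
  by move=> Q [VQ _]; exact: VQ.
- exact: homogenize_mhom.
- rewrite /ae_ideal => Ug; have Ag : U (A g) by apply: FU; exists g.
  have E : [set Q | point_ideal j Q (homogenize k g)] `&` A g = set0.
    rewrite -subset0 => Q [/= + [VQ [c Qc]]].
    by rewrite /point_ideal (mmap_homogenize_Some _ _ Qc) => rc; rewrite /root rc eqxx.
  by apply: (@filter_not_empty _ U); rewrite -E; exact: filterI.
- by rewrite /point_ideal (mmap_homogenize_Some _ _ Rb); exact/eqP.
Qed.

(** Passage from [Kbar] to arbitrary extensions, such as completions: by the Nullstellensatz for its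
    ideal, a point over [L] violating the equation would specialise to a point over [Kbar] violating
    it. *)
Lemma points_coord_root (V : subvariety n K) (k : 'I_n) (g : {poly K}) :
  (forall Q, points V j Q -> forall b, Q k = Some b -> root (map_poly j g) b) ->
  forall (L : fieldType) (i : {rmorphism K -> L}) Q, points V i Q ->
  forall b, Q k = Some b -> root (map_poly i g) b.
Proof.
move=> h L i Q VQ b Qb; apply: contrapT => nr.
have nI : ~ point_ideal i Q (homogenize k g).
  by rewrite /point_ideal (mmap_homogenize_Some _ _ Qb) => /eqP.
have [R [R0 RG]] := normalized_nullstellensatz (point_ideal_prime i Q) (point_ideal_normalized i Q) nI.
have VR : points V j R by move=> F /VQ; exact: R0.
have [c Rc] : exists c, R k = Some c.
  have : point_ideal i Q (mvarY k - 1).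
    by rewrite /point_ideal rmorphB rmorph1 /= mmap_mvarY P1n_coord_rshift Qb /= subrr.
  move=> /R0; rewrite /point_ideal rmorphB rmorph1 /= mmap_mvarY P1n_coord_rshift.
  case: (R k) => [c|] /=; first by exists c.
  by rewrite sub0r => /eqP; rewrite oppr_eq0 oner_eq0.
apply: RG; rewrite /point_ideal (mmap_homogenize_Some _ _ Rc).
exact/eqP/(h R VR).
Qed.

End Closure.

End ZeroDimensional.

(** * Extension of ultrametric absolute values *)

Section AbsvalAlgebra.
Variable R : realType.

Lemma absval1 (K : fieldType) (v : absval R K) : v 1 = 1.
Proof.
have v1 : v 1 != 0 by rewrite absval_eq0 oner_neq0.
by apply: (mulfI v1); rewrite -absvalM !mulr1.
Qed.

Lemma absvalV (K : fieldType) (v : absval R K) x : v x^-1 = (v x)^-1.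
Proof.
have [->|x0] := eqVneq x 0; first by rewrite invr0 absval0 invr0.
have vx : v x != 0 by rewrite absval_eq0.
by apply: (mulfI vx); rewrite -absvalM !divff // absval1.
Qed.

Lemma absvalX (K : fieldType) (v : absval R K) x n : v (x ^+ n) = v x ^+ n.
Proof. by elim: n => [|n IHn]; rewrite ?absval1 // !exprS absvalM IHn. Qed.

Lemma absval_gt0 (K : fieldType) (v : absval R K) x : (0 < v x) = (x != 0).
Proof. by rewrite lt0r absval_eq0 absval_ge0 andbT. Qed.

End AbsvalAlgebra.

Section ChevalleyExtension.
Variables (R : realType) (F E : fieldType) (iota : {rmorphism F -> E}).
Variables (w : absval R F).
Hypothesis wu : ultrametric w.

Definition ring_set (A : set E) : Prop :=
  [/\ A 1, forall x y, A x -> A y -> A (x - y)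
    & forall x y, A x -> A y -> A (x * y)].

(** Requiring that the ring meet [F] exactly in the valuation ring of [w] replaces the usual order
    on pairs of a local ring and its maximal ideal. *)
Definition lying_over (A : set E) : Prop :=
  ring_set A /\ forall c, A (iota c) <-> w c <= 1.

Lemma integers_lying_over : lying_over (iota @` [set c | w c <= 1]).
Proof.
split; first split.
- by exists 1; rewrite ?rmorph1 //= absval1.
- move=> _ _ [x /= x1 <-] [y /= y1 <-]; exists (x - y); rewrite ?rmorphB //=.
  by apply: le_trans (wu _ _) _; rewrite absvalN ge_max x1.
- move=> _ _ [x /= x1 <-] [y /= y1 <-]; exists (x * y); rewrite ?rmorphM //=.
  by rewrite absvalM mulr_ile1 ?absval_ge0.
move=> c; split=> [[d /= d1 /fmorph_inj <-] //|c1]; by exists c.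
Qed.

Lemma maximal_lying_over : exists A, lying_over A /\
  forall B, lying_over B -> A `<=` B -> B `<=` A.
Proof.
pose P := [set A | A = set0 \/ lying_over A].
have [C CP Ctot|A [PA Amax]] := @Zorn_bigcup E P.
  have [C0|] := pselect (forall A, C A -> A = set0).
    by left; rewrite -subset0 => x [A /C0->].
  move=> /existsNP[A0 /not_implyP[CA0 A0n]]; right.
  have C1 A : C A -> A `<=` \bigcup_(X in C) X by move=> CA x Ax; exists A.
  have CL A x : C A -> A x -> lying_over A.
    by move=> CA Ax; case: (CP A CA) => // A0'; move: Ax; rewrite A0'.
  have CL0 : lying_over A0 by case: (CP A0 CA0).
  have join x y : (\bigcup_(X in C) X) x -> (\bigcup_(X in C) X) y ->
      exists A, [/\ C A, lying_over A, A x & A y].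
    move=> [A CA Ax] [B CB By]; case: (Ctot A B CA CB) => s.
      by exists B; split=> //; [exact: CL By|exact: s].
    by exists A; split=> //; [exact: CL Ax|exact: s].
  split; first split.
  - by apply: (C1 A0) => //; case: CL0 => -[].
  - move=> x y /join h /h[A [CA [[_ AB _] _] Ax Ay]]; apply: (C1 A) => //; exact: AB.
  - move=> x y /join h /h[A [CA [[_ _ AM] _] Ax Ay]]; apply: (C1 A) => //; exact: AM.
  move=> c; split=> [[A CA Ac]|c1]; first by apply/(proj2 (CL A _ CA Ac)).
  by apply: (C1 A0) => //; apply/(proj2 CL0).
have LA : lying_over A.
  case: PA => // A0; have [] := Amax (iota @` [set c | w c <= 1]); last first.
    by right; exact: integers_lying_over.
  rewrite A0; split=> // h; have [] := h 1; exists 1; rewrite ?rmorph1 //=.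
  by rewrite absval1.
exists A; split=> // B LB AB; apply: contrapT => nBA.
by apply: (Amax B); [split|right].
Qed.

Section Maximal.
Variables (A : set E).
Hypothesis LA : lying_over A.
Hypothesis Amax : forall B, lying_over B -> A `<=` B -> B `<=` A.

Let A1 : A 1. Proof. by case: LA => -[]. Qed.
Let AB x y : A x -> A y -> A (x - y). Proof. by case: LA => -[_ h _ _]; exact: h. Qed.
Let AM x y : A x -> A y -> A (x * y). Proof. by case: LA => -[_ _ h _]; exact: h. Qed.
Let A0 : A 0. Proof. by rewrite -(subrr 1); exact: AB. Qed.
Let AN x : A x -> A (- x). Proof. by rewrite -sub0r; exact: AB. Qed.
Let AD x y : A x -> A y -> A (x + y).
Proof. by move=> Ax Ay; rewrite -[y]opprK; apply: AB => //; exact: AN. Qed.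
Let AX x n : A x -> A (x ^+ n).
Proof. by move=> Ax; elim: n => [|n IHn]; rewrite ?expr0 // exprS; exact: AM. Qed.
Let Ai c : A (iota c) <-> w c <= 1. Proof. by case: LA. Qed.
Let Asum (I : Type) (r : seq I) (P : pred I) (G : I -> E) :
  (forall i, P i -> A (G i)) -> A (\sum_(i <- r | P i) G i).
Proof. by move=> h; elim/big_ind: _. Qed.

Let max_ideal_neq1 z b : w z < 1 -> A b -> iota z * b != 1.
Proof.
move=> z1 Ab; apply/eqP => zb; have z0 : z != 0.
  by apply: contra_eq_neq zb => ->; rewrite rmorph0 mul0r eq_sym oner_neq0.
have bE : b = iota z^-1.
  by rewrite fmorphV -[b]mul1r -(mulVf (x := iota z)) ?fmorph_eq0 // -mulrA zb mulr1.
move: Ab; rewrite bE => /Ai; rewrite absvalV invf_le1 ?absval_gt0 //.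
by rewrite leNgt z1.
Qed.

(** Divisibility is total in the valuation ring of [w], so a sum over its maximal ideal collapses to
    a single term. *)
Let max_ideal_add z y a b : w z < 1 -> w y < 1 -> A a -> A b ->
  exists t d, [/\ w t < 1, A d & iota z * a + iota y * b = iota t * d].
Proof.
wlog yz : z y a b / w y <= w z => [hw z1 y1 Aa Ab|].
  have /orP[h|h] := le_total (w y) (w z); first exact: hw.
  by rewrite addrC; exact: hw.
move=> z1 y1 Aa Ab; have [z0|z0] := eqVneq z 0.
  have y0 : y = 0.
    by apply/eqP; rewrite -(absval_eq0 w) eq_le absval_ge0 andbT (le_trans yz) // z0 absval0.
  by exists 0, 0; rewrite z0 y0 rmorph0 !mul0r addr0 absval0 ltr01.
exists z, (a + iota (y / z) * b); split=> //.
  apply: AD => //; apply: AM => //; apply/Ai.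
  by rewrite absvalM absvalV ler_pdivrMr ?absval_gt0 // mul1r.
by rewrite mulrDr mulrA -rmorphM mulrCA divff // mulr1.
Qed.

(** Inverting the powers of [1 - iota z * b] gives a ring that still lies over [w], so maximality
    puts the inverse in [A]. *)
Let unit_1B z b : w z < 1 -> A b ->
  1 - iota z * b != 0 /\ A (1 - iota z * b)^-1.
Proof.
move=> z1 Ab; set u := 1 - iota z * b.
have Au : A u by apply: AB => //; apply: AM => //; apply/Ai/ltW.
have u0 : u != 0.
  by rewrite subr_eq0 eq_sym; exact: max_ideal_neq1.
split=> //; pose B := [set x | exists a n, A a /\ x = a / u ^+ n].
have uE n : exists2 b', A b' & u ^+ n = 1 - iota z * b'.
  elim: n => [|n [b' Ab' E']]; first by exists 0; rewrite // mulr0 subr0.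
  exists (b + b' - b * (iota z * b')); last by rewrite exprS E' /u; ring.
  apply: AB; [exact: AD|apply: AM => //; apply: AM => //; exact/Ai/ltW].
apply: (Amax (B := B)); last by exists 1, 1%N; rewrite mul1r expr1.
- split; first split.
  + by exists 1, 0%N; rewrite expr0 divr1.
  + move=> _ _ [a [n [Aa ->]]] [c [m [Ac ->]]].
    exists (a * u ^+ m - c * u ^+ n), (n + m)%N; split.
      by apply: AB; apply: AM => //; exact: AX.
    by rewrite exprD; field; rewrite !expf_neq0.
  + move=> _ _ [a [n [Aa ->]]] [c [m [Ac ->]]].
    exists (a * c), (n + m)%N; split; first exact: AM.
    by rewrite exprD; field; rewrite !expf_neq0.
  + move=> c; split; last by move=> /Ai ?; exists (iota c), 0%N; rewrite expr0 divr1.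
    move=> [a [n [Aa /eqP cE]]]; rewrite leNgt; apply/negP => c1.
    have c0 : c != 0 by rewrite -(absval_gt0 w) (lt_trans _ c1).
    have [b' Ab' unE] := uE n.
    have cV : w c^-1 < 1 by rewrite absvalV invf_lt1 // absval_gt0.
    have [t [d [t1 Ad tE]]] := max_ideal_add z1 cV Ab' Aa.
    have /eqP := max_ideal_neq1 t1 Ad; apply; rewrite -tE.
    have -> : a = iota c * u ^+ n.
      by rewrite (eqP cE) mulfVK // expf_neq0.
    by rewrite mulrA -rmorphM mulVf // rmorph1 mul1r unE addrC subrK.
- by move=> x Ax; exists x, 0%N; rewrite expr0 divr1.
Qed.

(** [rel x n] says that the maximal ideal of [w] generates the unit ideal of the ring generated by
    [x] over [A], as witnessed in degree at most [n]. *)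
Let rel (x : E) (n : nat) := exists (p : {poly E}) (y : F),
  [/\ forall i, A p`_i, (size p <= n.+1)%N, w y < 1 & iota y * p.[x] = 1].

Let rel0 x : ~ rel x 0.
Proof.
move=> [p [y [Ap /size1_polyC pE y1]]]; rewrite pE hornerC => /eqP.
by apply/negP; exact: max_ideal_neq1.
Qed.

(** By maximality the ring generated by [x] over [A] does not lie over [w], so it contains [iota c]
    for some [c] with [w c > 1]; multiplying by the inverse of [c] gives the relation. *)
Let rel_ex x : ~ A x -> exists n, rel x n.
Proof.
move=> nAx; pose B := [set z | exists2 p : {poly E}, forall i, A p`_i & z = p.[x]].
have AB' : A `<=` B.
  move=> a Aa; exists a%:P; rewrite ?hornerC // => i; rewrite coefC.
  by case: eqP.
have Bx : B x.
  by exists 'X; rewrite ?hornerX // => i; rewrite coefX; case: eqP.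
have rB : ring_set B.
  split; first exact: AB'.
  - move=> _ _ [p Ap ->] [q Aq ->]; exists (p - q); rewrite ?hornerE // => i.
    by rewrite coefB; exact: AB.
  - move=> _ _ [p Ap ->] [q Aq ->]; exists (p * q); rewrite ?hornerE // => i.
    by rewrite coefM; apply: Asum => k _; exact: AM.
have [LB|] := pselect (lying_over B); first by case: nAx; exact: (Amax LB AB').
move=> /not_andP[//|/existsNP[c cP]].
have [p Ap cE] : B (iota c).
  by apply: contrapT => nB; apply: cP; split => // /Ai/AB'.
have c1 : 1 < w c.
  by rewrite ltNge; apply/negP => c1; apply: cP; split=> // _; exists p.
have c0 : c != 0 by rewrite -(absval_gt0 w) (lt_trans _ c1).
exists (size p), p, c^-1; split=> //.
  by rewrite absvalV invf_lt1 // absval_gt0.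
by rewrite -cE -rmorphM mulVf // rmorph1.
Qed.

(** In the relation for [x^-1] the constant term can be moved over to form the unit [u]. Multiplied
    by [x ^+ n.+1], it expresses this power through lower ones, and substituting lowers the degree
    of the relation for [x]. *)
Let rel_step x n m : x != 0 -> (m <= n.+1)%N -> rel x n.+1 -> rel x^-1 m -> rel x n.
Proof.
move=> x0 mn [p [y [Ap sp y1 pE]]] [q [z [Aq sq z1 qE]]].
have [u0 Au] := unit_1B z1 (Aq 0%N); set u := 1 - _ in u0 Au.
pose s := \poly_(k < n.+1) (q`_(n.+1 - k) / u).
have As i : A s`_i by rewrite coef_poly; case: ifP => // _; exact: AM.
have xE : x ^+ n.+1 = iota z * s.[x].
  have : u = iota z * \sum_(i < n.+1) q`_i.+1 * x^-1 ^+ i.+1.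
    rewrite /u -qE (horner_coef_wide _ (leq_trans sq (_ : m.+1 <= n.+2)%N)) //.
    by rewrite big_ord_recl /= expr0 mulr1 mulrDr addrC addKr.
  move=> uE; apply: (mulfI u0); rewrite {1}uE -mulrA [RHS]mulrCA; congr (_ * _).
  rewrite /s horner_poly mulr_suml mulr_sumr (reindex_inj rev_ord_inj) /=.
  apply: eq_bigr => i _; have iE : (n - i).+1 = (n.+1 - i)%N by rewrite subSn // -ltnS.
  rewrite subSS iE [RHS]mulrA [u * _]mulrCA divff // mulr1 -mulrA; congr (_ * _).
  rewrite -[X in x ^+ X](subnK (ltnW (ltn_ord i))).
  by rewrite exprD mulrA exprVn mulVf ?mul1r // expf_neq0.
exists (\poly_(k < n.+1) p`_k + (p`_n.+1 * iota z) *: s), y; split=> //.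
- move=> i; rewrite coefD coef_poly coefZ; apply: AD; first by case: ifP.
  by apply: AM => //; apply: AM => //; exact/Ai/ltW.
- rewrite (leq_trans (size_polyD _ _)) // geq_max size_poly.
  by rewrite (leq_trans (size_scale_leq _ _)) // size_poly.
- rewrite -pE; congr (_ * _); rewrite hornerD hornerZ -mulrA -xE horner_poly.
  by rewrite [RHS](horner_coef_wide _ sp) [RHS]big_ord_recr.
Qed.

Let rel_absurd x n m : x != 0 -> rel x n -> rel x^-1 m -> False.
Proof.
have [N] := ubnP (n + m); elim: N x n m => // N IHN x n m nmN x0 rn rm.
wlog mn : x n m nmN x0 rn rm / (m <= n)%N => [hw|].
  have /orP[h|h] := leq_total m n; first exact: (hw x n m).
  by apply: (hw x^-1 m n); rewrite ?invrK ?invr_eq0 // addnC.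
case: n nmN rn mn => [|n] nmN rn mn; first exact: rel0 rn.
have rn' := rel_step x0 mn rn rm; apply: (IHN x n m) => //.
Qed.

(* Chevalley's extension argument. *)
Lemma maximal_valuation_ring x : x != 0 -> ~ A x -> A x^-1.
Proof.
move=> x0 /rel_ex[n rn]; apply: contrapT => /rel_ex[m]; exact: rel_absurd rn.
Qed.

(** [x ^+ n] and [iota c] differ by a unit of [A], so an extension of [w] with valuation ring [A]
    must take at [x] the n-th root of [w c]. *)
Definition assoc_value (x : E) (n : nat) (c : F) : Prop :=
  [/\ x != 0, (0 < n)%N, c != 0, A (x ^+ n / iota c) & A (iota c / x ^+ n)].

(** As [A] is a valuation ring, this is membership in its maximal ideal. *)
Let small x := ~ (x != 0 /\ A x^-1).

Let small_add x y : small x -> small y -> small (x + y).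
Proof.
wlog xy : x y / A (y / x) => [hw sx sy|sx sy [xy0 Axy]].
  have [->|x0] := eqVneq x 0; first by rewrite add0r.
  have [->|y0] := eqVneq y 0; first by rewrite addr0.
  have [h|h] := pselect (A (y / x)); first exact: hw.
  rewrite addrC; apply: hw => //; rewrite -[x / y]invrK invf_div.
  by apply: maximal_valuation_ring; rewrite ?mulf_neq0 ?invr_eq0.
have [x0|x0] := eqVneq x 0.
  by move: xy0 Axy; rewrite x0 add0r => y0 Ay; exact: sy.
apply: sx; split=> //; have -> : x^-1 = (x + y)^-1 * (1 + y / x).
  by apply: (mulfI xy0); rewrite mulrA divff // mul1r; field.
by apply: AM => //; exact: AD.
Qed.

Let max_term n (f : nat -> E) : (exists2 i, (i < n)%N & f i != 0) ->
  exists2 i, (i < n)%N /\ f i != 0 & forall k, (k < n)%N -> A (f k / f i).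
Proof.
elim: n => [[i]//|n IHn] [i]; rewrite ltnS => lin fi.
have [[k kn fk]|nex] := pselect (exists2 i, (i < n)%N & f i != 0).
  have [m [mn fm] mmax] := IHn (ex_intro2 _ _ k kn fk).
  have [h|h] := pselect (A (f n / f m)).
    exists m; first by split=> //; exact: ltnW.
    by move=> l; rewrite ltnS leq_eqVlt => /orP[/eqP->//|]; exact: mmax.
  have fn : f n != 0 by apply: contra_notN h => /eqP->; rewrite mul0r.
  have h' : A (f m / f n).
    rewrite -[f m / f n]invrK invf_div.
    by apply: maximal_valuation_ring => //; rewrite mulf_neq0 ?invr_eq0.
  exists n => // l; rewrite ltnS leq_eqVlt => /orP[/eqP->|/mmax h'']; first by rewrite divff.
  have -> : f l / f n = (f l / f m) * (f m / f n) by field; rewrite fn.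
  exact: AM.
have z k : (k < n)%N -> f k = 0.
  by move=> kn; apply/eqP/negP => /negP fk; apply: nex; exists k.
have inn : i = n.
  apply/eqP; rewrite eqn_leq lin /= leqNgt; apply: contraNN fi => lt.
  by rewrite z.
rewrite inn in fi; exists n => // l; rewrite ltnS leq_eqVlt => /orP[/eqP->|/z->].
  by rewrite divff.
by rewrite mul0r.
Qed.

(** In a vanishing sum two terms share the largest value: otherwise dividing by the largest term
    would put -1 in the maximal ideal. Equality for the terms of degrees [k] and [m] associates
    [x ^+ (k - m)] with a quotient of coefficients. *)
Lemma assoc_value_ex x : x != 0 -> algebraicOver iota x ->
  exists n c, assoc_value x n c.
Proof.
move=> x0 [p p0 px]; set N := size p.
have sp : (0 < N)%N by rewrite size_poly_gt0.
pose f i := iota p`_i * x ^+ i.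
have sf : \sum_(i < N) f i = 0.
  rewrite -[RHS](rootP px) horner_coef size_map_poly.
  by apply: eq_bigr => i _; rewrite coef_map.
have [m [mN fm] mmax] : exists2 i, (i < N)%N /\ f i != 0 &
    forall k, (k < N)%N -> A (f k / f i).
  apply: max_term; exists N.-1; first by rewrite prednK.
  by rewrite mulf_neq0 ?expf_neq0 // fmorph_eq0 -/(lead_coef p) lead_coef_eq0.
have [k [kN km fk Ak]] : exists k, [/\ (k < N)%N, k != m, f k != 0 & A (f m / f k)].
  apply: contrapT => nk.
  have : small (-1).
    have -> : -1 = \sum_(i < N | i != Ordinal mN) f i / f m.
      move: sf; rewrite (bigD1 (Ordinal mN)) //= => /eqP.
      rewrite addr_eq0 => /eqP fmE; rewrite -mulr_suml.
      by rewrite -[\sum_(i < N | _) _]opprK -fmE mulNr divff.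
    elim/big_ind: _ => // [[]|i im]; first by rewrite eqxx.
    move=> [fi0 Afi]; apply: nk; exists i; split=> //.
      by apply: contraNneq fi0 => ->; rewrite mul0r.
    by rewrite -invf_div.
  by apply; split; rewrite ?oppr_eq0 ?oner_neq0 // invrN invr1; exact: AN.
wlog lkm : k m kN mN fm fk km Ak mmax / (m < k)%N => [hw|].
  have /orP[h|h] : (m < k)%N || (k < m)%N by rewrite -neq_ltn eq_sym.
    exact: (hw k m).
  apply: (hw m k) => //; rewrite 1?eq_sym //; first exact: mmax.
  move=> l lN; have -> : f l / f k = (f l / f m) * (f m / f k) by rewrite mulrA mulfVK.
  by apply: AM => //; exact: mmax.
have Akm := mmax k kN.
move: fk fm; rewrite !mulf_eq0 !fmorph_eq0 !negb_or => /andP[pk _] /andP[pm _].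
have e : x ^+ k = x ^+ (k - m) * x ^+ m by rewrite -exprD subnK // ltnW.
exists (k - m)%N, (p`_m / p`_k); split; rewrite ?subn_gt0 ?mulf_neq0 ?invr_eq0 //.
  have -> : x ^+ (k - m) / iota (p`_m / p`_k) = f k / f m.
    by rewrite /f e fmorph_div; field; rewrite !fmorph_eq0 pk pm expf_neq0.
  exact: mmax.
have -> : iota (p`_m / p`_k) / x ^+ (k - m) = f m / f k.
  by rewrite /f e fmorph_div; field; rewrite !fmorph_eq0 pk !expf_neq0.
exact: Ak.
Qed.

Lemma assoc_value_unique x n c m d : assoc_value x n c -> assoc_value x m d ->
  w c ^+ m = w d ^+ n.
Proof.
suff le n' c' m' d' : assoc_value x n' c' -> assoc_value x m' d' -> w c' ^+ m' <= w d' ^+ n'.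
  by move=> h1 h2; apply/eqP; rewrite eq_le !le.
move=> [x0 n0 c0 A1' A2] [_ m0 d0 A3 A4].
have : A (iota (c' ^+ m' / d' ^+ n')).
  have -> : iota (c' ^+ m' / d' ^+ n') =
      (iota c' / x ^+ n') ^+ m' * (x ^+ m' / iota d') ^+ n'.
    rewrite !exprMn -!exprM [(m' * n')%N]mulnC !exprVn fmorph_div !rmorphXn /= -!exprM.
    by field; rewrite !expf_neq0 // fmorph_eq0.
  by apply: AM; exact: AX.
move=> /Ai; rewrite absvalM absvalV !absvalX ler_pdivrMr ?mul1r //.
by rewrite exprn_gt0 // absval_gt0.
Qed.

Hypothesis alg : forall x, algebraicOver iota x.

Lemma ext_value_ex x : exists r : R, 0 <= r /\ ((x = 0 /\ r = 0) \/ exists n c, assoc_value x n c /\ r ^+ n = w c).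
Proof.
have [->|x0] := eqVneq x 0; first by exists 0; split => //; left.
have [n [c nc]] := assoc_value_ex x0 (alg x); case: (nc) => _ n0 _ _ _.
exists (w c `^ n%:R^-1); split; first exact: powR_ge0.
right; exists n, c; split=> //.
rewrite -powR_mulrn ?powR_ge0 // -powRrM mulVf ?pnatr_eq0 -?lt0n //.
by rewrite powRr1 // absval_ge0.
Qed.

Definition ext_value x : R := projT1 (cid (ext_value_ex x)).

Lemma ext_value_ge0 x : 0 <= ext_value x.
Proof. by rewrite /ext_value; case: cid => r /= []. Qed.

Lemma ext_value0 : ext_value 0 = 0.
Proof.
rewrite /ext_value; case: cid => r /= [_ [[]//|[n [c [[]]]]]].
by rewrite eqxx.
Qed.

Lemma ext_valueE x n c : assoc_value x n c -> ext_value x ^+ n = w c.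
Proof.
move=> xnc; have [x0 n0 _ _ _] := xnc; rewrite /ext_value.
case: cid => r /= [r0 [[xE _]|[m [d [xmd rE]]]]]; first by rewrite xE eqxx in x0.
have [_ m0 _ _ _] := xmd; apply/eqP.
rewrite -(eqrXn2 m0) ?exprn_ge0 ?absval_ge0 // -exprM mulnC exprM rE.
by rewrite (assoc_value_unique xmd xnc).
Qed.

Lemma ext_value_uniq x n c (r : R) : 0 <= r -> assoc_value x n c -> r ^+ n = w c ->
  r = ext_value x.
Proof.
move=> r0 xnc rE; have [_ n0 _ _ _] := xnc; apply/eqP.
by rewrite -(eqrXn2 n0) ?ext_value_ge0 // rE (ext_valueE xnc).
Qed.

Lemma ext_value_eq0 x : (ext_value x == 0) = (x == 0).
Proof.
have [->|x0] := eqVneq x 0; first by rewrite ext_value0 eqxx.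
have [n [c xnc]] := assoc_value_ex x0 (alg x); have [_ n0 c0 _ _] := xnc.
apply/eqP => x1; have := ext_valueE xnc.
by rewrite x1 expr0n gtn_eqF //= => /esym/eqP; rewrite absval_eq0 (negbTE c0).
Qed.

Lemma ext_value_iota c : ext_value (iota c) = w c.
Proof.
have [->|c0] := eqVneq c 0; first by rewrite rmorph0 ext_value0 absval0.
apply/esym/(@ext_value_uniq _ 1 c); rewrite ?absval_ge0 ?expr1 //.
by split; rewrite ?fmorph_eq0 ?expr1 ?divff ?fmorph_eq0.
Qed.

Lemma ext_valueM x y : ext_value (x * y) = ext_value x * ext_value y.
Proof.
have [->|x0] := eqVneq x 0; first by rewrite mul0r ext_value0 mul0r.
have [->|y0] := eqVneq y 0; first by rewrite mulr0 ext_value0 mulr0.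
have [n [c xnc]] := assoc_value_ex x0 (alg x).
have [m [d ymd]] := assoc_value_ex y0 (alg y).
apply/esym/(@ext_value_uniq _ (n * m)%N (c ^+ m * d ^+ n)).
- by rewrite mulr_ge0 ?ext_value_ge0.
- case: xnc => _ n0 c0 A1' A2; case: ymd => _ m0 d0 A3 A4.
  split; rewrite ?mulf_neq0 ?expf_neq0 ?muln_gt0 ?n0 //.
    have -> : (x * y) ^+ (n * m) / iota (c ^+ m * d ^+ n) =
        (x ^+ n / iota c) ^+ m * (y ^+ m / iota d) ^+ n.
      rewrite !exprMn -!exprM [(m * n)%N]mulnC !exprVn rmorphM !rmorphXn /=.
      by field; rewrite !expf_neq0 // fmorph_eq0.
    by apply: AM; exact: AX.
  have -> : iota (c ^+ m * d ^+ n) / (x * y) ^+ (n * m) =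
      (iota c / x ^+ n) ^+ m * (iota d / y ^+ m) ^+ n.
    rewrite !exprMn -!exprVn -!exprM [(m * n)%N]mulnC !exprVn rmorphM !rmorphXn /=.
    by field; rewrite !expf_neq0.
  by apply: AM; exact: AX.
- rewrite exprMn exprM (ext_valueE xnc) mulnC exprM (ext_valueE ymd).
  by rewrite absvalM !absvalX.
Qed.

Lemma ext_value_le1 x : (ext_value x <= 1) <-> A x.
Proof.
have [->|x0] := eqVneq x 0; first by rewrite ext_value0 ler01.
have [n [c xnc]] := assoc_value_ex x0 (alg x); have [_ n0 c0 A1' A2] := xnc.
have -> : (ext_value x <= 1) = (w c <= 1).
  by rewrite -(ext_valueE xnc) expr_le1 ?ext_value_ge0.
split=> [c1|Ax].
  have Axn : A (x ^+ n).
    have -> : x ^+ n = (x ^+ n / iota c) * iota c by rewrite mulfVK // fmorph_eq0.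
    by apply: AM => //; exact/Ai.
  apply: contrapT => nAx; have Ax := maximal_valuation_ring x0 nAx; apply: nAx.
  have -> : x = x ^+ n * x^-1 ^+ n.-1.
    by rewrite -{1}(prednK n0) exprS exprVn mulfK // expf_neq0.
  by apply: AM => //; exact: AX.
apply/Ai; have -> : iota c = (iota c / x ^+ n) * x ^+ n by rewrite mulfVK // expf_neq0.
by apply: AM => //; exact: AX.
Qed.

Lemma ext_value_ultra x y : ext_value (x + y) <= Num.max (ext_value x) (ext_value y).
Proof.
wlog xy : x y / ext_value x <= ext_value y => [hw|].
  have /orP[h|h] := le_total (ext_value x) (ext_value y); first exact: hw.
  by rewrite addrC maxC; exact: hw.
rewrite (max_idPr xy); have [y0|y0] := eqVneq y 0.
  by rewrite y0 addr0 (le_trans xy) // y0.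
have y1 : 0 < ext_value y by rewrite lt0r ext_value_eq0 y0 ext_value_ge0.
have -> : x + y = (x / y + 1) * y by rewrite mulrDl mulfVK // mul1r.
rewrite ext_valueM ger_pMl //; apply/ext_value_le1; apply: AD => //.
apply/ext_value_le1; rewrite -(ler_pM2r y1) mul1r -ext_valueM mulfVK //.
Qed.

Lemma ext_valueD x y : ext_value (x + y) <= ext_value x + ext_value y.
Proof.
apply: le_trans (ext_value_ultra x y) _.
by rewrite ge_max lerDl lerDr !ext_value_ge0.
Qed.

End Maximal.

Theorem ultrametric_extension : (forall x, algebraicOver iota x) ->
  exists W : absval R E, ultrametric W /\ forall c, W (iota c) = w c.
Proof.
move=> alg; have [A [LA Amax]] := maximal_lying_over.
exists (AbsVal (ext_value_ge0 LA Amax alg) (ext_value_eq0 LA Amax alg)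
  (ext_valueM LA Amax alg) (ext_valueD LA Amax alg)).
by split=> [x y|c]; [exact: ext_value_ultra|exact: ext_value_iota].
Qed.

End ChevalleyExtension.

Section AbsvalFacts.
Variables (R : realType) (K : fieldType).
Implicit Types v w : absval R K.

Lemma absval_prod v (I : Type) (r : seq I) (F : I -> K) :
  v (\prod_(i <- r) F i) = \prod_(i <- r) v (F i).
Proof. by elim/big_rec2: _ => [|i a b _ <-]; rewrite ?absval1 ?absvalM. Qed.

Lemma powRX (x s : R) n : 0 <= x -> (x ^+ n) `^ s = (x `^ s) ^+ n.
Proof.
move=> x0; elim: n => [|n IHn]; first by rewrite !expr0 powR1.
by rewrite !exprS powRM ?exprn_ge0 // IHn.
Qed.

Lemma powR_inv (x s : R) : 0 < x -> x^-1 `^ s = (x `^ s)^-1.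
Proof.
move=> x0; have xs : x `^ s != 0 by rewrite gt_eqF ?powR_gt0.
apply: (mulfI xs); rewrite mulfV // -powRM ?invr_ge0 ?(ltW x0) //.
by rewrite mulfV ?gt_eqF // powR1.
Qed.

Lemma absval_equiv_sym v w : absval_equiv v w -> absval_equiv w v.
Proof.
move=> [s s0 h]; exists s^-1; first by rewrite invr_gt0.
by move=> x; rewrite h -powRrM mulfV ?gt_eqF // powRr1 // absval_ge0.
Qed.

Lemma absval_equiv_refl v : absval_equiv v v.
Proof. by exists 1 => // x; rewrite powRr1 // absval_ge0. Qed.

Lemma absval_equiv_trans u v w :
  absval_equiv u v -> absval_equiv v w -> absval_equiv u w.
Proof.
move=> [s s0 h] [t t0 h']; exists (s * t); first exact: mulr_gt0.
by move=> x; rewrite h' h powRrM.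
Qed.

Lemma absval_equiv_lt1 v w x : absval_equiv v w -> v x < 1 -> w x < 1.
Proof.
move=> [s s0 ->] vx; have <- : 1 `^ s = 1 :> R by rewrite powR1.
by rewrite gt0_ltr_powR ?nnegrE ?absval_ge0 ?ler01.
Qed.

Lemma absval_equiv_ultrametric v w : absval_equiv v w -> ultrametric v -> ultrametric w.
Proof.
move=> [s s0 h] vu x y; rewrite !h; have := vu x y; rewrite !le_max => /orP[] xy.
  by apply/orP; left; rewrite ge0_ler_powR ?nnegrE ?absval_ge0 // ltW.
by apply/orP; right; rewrite ge0_ler_powR ?nnegrE ?absval_ge0 // ltW.
Qed.

Lemma ultrametric_nat v n : ultrametric v -> v n%:R <= 1.
Proof.
move=> vu; elim: n => [|n IHn]; first by rewrite absval0.
rewrite -addn1 natrD; apply: le_trans (vu _ _) _.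
by rewrite ge_max IHn absval1 lexx.
Qed.

End AbsvalFacts.

(** * Base fields with a product formula *)

Definition product_formula (R : realType) (K : fieldType) (M : eqType)
    (w : M -> absval R K) : Prop :=
  forall x, x != 0 -> exists s : seq M,
    [/\ uniq s, forall i, i \notin s -> w i x = 1 & \prod_(i <- s) w i x = 1].

(** What is retained of the rationals or of kappa(t): a product formula without exponents, and
    enough of Ostrowski's theorem to recognise the restriction of a place of [K]. [C] holds the
    constants and is empty for number fields. *)
Record arithmetic_family (R : realType) (k : fieldType) (M : eqType)
    (w : M -> absval R k) (C : set k) : Prop := {
  af_product : product_formula w;
  af_infinite : forall s : seq M, exists i, i \notin s;
  af_ultrametric : exists s : seq M, forall i, i \notin s -> ultrametric (w i);
  af_nontrivial : forall i, absval_nontrivial (w i);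
  af_constants : forall i c, C c -> c != 0 -> w i c = 1;
  af_inequivalent : forall i j, absval_equiv (w i) (w j) -> i = j;
  af_ostrowski : forall v : absval R k, ultrametric v -> absval_nontrivial v ->
    (forall c, C c -> c != 0 -> v c = 1) -> exists i, absval_equiv v (w i)
}.

(** * Absolute values on a field of fractions *)

Section FractionAbsval.
Variables (R : realType) (A : idomainType) (k : fieldType).
Variables (phi : {rmorphism A -> k}).
Hypothesis phi_inj : injective phi.
Hypothesis frac : forall x, exists a b, b != 0 /\ x = phi a / phi b.
Variables (mu : A -> R).
Hypothesis mu_ge0 : forall a, 0 <= mu a.
Hypothesis mu_eq0 : forall a, (mu a == 0) = (a == 0).
Hypothesis muM : forall a b, mu (a * b) = mu a * mu b.

Let phi0 a : (phi a == 0) = (a == 0).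
Proof. by rewrite -(inj_eq phi_inj) rmorph0. Qed.

Let num x := projT1 (cid (frac x)).
Let den x := projT1 (cid (projT2 (cid (frac x)))).
Let den0 x : den x != 0. 
Proof. exact: (proj1 (projT2 (cid (projT2 (cid (frac x)))))). Qed.
Let fracE x : x = phi (num x) / phi (den x).
Proof. exact: (proj2 (projT2 (cid (projT2 (cid (frac x)))))). Qed.

Let val x := mu (num x) / mu (den x).

Let valE a b : b != 0 -> val (phi a / phi b) = mu a / mu b.
Proof.
move=> b0; rewrite /val; set x := phi a / phi b.
apply/eqP; rewrite eqr_div ?mu_eq0 ?den0 // -!muM; apply/eqP; congr mu.
apply: phi_inj; rewrite !rmorphM; apply/eqP; rewrite -eqr_div ?phi0 ?den0 //.
by rewrite -fracE.
Qed.

Let val_ge0 x : 0 <= val x. Proof. by rewrite /val divr_ge0. Qed.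

Let val_eq0 x : (val x == 0) = (x == 0).
Proof.
rewrite {2}[x]fracE /val !mulf_eq0 !invr_eq0 mu_eq0 phi0.
by rewrite mu_eq0 phi0 !(negbTE (den0 x)).
Qed.

Let valM x y : val (x * y) = val x * val y.
Proof.
rewrite {1}[x]fracE {1}[y]fracE mulf_div -!rmorphM valE ?mulf_neq0 ?den0 //.
by rewrite !muM -mulf_div.
Qed.

Let sumE x y : x + y =
  phi (num x * den y + num y * den x) / phi (den x * den y).
Proof. by rewrite {1}[x]fracE {1}[y]fracE addf_div ?phi0 ?den0 // rmorphD !rmorphM. Qed.

Lemma fraction_absval : (forall a b, mu (a + b) <= mu a + mu b) ->
  exists v : absval R k, forall a, v (phi a) = mu a.
Proof.
move=> muD.
have valD x y : val (x + y) <= val x + val y.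
  rewrite sumE valE ?mulf_neq0 ?den0 // /val addf_div ?mu_eq0 ?den0 // -!muM.
  by rewrite ler_pM2r ?invr_gt0 ?lt0r ?mu_ge0 ?mu_eq0 ?mulf_neq0 ?den0.
exists (AbsVal val_ge0 val_eq0 valM valD) => a /=.
have -> : phi a = phi a / phi 1 by rewrite rmorph1 divr1.
rewrite valE ?oner_neq0 //; have m1 : mu 1 != 0 by rewrite mu_eq0 oner_neq0.
by rewrite -{1}[a]mulr1 muM mulfK.
Qed.

Lemma fraction_absvalE (v : absval R k) : (forall a, v (phi a) = mu a) ->
  forall a b, v (phi a / phi b) = mu a / mu b.
Proof. by move=> h a b; rewrite absvalM absvalV !h. Qed.

Lemma fraction_ultrametric (v : absval R k) : (forall a, v (phi a) = mu a) ->
  (forall a b, mu (a + b) <= Num.max (mu a) (mu b)) -> ultrametric v.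
Proof.
move=> h mD x y.
have vE z : v z = mu (num z) / mu (den z) by rewrite {1}[z]fracE (fraction_absvalE h).
rewrite sumE (fraction_absvalE h) (vE x) (vE y) muM.
have dx : 0 < mu (den x) by rewrite lt0r mu_eq0 den0 mu_ge0.
have dy : 0 < mu (den y) by rewrite lt0r mu_eq0 den0 mu_ge0.
have -> : mu (num x) / mu (den x) = mu (num x * den y) / (mu (den x) * mu (den y)).
  by rewrite muM invfM mulrACA divff ?mulr1 // gt_eqF.
have -> : mu (num y) / mu (den y) = mu (num y * den x) / (mu (den x) * mu (den y)).
  by rewrite muM [_ * mu (den y)]mulrC invfM mulrACA divff ?mulr1 // gt_eqF.
have dd : 0 < (mu (den x) * mu (den y))^-1 by rewrite invr_gt0 mulr_gt0.
by rewrite -maxr_pMl ?(ltW dd) // ler_pM2r.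
Qed.

End FractionAbsval.

(** * Product formula and Ostrowski's theorem over a ring with Bezout relations *)

Section FactorialBase.
Variables (R : realType) (A : idomainType) (k : fieldType).
Variables (phi : {rmorphism A -> k}).
Hypothesis phi_inj : injective phi.
Hypothesis frac : forall x, exists a b, b != 0 /\ x = phi a / phi b.
Variables (winf : absval R k) (I : eqType) (prm : I -> A).
Hypothesis winf_ge1 : forall a, a != 0 -> 1 <= winf (phi a).
Hypothesis prm_gt1 : forall i, 1 < winf (phi (prm i)).
Hypothesis factor : forall a, a != 0 ->
  exists u u' (s : seq I), u * u' = 1 /\ a = u * \prod_(i <- s) prm i.
Hypothesis bezout : forall i a,
  (exists b, a = b * prm i) \/ (exists x y, x * prm i + y * a = 1).
Hypothesis prm_dvd : forall i j b, prm j = b * prm i -> i = j.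

Let dv i a := exists b, a = b * prm i.

Let unit_winf u u' : u * u' = 1 -> winf (phi u) = 1.
Proof.
move=> uu; have u0 : u != 0 by apply: contra_eq_neq uu => ->; rewrite mul0r eq_sym oner_neq0.
have u'0 : u' != 0 by apply: contra_eq_neq uu => ->; rewrite mulr0 eq_sym oner_neq0.
apply/eqP; rewrite eq_le winf_ge1 // andbT -(absval1 winf) -(rmorph1 phi) -uu.
by rewrite rmorphM absvalM ler_peMr ?absval_ge0 ?winf_ge1.
Qed.

Let prm0 i : prm i != 0.
Proof.
have := prm_gt1 i; apply: contraTneq => ->.
by rewrite rmorph0 absval0 -leNgt ler01.
Qed.

Let ndv1 i : ~ dv i 1.
Proof.
move=> [b /esym bi]; have := prm_gt1 i.
by rewrite mulrC in bi; rewrite (unit_winf bi) ltxx.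
Qed.

Let ndv_unit i u u' : u * u' = 1 -> ~ dv i u.
Proof. by move=> uu [b ub]; apply: (@ndv1 i); exists (b * u'); rewrite -uu ub mulrAC. Qed.

Let dvM i a b : dv i (a * b) -> dv i a \/ dv i b.
Proof.
move=> [c abc]; have [?|[x [y xy]]] := bezout i a; first by left.
right; exists (x * b + y * c).
by rewrite -[b in LHS]mul1r -xy !mulrDl -[y * a * b]mulrA abc; ring.
Qed.

Let ndv_prod i (s : seq I) : i \notin s -> ~ dv i (\prod_(l <- s) prm l).
Proof.
elim: s => [_|l s IHs]; first by rewrite big_nil; exact: ndv1.
rewrite inE negb_or big_cons => /andP[il /IHs ns] /dvM[[b /prm_dvd h]|//].
by rewrite h eqxx in il.
Qed.

Let ord i a n := exists b, a = b * prm i ^+ n /\ ~ dv i b.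

Let ord_ex i a : a != 0 -> exists n, ord i a n.
Proof.
move=> a0; have [u [u' [s [uu ->]]]] := factor a0.
exists (count_mem i s), (u * \prod_(l <- [seq l <- s | l != i]) prm l); split.
  rewrite -mulrA; congr (_ * _); elim: s {a0} => [|l s IHs] /=.
    by rewrite !big_nil expr0 mulr1.
  rewrite big_cons IHs; case: eqVneq => [->|li] /=; first by rewrite exprD; ring.
  by rewrite big_cons add0n mulrA.
move=> /dvM[]; first exact: ndv_unit uu.
by apply: ndv_prod; rewrite mem_filter eqxx.
Qed.

Let ord_uniq i a n m : ord i a n -> ord i a m -> n = m.
Proof.
suff le n' m' : ord i a n' -> ord i a m' -> (n' <= m')%N.
  by move=> h1 h2; apply/eqP; rewrite eqn_leq !le.
move=> [b [ab nb]] [c [ac nc]]; rewrite leqNgt; apply/negP => mn; apply: nc.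
exists (b * prm i ^+ (n' - m').-1).
have p0 : prm i ^+ m' != 0 by rewrite expf_neq0.
apply: (mulIf p0); rewrite -ac ab -!mulrA -exprS -exprD.
by rewrite addnS -addSn prednK ?subn_gt0 // subnK // ltnW.
Qed.

Let ordM i a b n m : ord i a n -> ord i b m -> ord i (a * b) (n + m).
Proof.
move=> [c [-> nc]] [d [-> nd]]; exists (c * d); split; last by move=> /dvM[].
by rewrite exprD; ring.
Qed.

Let ordD i a b n m l : ord i a n -> ord i b m -> ord i (a + b) l -> (minn n m <= l)%N.
Proof.
wlog nm : a b n m / (n <= m)%N => [hw|].
  have /orP[h|h] := leq_total n m; first exact: hw.
  by rewrite minnC addrC => ha hb; exact: hw.
rewrite (minn_idPl nm) => -[c [-> nc]] [d [-> nd]] [e [E' ne]].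
rewrite leqNgt; apply/negP => ln; apply: ne.
exists ((c + d * prm i ^+ (m - n)) * prm i ^+ (n - l).-1).
have p0 : prm i ^+ l != 0 by rewrite expf_neq0.
apply: (mulIf p0); rewrite -E' -!mulrA -exprS -exprD addnS -addSn prednK ?subn_gt0 //.
by rewrite (subnK (ltnW ln)) mulrDl -mulrA -exprD (subnK nm).
Qed.

(** The absolute value attached to [prm i] is normalised to be the inverse of [c i] at [prm i]; each
    prime factor then cancels against its own size at infinity in the product formula. *)
Let c i := winf (phi (prm i)).
Let c0 i : 0 < c i. Proof. exact: lt_trans (prm_gt1 i). Qed.

Let mu_ex i a : exists r : R, (a = 0 /\ r = 0) \/ exists n, ord i a n /\ r = c i ^- n.
Proof.
have [->|/ord_ex] := eqVneq a 0; first by exists 0; left.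
by move=> /(_ i)[n h]; exists (c i ^- n); right; exists n.
Qed.

Let mu i a := projT1 (cid (mu_ex i a)).

Let ord_neq0 i a n : ord i a n -> a != 0.
Proof.
move=> [b [-> nb]]; rewrite mulf_neq0 ?expf_neq0 //.
by apply: contra_notN nb => /eqP->; exists 0; rewrite mul0r.
Qed.

Let mu0 i : mu i 0 = 0.
Proof.
rewrite /mu; case: cid => r /= [[]//|[n [/ord_neq0]]].
by rewrite eqxx.
Qed.

Let muE i a n : ord i a n -> mu i a = c i ^- n.
Proof.
move=> an; have a0 := ord_neq0 an; rewrite /mu; case: cid => r /= [[a0' _]|].
  by rewrite a0' eqxx in a0.
by move=> [m [am ->]]; rewrite (ord_uniq an am).
Qed.

Let mu_ge0 i a : 0 <= mu i a.
Proof.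
have [->|/ord_ex] := eqVneq a 0; first by rewrite mu0.
by move=> /(_ i)[n /muE->]; rewrite invr_ge0 exprn_ge0 // ltW.
Qed.

Let mu_eq0 i a : (mu i a == 0) = (a == 0).
Proof.
have [->|a0] := eqVneq a 0; first by rewrite mu0 eqxx.
have [n /muE->] := ord_ex i a0.
by rewrite invr_eq0 expf_eq0 gt_eqF // andbF.
Qed.

Let muM i a b : mu i (a * b) = mu i a * mu i b.
Proof.
have [->|a0] := eqVneq a 0; first by rewrite mul0r mu0 mul0r.
have [->|b0] := eqVneq b 0; first by rewrite mulr0 mu0 mulr0.
have [n an] := ord_ex i a0; have [m bm] := ord_ex i b0.
by rewrite (muE an) (muE bm) (muE (ordM an bm)) exprD invfM.
Qed.

Let muU i a b : mu i (a + b) <= Num.max (mu i a) (mu i b).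
Proof.
have [->|a0] := eqVneq a 0; first by rewrite add0r le_max lexx orbT.
have [->|b0] := eqVneq b 0; first by rewrite addr0 le_max lexx.
have [ab0|ab0] := eqVneq (a + b) 0; first by rewrite ab0 mu0 le_max mu_ge0.
have [n an] := ord_ex i a0; have [m bm] := ord_ex i b0.
have [l abl] := ord_ex i ab0; have := ordD an bm abl.
have le p q : (p <= q)%N -> c i ^- q <= c i ^- p.
  move=> pq; rewrite lef_pV2 ?posrE ?exprn_gt0 //.
  by rewrite ler_weXn2l // ltW // prm_gt1.
rewrite (muE an) (muE bm) (muE abl) geq_min le_max => /orP[] /le ->; by rewrite ?orbT.
Qed.

Let muD i a b : mu i (a + b) <= mu i a + mu i b.
Proof. by apply: le_trans (muU i a b) _; rewrite ge_max lerDl lerDr !mu_ge0. Qed.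

Let wp_ex i := fraction_absval phi_inj frac (mu_ge0 i) (mu_eq0 i) (muM i) (muD i).

Let w (o : option I) : absval R k :=
  if o is Some i then projT1 (cid (wp_ex i)) else winf.

Let wE i a : w (Some i) (phi a) = mu i a.
Proof. by rewrite /w; case: cid. Qed.

Let wU i : ultrametric (w (Some i)).
Proof. exact: (fraction_ultrametric phi_inj frac (mu_ge0 i) (mu_eq0 i) (muM i) (wE i) (muU i)). Qed.

Let mu_prm i j : mu i (prm j) = if i == j then (c i)^-1 else 1.
Proof.
case: eqVneq => [->|ij].
  rewrite (@muE _ _ 1%N) ?expr1 //; exists 1; by rewrite mul1r expr1; split.
rewrite (@muE _ _ 0%N) ?expr0 ?invr1 //; exists (prm j); rewrite expr0 mulr1.
by split => // -[b /prm_dvd h]; rewrite h eqxx in ij.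
Qed.

Let mu_unit i u u' : u * u' = 1 -> mu i u = 1.
Proof.
move=> uu; rewrite (@muE _ _ 0%N) ?expr0 ?invr1 //; exists u; rewrite expr0 mulr1.
by split => //; exact: ndv_unit uu.
Qed.

Let mu_prod i (s : seq I) : mu i (\prod_(l <- s) prm l) = \prod_(l <- s) mu i (prm l).
Proof.
elim: s => [|l s IHs]; first by rewrite !big_nil (mu_unit _ (mulr1 1)).
by rewrite !big_cons muM IHs.
Qed.

Let mu_out i (s : seq I) : i \notin s -> mu i (\prod_(l <- s) prm l) = 1.
Proof.
move=> h; rewrite mu_prod big_seq big1 // => l ls; rewrite mu_prm.
by case: eqP => // il; rewrite il ls in h.
Qed.

Let pf_prod (s t : seq I) : uniq t -> {subset s <= t} ->
  \prod_(i <- t) mu i (\prod_(l <- s) prm l) * winf (phi (\prod_(l <- s) prm l)) = 1.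
Proof.
move=> ut; elim: s => [_|l s IHs st].
  by rewrite big1 ?big_nil ?rmorph1 ?absval1 ?mulr1 // => i _; rewrite (mu_unit _ (mulr1 1)).
rewrite big_cons rmorphM absvalM -/(c l).
have -> : \prod_(i <- t) mu i (prm l * \prod_(l <- s) prm l) =
    (c l)^-1 * \prod_(i <- t) mu i (\prod_(l <- s) prm l).
  under eq_bigr do rewrite muM.
  rewrite big_split /=; congr (_ * _).
  have lt : l \in t by apply: st; rewrite mem_head.
  rewrite (bigD1_seq l) //= mu_prm eqxx big1 ?mulr1 // => i il.
  by rewrite mu_prm (negbTE il).
rewrite mulrACA [_^-1 * _]mulrC divff ?gt_eqF // mul1r; apply: IHs.
by move=> x xs; apply: st; rewrite inE xs orbT.
Qed.

Let w_product : product_formula w.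
Proof.
have pfA a (s : seq I) u u' (t : seq I) : u * u' = 1 -> a = u * \prod_(i <- s) prm i ->
    uniq t -> {subset s <= t} ->
    (forall i, i \notin t -> mu i a = 1) /\
    \prod_(i <- t) mu i a * winf (phi a) = 1.
  move=> uu -> ut st; split=> [i it|].
    rewrite muM (mu_unit _ uu) mul1r mu_out //.
    by apply: contra it; exact: st.
  rewrite -[RHS](pf_prod ut st) rmorphM absvalM (unit_winf uu) mul1r.
  congr (_ * _); apply: eq_bigr => i _; by rewrite muM (mu_unit _ uu) mul1r.
move=> x x0; have [a [b [b0 xE]]] := frac x.
have a0 : a != 0 by apply: contraNneq x0 => a0; rewrite xE a0 rmorph0 mul0r.
have [u [u' [s [uu aE]]]] := factor a0; have [v [v' [s' [vv bE]]]] := factor b0.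
pose t := undup (s ++ s').
have ut : uniq t by rewrite undup_uniq.
have st : {subset s <= t} by move=> y ys; rewrite mem_undup mem_cat ys.
have st' : {subset s' <= t} by move=> y ys; rewrite mem_undup mem_cat ys orbT.
have [a1 apf] := pfA a s u u' t uu aE ut st.
have [b1 bpf] := pfA b s' v v' t vv bE ut st'.
exists (None :: map Some t); split.
- rewrite /= map_inj_uniq ?ut ?andbT; last by move=> ? ? [].
  by apply/mapP => -[].
- move=> [i|//]; rewrite inE /= mem_map; last by move=> ? ? [].
  move=> it; rewrite xE absvalM absvalV.
  by rewrite !wE a1 // b1 // invr1 mulr1.
rewrite big_cons big_map xE absvalM absvalV.
under eq_bigr do rewrite absvalM absvalV !wE.
rewrite big_split /= prodfV mulrACA -invfM mulrC [X in _^-1 * X]mulrC apf.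
by rewrite [X in X^-1]mulrC bpf invr1 mulr1.
Qed.

Let inequiv o o' : absval_equiv (w o) (w o') -> o = o'.
Proof.
have self i : w (Some i) (phi (prm i)) < 1.
  by rewrite wE mu_prm eqxx invf_lt1 //; exact: prm_gt1.
have aux i o1 : absval_equiv (w (Some i)) (w o1) -> Some i = o1.
  move=> /absval_equiv_lt1 /(_ (self i)); case: o1 => [j|] /=.
    by rewrite -/(w (Some j)) wE mu_prm; case: eqVneq => [->//|_]; rewrite ltxx.
  by move=> /lt_trans /(_ (prm_gt1 i)); rewrite ltxx.
case: o => [i|]; first exact: aux.
by case: o' => // j /absval_equiv_sym/aux.
Qed.

(** Some prime has value less than 1. By Bezout, everything not divisible by it has value 1, so [v]
    depends only on the exponent of that prime. *)
Let ostrowski (v : absval R k) : ultrametric v -> absval_nontrivial v ->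
  (forall a, v (phi a) <= 1) -> exists o, absval_equiv v (w o).
Proof.
move=> vu [x x0 vx] vA.
have [i vi] : exists i, v (phi (prm i)) < 1.
  apply: contrapT => ni.
  have v1 a : a != 0 -> v (phi a) = 1.
    move=> a0; have [u [u' [s [uu ->]]]] := factor a0.
    have vuu : v (phi u) = 1.
      apply/eqP; rewrite eq_le vA -(absval1 v) -(rmorph1 phi) -uu rmorphM absvalM.
      by rewrite ler_piMr ?absval_ge0 ?vA.
    rewrite rmorphM absvalM vuu mul1r rmorph_prod absval_prod big1 // => l _.
    apply/eqP; rewrite eq_le vA leNgt; apply/negP => vl; by apply: ni; exists l.
  have [a [b [b0 xE]]] := frac x.
  have a0 : a != 0 by apply: contraNneq x0 => a0; rewrite xE a0 rmorph0 mul0r.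
  by move: vx; rewrite xE absvalM absvalV !v1 // invr1 mulr1 eqxx.
exists (Some i).
have vpi0 : 0 < v (phi (prm i)) by rewrite absval_gt0 -(rmorph0 phi) (inj_eq phi_inj).
have v1 b : ~ dv i b -> v (phi b) = 1.
  have [//|[y [z yz]] _] := bezout i b; apply/eqP; rewrite eq_le vA /=.
  have := vu (phi (y * prm i)) (phi (z * b)).
  rewrite -rmorphD yz rmorph1 absval1 le_max !rmorphM !absvalM => /orP[h|h].
    have : v (phi y) * v (phi (prm i)) < 1.
      by apply: le_lt_trans vi; rewrite ler_piMl ?absval_ge0 ?vA.
    by rewrite ltNge h.
  by apply: le_trans h _; rewrite ler_piMl ?absval_ge0 ?vA.
(* The exponent for which [v (phi (prm i))] becomes [(c i)^-1]. *)
pose s := ln (c i) / - ln (v (phi (prm i))).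
have s0 : 0 < s.
  by rewrite divr_gt0 ?ln_gt0 ?prm_gt1 // oppr_gt0 ln_lt0 // vpi0.
have vs : v (phi (prm i)) `^ s = (c i)^-1.
  rewrite /powR gt_eqF // /s invrN mulrN mulNr mulfVK; last first.
    by rewrite lt_eqF // ln_lt0 // vpi0.
  by rewrite expRN lnK ?posrE.
have vmu a : mu i a = v (phi a) `^ s.
  have [->|a0] := eqVneq a 0; first by rewrite mu0 rmorph0 absval0 powR0 // gt_eqF.
  have [n an] := ord_ex i a0; rewrite (muE an); have [b [-> nb]] := an.
  by rewrite rmorphM rmorphXn absvalM absvalX v1 // mul1r powRX ?absval_ge0 // vs exprVn.
exists s => // y; have [a [b [b0 ->]]] := frac y.
rewrite absvalM absvalV !wE !vmu [v (_ / _)]absvalM absvalV powRM ?invr_ge0 ?absval_ge0 //.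
by rewrite powR_inv // absval_gt0 -(rmorph0 phi) (inj_eq phi_inj).
Qed.

Theorem factorial_base (C : set k) : (forall s : seq I, exists i, i \notin s) ->
  (forall x, C x -> x != 0 -> winf x = 1) ->
  (forall x, C x -> x != 0 -> exists u u', u * u' = 1 /\ x = phi u) ->
  (exists x, x != 0 /\ winf x != 1) ->
  (forall v : absval R k, ultrametric v -> (forall c, C c -> c != 0 -> v c = 1) ->
     (forall a, v (phi a) <= 1) \/ absval_equiv v winf) ->
  exists w : option I -> absval R k, [/\ arithmetic_family w C,
    w None = winf & forall i, ultrametric (w (Some i))].
Proof.
move=> Iinf Cinf Cunit [x [x0 winfx]] ost; exists w; split => //; split.
- exact: w_product.
- move=> s; have [i ni] := Iinf (pmap id s); exists (Some i).
  apply: contra ni => si; rewrite mem_pmap; apply/mapP; by exists (Some i).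
- exists [:: None] => -[i _|]; [exact: wU|by rewrite inE eqxx].
- move=> [i|]; last by exists x.
  exists (phi (prm i)); first by rewrite -(rmorph0 phi) (inj_eq phi_inj).
  by rewrite wE mu_prm eqxx invr_eq1 gt_eqF //; exact: prm_gt1.
- move=> [i|] y Cy y0; last exact: Cinf.
  by have [u [u' [uu ->]]] := Cunit y Cy y0; rewrite wE (mu_unit _ uu).
- exact: inequiv.
- move=> v vu vn vC; have [vA|h] := ost v vu vC; last by exists None.
  exact: ostrowski.
Qed.

End FactorialBase.

Lemma injective_notin (I : eqType) (f : nat -> I) (s : seq I) : injective f ->
  exists n, f n \notin s.
Proof.
move=> finj; apply: contrapT => h.
have /uniq_leq_size : uniq [seq f n | n <- iota 0 (size s).+1].
  by rewrite map_inj_uniq // iota_uniq.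
move=> /(_ s); rewrite size_map size_iota ltnn => sub.
suff /sub : {subset [seq f n | n <- iota 0 (size s).+1] <= s} by [].
by move=> _ /mapP[n _ ->]; apply: contrapT => /negP nf; apply: h; exists n.
Qed.

(** * The rational numbers *)

Section RationalBase.
Variable (R : realType).

Definition rat_abs (q : rat) : R := `|ratr q|.

Lemma rat_abs_ge0 q : 0 <= rat_abs q. Proof. exact: normr_ge0. Qed.
Lemma rat_abs_eq0 q : (rat_abs q == 0) = (q == 0).
Proof. by rewrite normr_eq0 fmorph_eq0. Qed.
Lemma rat_absM p q : rat_abs (p * q) = rat_abs p * rat_abs q.
Proof. by rewrite /rat_abs rmorphM normrM. Qed.
Lemma rat_absD p q : rat_abs (p + q) <= rat_abs p + rat_abs q.
Proof. by rewrite /rat_abs rmorphD ler_normD. Qed.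

Definition rat_absval : absval R rat := AbsVal rat_abs_ge0 rat_abs_eq0 rat_absM rat_absD.

Lemma rat_absval_int (a : int) : rat_absval a%:~R = `|a|%:~R.
Proof. by rewrite /= /rat_abs ratr_int -intr_norm. Qed.

Lemma nat_prime_factorization n : (0 < n)%N ->
  exists s : seq {p : nat | prime p}, n = (\prod_(i <- s) val i)%N.
Proof.
have [m] := ubnP n; elim: m n => // m IHm n nm n0.
have [n1|n1] := leqP n 1.
  by exists [::]; rewrite big_nil; apply/eqP; rewrite eqn_leq n1.
have pp := pdiv_prime n1.
have [s sE] : exists s : seq {p : nat | prime p}, (n %/ pdiv n)%N = (\prod_(i <- s) val i)%N.
  apply: IHm; last by rewrite divn_gt0 ?pdiv_gt0 ?pdiv_leq.
  by apply: (@leq_trans n) => //; rewrite ltn_Pdiv // prime_gt1.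
exists (exist _ (pdiv n) pp :: s).
by rewrite big_cons /= -sE mulnC divnK // pdiv_dvd.
Qed.

Lemma rat_base : exists (I : eqType) (w : option I -> absval R rat),
  [/\ arithmetic_family w set0, w None = rat_absval & forall i, ultrametric (w (Some i))].
Proof.
exists {p : nat | prime p}.
apply: (@factorial_base R int rat (intr : {rmorphism int -> rat}) _ _ rat_absval _
  (fun i : {p : nat | prime p} => (val i)%:Z)).
- exact: intr_inj.
- by move=> x; exists (numq x), (denq x); rewrite denq_eq0 divq_num_den.
- by move=> a a0; rewrite rat_absval_int ler1z -gtz0_ge1 normr_gt0.
- by move=> [p pp]; rewrite rat_absval_int ltr1z ltz_nat prime_gt1.
- move=> a a0; have [s sE] := @nat_prime_factorization `|a|%N ltac:(by rewrite absz_gt0).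
  exists (sgz a), (sgz a), s; split; first by rewrite mulz_sg a0.
  rewrite {1}[a]intEsg sE -/(Posz _); congr (_ * _).
  by rewrite (big_morph Posz PoszM (erefl _)).
- move=> [p pp] a /=; have [pa|npa] := boolP (p %| `|a|)%N.
    left; have /dvdzP[b ->] : (p%:Z %| a)%Z by rewrite dvdzE.
    by exists b.
  right; have [x [y xy]] := Bezoutz p%:Z a; exists x, y; rewrite xy.
  by congr Posz; apply/eqP; rewrite -/(coprime _ _) prime_coprime.
- move=> [p pp] [q pq] b /= /(congr1 absz); rewrite abszM /= => qE.
  apply: val_inj => /=; apply/eqP; rewrite -dvdn_prime2 // qE; exact: dvdn_mull.
- move=> s; pose m := (\max_(i <- s) val i)%N.
  have [p mp pp] := prime_above m; exists (exist _ p pp).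
  apply/negP => ps; move: mp; rewrite ltnNge /m.
  by rewrite (@leq_bigmax_seq _ s xpredT (fun i : {p | prime p} => val i) (exist _ p pp) ps).
- by [].
- by [].
- exists 2%:~R; split; first by [].
  by rewrite rat_absval_int normr_nat; apply/eqP => /(congr1 (fun x : R => x - 1)); lra.
- move=> v vu _; left; move=> a.
  rewrite [a]intEsg rmorphM absvalM; have [->|a0] := eqVneq a 0.
    by rewrite sgz0 absval0 mul0r ler01.
  have -> : v (sgz a)%:~R = 1.
    have /orP[/eqP->|/eqP->] : (sgz a == 1) || (sgz a == -1) by case: sgzP a0.
      by rewrite absval1.
    by rewrite rmorphN absvalN absval1.
  by rewrite mul1r; exact: ultrametric_nat.
Qed.

End RationalBase.

Section UltrametricFacts.
Variables (R : realType) (K : fieldType) (v : absval R K).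
Hypothesis vu : ultrametric v.

Lemma ultrametric_lt x y : v x < v y -> v (x + y) = v y.
Proof.
move=> xy; apply/eqP; rewrite eq_le; apply/andP; split.
  by apply: le_trans (vu x y) _; rewrite ge_max (ltW xy) lexx.
have := vu (- x) (x + y); rewrite addKr absvalN le_max => /orP[|//].
by rewrite leNgt xy.
Qed.

Lemma ultrametric_sum (I : Type) (r : seq I) (P : pred I) (F : I -> K) B : 0 <= B ->
  (forall i, P i -> v (F i) <= B) -> v (\sum_(i <- r | P i) F i) <= B.
Proof.
move=> B0 h; elim/big_ind: _ => // [|x y xB yB]; first by rewrite absval0.
by apply: le_trans (vu x y) _; rewrite ge_max xB.
Qed.

Lemma ultrametric_sub x y B : v x <= B -> v y <= B -> v (x - y) <= B.
Proof. by move=> xB yB; apply: le_trans (vu _ _) _; rewrite absvalN ge_max xB. Qed.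

Lemma ultrametric_horner (p : {poly K}) x :
  (forall i, v p`_i <= 1) -> v x <= 1 -> v p.[x] <= 1.
Proof.
move=> p1 x1; rewrite horner_coef; apply: ultrametric_sum => // i _.
by rewrite absvalM absvalX mulr_ile1 ?exprn_ge0 ?absval_ge0 ?exprn_ile1 ?absval_ge0.
Qed.

End UltrametricFacts.

(** * Subfields given as sets, realised as fields *)

Section SubfieldType.
Variables (K : fieldType) (S : set K).
Hypothesis hS : is_subfield S.

Definition subfield_pred of is_subfield S : {pred K} := fun x => x \in S.

Lemma subfield_divring_closed : divring_closed (subfield_pred hS).
Proof.
case: hS => S1 SB SD; split; rewrite /subfield_pred.
- exact/mem_set.
- by move=> x y /set_mem Sx /set_mem Sy; exact/mem_set/SB.
- by move=> x y /set_mem Sx /set_mem Sy; exact/mem_set/SD.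
Qed.

HB.instance Definition _ :=
  GRing.isDivringClosed.Build K (subfield_pred hS) subfield_divring_closed.

Record subfield_type := SubfieldElt {
  subfield_val :> K; _ : subfield_val \in subfield_pred hS }.

HB.instance Definition _ := [isSub for subfield_val].
HB.instance Definition _ := [Choice of subfield_type by <:].
HB.instance Definition _ := [SubChoice_isSubIntegralDomain of subfield_type by <:].
HB.instance Definition _ := [SubIntegralDomain_isSubField of subfield_type by <:].

End SubfieldType.

Lemma subfield_realization (K : fieldType) (S : set K) : is_subfield S ->
  exists (k : fieldType) (i : {rmorphism k -> K}), range i = S.
Proof.
move=> hS; exists (subfield_type hS), (val : {rmorphism subfield_type hS -> K}).
apply/seteqP; split => [_ [x _ <-]|x Sx].
  by apply: set_mem; case: x.
by exists (SubfieldElt (mem_set Sx : x \in subfield_pred hS)).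
Qed.

Section Factor.
Variables (k1 k2 K : fieldType) (i1 : {rmorphism k1 -> K}) (i2 : {rmorphism k2 -> K}).
Hypothesis sub : range i1 `<=` range i2.

Let factor_ex x : exists y, i2 y = i1 x.
Proof. by have [|y _ yx] := sub (_ : range i1 (i1 x)); [exists x|exists y]. Qed.

Definition subfield_factor x := projT1 (cid (factor_ex x)).

Lemma subfield_factorE x : i2 (subfield_factor x) = i1 x.
Proof. exact: projT2 (cid (factor_ex x)). Qed.

Lemma subfield_factor_zmod : zmod_morphism subfield_factor.
Proof. by move=> x y; apply: (fmorph_inj i2); rewrite rmorphB !subfield_factorE rmorphB. Qed.

Lemma subfield_factor_monoid : monoid_morphism subfield_factor.
Proof.
split; first by apply: (fmorph_inj i2); rewrite subfield_factorE !rmorph1.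
by move=> x y; apply: (fmorph_inj i2); rewrite rmorphM !subfield_factorE rmorphM.
Qed.

HB.instance Definition _ := GRing.isZmodMorphism.Build k1 k2 subfield_factor subfield_factor_zmod.
HB.instance Definition _ := GRing.isMonoidMorphism.Build k1 k2 subfield_factor subfield_factor_monoid.

Lemma subfield_factor_rmorphism : exists r : {rmorphism k1 -> k2}, forall x, i2 (r x) = i1 x.
Proof. by exists subfield_factor; exact: subfield_factorE. Qed.

End Factor.

Lemma subfield_gen_is_subfield (K : fieldType) (A : set K) : is_subfield (subfield_gen A).
Proof.
split.
- by move=> S [[S1 _ _] _].
- move=> x y gx gy S SA; have [[_ SB _] _] := SA; apply: SB; [exact: gx|exact: gy].
- move=> x y gx gy S SA; have [[_ _ SD] _] := SA; apply: SD; [exact: gx|exact: gy].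
Qed.

Lemma coprimep_bezout (F : fieldType) (p q : {poly F}) : coprimep p q ->
  exists u v, u * p + v * q = 1.
Proof.
move=> /Bezout_coprimepP[[u v] /= /eqpP[[a b] /= /andP[a0 b0] E]].
exists ((a / b) *: u), ((a / b) *: v).
rewrite -!scalerAl -scalerDr mulrC -scalerA E scalerA mulVf // scale1r //.
Qed.

Lemma natr_inj_char0 (F : fieldType) : [pchar F] =i pred0 ->
  injective (fun n : nat => n%:R : F).
Proof.
move=> /pcharf0P F0 m n; wlog mn : m n / (m <= n)%N => [hw mE|].
  by have /orP[h|h] := leq_total m n; [exact: hw|exact/esym/hw].
move=> /= /esym/eqP; rewrite -subr_eq0 -natrB // F0 subn_eq0 => nm.
by apply/eqP; rewrite eqn_leq mn.
Qed.

Section PolynomialFactorization.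
Variable F : fieldType.

Lemma nonconstant_irreducible_dvd (p : {poly F}) : (1 < size p)%N ->
  exists2 q, q \is monic /\ irreducible_poly q & q %| p.
Proof.
move=> sp; pose T n := `[< exists q : {poly F}, [/\ (1 < size q)%N, q %| p & size q = n] >].
have exT : exists n, T n by exists (size p); apply/asboolP; exists p; rewrite dvdpp.
have [n /asboolP[q [sq qp qn]] nmin] := ex_minnP exT.
have q0 : q != 0 by rewrite -size_poly_gt0 (ltn_trans _ sq).
have qirr : irreducible_poly q.
  split=> // r sr rq; have r0 : r != 0 by apply: contraTneq rq => ->; rewrite dvd0p.
  rewrite -dvdp_size_eqp // eqn_leq dvdp_leq //= qn; apply: nmin.
  apply/asboolP; exists r; split=> //; last exact: dvdp_trans qp.
  by rewrite ltn_neqAle eq_sym sr size_poly_gt0.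
have lq : lead_coef q != 0 by rewrite lead_coef_eq0.
have lqV : (lead_coef q)^-1 != 0 by rewrite invr_eq0.
have qE : (lead_coef q)^-1 *: q %= q by exact: eqp_scale.
exists ((lead_coef q)^-1 *: q); last by rewrite (eqp_dvdl _ qE).
split; first by rewrite monicE lead_coefZ mulVf.
split; first by rewrite size_scale.
have [_ qi] := qirr.
by move=> r sr; rewrite (eqp_dvdr _ qE) => /(qi r sr) h; rewrite (eqp_trans h) // eqp_sym.
Qed.

Definition monic_irreducible : pred {poly F} :=
  fun q => (q \is monic) && `[< irreducible_poly q >].

Lemma poly_factorization (p : {poly F}) : p != 0 ->
  exists u u' (s : seq {q | monic_irreducible q}),
    u * u' = 1 /\ p = u * \prod_(i <- s) val i.
Proof.
have [m] := ubnP (size p); elim: m p => // m IHm p pm p0.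
have [sp|sp] := leqP (size p) 1.
  have pE := size1_polyC sp; rewrite pE polyC_eq0 in p0.
  exists p, (p`_0)^-1%:P, [::]; rewrite big_nil mulr1; split=> //.
  by rewrite [X in X * _]pE -polyCM mulfV.
have [q [qm qi] /dvdpP[r rE]] := nonconstant_irreducible_dvd sp.
have r0 : r != 0 by apply: contraNneq p0 => r0; rewrite rE r0 mul0r.
have q0 := monic_neq0 qm; have [sq _] := qi.
have [u [u' [s [uu rE']]]] : exists u u' (s : seq {q | monic_irreducible q}),
    u * u' = 1 /\ r = u * \prod_(i <- s) val i.
  apply: IHm => //; rewrite -ltnS (leq_trans _ pm) // ltnS rE size_mul //.
  by move: sq; case: (size q) => [|[|n]] // _; rewrite !addnS /= ltnS leq_addr.
have qP : monic_irreducible q by rewrite /monic_irreducible qm; exact/asboolP.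
exists u, u', (exist _ q qP :: s); split=> //.
by rewrite big_cons rE rE' /=; ring.
Qed.

End PolynomialFactorization.

(** * The rational function field kappa(t) *)

Section FunctionFieldBase.
Variables (R : realType) (K : fieldType) (kappa : set K) (t : K).
Hypothesis charK : [pchar K] =i pred0.
Hypothesis kappaP : is_subfield kappa.
Hypothesis tP : ~ algebraic_over kappa t.

Section Realized.
Variables (F k : fieldType) (iF : {rmorphism F -> K}) (ik : {rmorphism k -> K}).
Hypothesis iFE : range iF = kappa.
Hypothesis ikE : range ik = subfield_gen (kappa `|` [set t]).
Variables (rho : {rmorphism F -> k}) (tk : k).
Hypothesis rhoE : forall x, ik (rho x) = iF x.
Hypothesis tkE : ik tk = t.

Let phi : {rmorphism {poly F} -> k} := horner_eval tk \o map_poly rho.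

Let ik_phi p : ik (phi p) = (map_poly iF p).[t].
Proof.
rewrite /phi /= /horner_eval -horner_map tkE -map_poly_comp; congr (_.[t]).
by apply: eq_map_poly => x /=; exact: rhoE.
Qed.

Let phi_eq0 p : phi p = 0 -> p = 0.
Proof.
move=> p0; apply: contrapT => /eqP np; apply: tP.
exists (map_poly iF p); split; first by rewrite map_poly_eq0.
  by move=> i; rewrite coef_map -iFE; exists p`_i.
by rewrite /root -ik_phi p0 rmorph0.
Qed.

Let phi_inj : injective phi.
Proof.
move=> p q pq; apply/eqP; rewrite -subr_eq0; apply/eqP/phi_eq0.
by rewrite rmorphB pq subrr.
Qed.

Let frac x : exists a b, b != 0 /\ x = phi a / phi b.
Proof.
pose S := [set y | exists a b, b != 0 /\ y = ik (phi a) / ik (phi b)].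
have nz b : b != 0 -> ik (phi b) != 0.
  by rewrite fmorph_eq0; apply: contra_neq; exact: phi_eq0.
have SS : is_subfield S.
  split.
  - by exists 1, 1; rewrite oner_neq0 !rmorph1 divr1.
  - move=> _ _ [a [b [b0 ->]]] [c [d [d0 ->]]].
    exists (a * d - c * b), (b * d); rewrite mulf_neq0 //; split=> //.
    rewrite !(rmorphM, rmorphB) /= -!rmorphM /=; have := nz b b0; have := nz d d0.
    by rewrite !rmorphM /= => ? ?; field; apply/andP.
  - move=> _ _ [a [b [b0 ->]]] [c [d [d0 ->]]].
    have [->|c0] := eqVneq c 0.
      by exists 0, 1; rewrite oner_neq0 !rmorph0 !mul0r invr0 mulr0.
    exists (a * d), (b * c); rewrite mulf_neq0 //; split=> //.
    by rewrite invf_div mulf_div !rmorphM.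
have : subfield_gen (kappa `|` [set t]) `<=` S.
  apply: smallest_sub => //.
  rewrite -iFE => y [[c _ <-]|->].
    exists c%:P, 1; rewrite oner_neq0 !rmorph1 divr1; split=> //.
    by rewrite ik_phi map_polyC hornerC.
  exists 'X, 1; rewrite oner_neq0 !rmorph1 divr1; split=> //.
  by rewrite ik_phi map_polyX hornerX.
rewrite -ikE => /(_ (ik x)); case; first by exists x.
move=> a [b [b0 E]]; exists a, b; split=> //.
by apply: (fmorph_inj ik); rewrite fmorph_div.
Qed.

(** The degree absolute value, which plays the part of the place at infinity; any base greater than
    1 would serve in place of 2. *)
Let mu (p : {poly F}) : R := if p == 0 then 0 else 2 ^+ (size p).-1.

Let mu_ge0 p : 0 <= mu p.
Proof. by rewrite /mu; case: ifP => // _; rewrite exprn_ge0. Qed.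

Let mu_eq0 p : (mu p == 0) = (p == 0).
Proof. by rewrite /mu; case: (eqVneq p 0) => _; rewrite ?eqxx // expf_eq0 pnatr_eq0 andbF. Qed.

Let muM p q : mu (p * q) = mu p * mu q.
Proof.
rewrite /mu mulf_eq0; case: (eqVneq p 0) => [_|p0]; first by rewrite mul0r.
case: (eqVneq q 0) => [_|q0]; first by rewrite mulr0.
rewrite /= -exprD size_mul //; congr (_ ^+ _).
move: p0 q0; rewrite -!size_poly_gt0; case: (size p) => // a.
by case: (size q) => // b _ _; rewrite addnS addSn.
Qed.

Let muU p q : mu (p + q) <= Num.max (mu p) (mu q).
Proof.
have [->|p0] := eqVneq p 0; first by rewrite add0r le_max lexx orbT.
have [->|q0] := eqVneq q 0; first by rewrite addr0 le_max lexx.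
rewrite {1}/mu; case: eqVneq => [_|pq0]; first by rewrite le_max mu_ge0.
rewrite /mu (negbTE p0) (negbTE q0) le_max !ler_eXn2l ?ltr1n //.
have := size_polyD p q; rewrite leq_max; move: p0 q0 pq0; rewrite -!size_poly_gt0.
move: (size p) (size q) (size (p + q)) => a b c; lia.
Qed.

Let muD p q : mu (p + q) <= mu p + mu q.
Proof. by apply: le_trans (muU p q) _; rewrite ge_max lerDl lerDr !mu_ge0. Qed.

Let muC (c : F) : c != 0 -> mu c%:P = 1.
Proof. by move=> c0; rewrite /mu polyC_eq0 (negbTE c0) size_polyC c0 expr0. Qed.

Lemma function_field_base_realized : exists (I : eqType) (w : option I -> absval R k),
  arithmetic_family w (ik @^-1` kappa) /\ forall o, ultrametric (w o).
Proof.
have [winf winfE] := fraction_absval phi_inj frac mu_ge0 mu_eq0 muM muD.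
have winfU := fraction_ultrametric phi_inj frac mu_ge0 mu_eq0 muM winfE muU.
have constP x : kappa (ik x) -> exists c, x = phi c%:P.
  rewrite -iFE => -[c _ cE]; exists c; apply: (fmorph_inj ik).
  by rewrite ik_phi map_polyC hornerC.
have phiC c : c != 0 -> phi c%:P != 0.
  by apply: contra_neq => /phi_eq0/polyC_inj; exact.
have [w [wA wN wS]] : exists w : option {q : {poly F} | monic_irreducible q} -> absval R k,
    [/\ arithmetic_family w (ik @^-1` kappa), w None = winf & forall i, ultrametric (w (Some i))].
  apply: (@factorial_base R {poly F} k phi phi_inj frac winf
    {q : {poly F} | monic_irreducible q} val).
  - by move=> a a0; rewrite winfE /mu (negbTE a0) exprn_ege1 // ler1n.
  - move=> [q /= /andP[qm /asboolP[sq _]]]; rewrite winfE /mu (negbTE (monic_neq0 qm)).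
    by rewrite exprn_egt1 ?ltr1n //; move: sq; case: (size q) => // -[].
  - exact: poly_factorization.
  - move=> [q /= /andP[qm /asboolP qi]] a; have [qa|qa] := boolP (q %| a).
      by left; have /dvdpP[b ->] := qa; exists b.
    right; apply: coprimep_bezout; by rewrite irreducible_poly_coprime.
  - move=> i j b rE; apply: val_inj; apply/eqP.
    have /andP[qm /asboolP qi] := valP i; have /andP[rm /asboolP ri] := valP j.
    move: (val i) (val j) rE qm qi rm ri => q r rE qm qi rm ri.
    rewrite -eqp_monic //; have [sq _] := qi; have [_] := ri; apply.
      by rewrite gtn_eqF.
    by rewrite rE dvdp_mull.
  - move=> s.
    have Xc (n : nat) : monic_irreducible ('X - n%:R%:P : {poly F}).
      rewrite /monic_irreducible monicXsubC; apply/asboolP; split.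
        by rewrite size_XsubC.
      move=> q sq qd; rewrite -dvdp_size_eqp // eqn_leq dvdp_leq ?polyXsubC_eq0 //.
      have q0 : q != 0 by apply: contraTneq qd => ->; rewrite dvd0p polyXsubC_eq0.
      by rewrite size_XsubC ltn_neqAle eq_sym sq size_poly_gt0.
    (* The linear polynomials X - n are pairwise distinct in characteristic 0, even though the
       constant field is otherwise arbitrary. *)
    pose g (n : nat) : {q : {poly F} | monic_irreducible q} := Sub ('X - n%:R%:P) (Xc n).
    have ginj : injective g.
      move=> m n /(congr1 val); rewrite !SubK => /addrI/oppr_inj/polyC_inj.
      have cF : [pchar F] =i pred0 by move=> p; rewrite -(fmorph_pchar iF) charK.
      exact: natr_inj_char0.
    have [n nP] := injective_notin s ginj; by exists (g n).
  - move=> x /constP[c ->] x0; rewrite winfE muC //.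
    by apply: contraNneq x0 => ->; rewrite rmorph0.
  - move=> x /constP[c ->] x0; exists c%:P, (c^-1)%:P; rewrite -polyCM mulfV //.
    by apply: contraNneq x0 => ->; rewrite rmorph0.
  - exists (phi 'X); split; first by apply/eqP => /phi_eq0/eqP; rewrite polyX_eq0.
    by rewrite winfE /mu polyX_eq0 size_polyX expr1 gt_eqF // ltr1n.
  - move=> v vu vC.
    have vF c : c != 0 -> v (phi c%:P) = 1.
      move=> c0; apply: vC; last exact: phiC.
      by rewrite /= ik_phi map_polyC hornerC -iFE; exists c.
    have phiE a : phi a = \sum_(i < size a) phi (a`_i)%:P * phi 'X ^+ i.
      rewrite -[a in LHS]coefK poly_def rmorph_sum; apply: eq_bigr => i _.
      by rewrite -mul_polyC !rmorphM rmorphXn.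
    have vterm a i : v (phi (a`_i)%:P * phi 'X ^+ i) <= v (phi 'X) ^+ i.
      have [->|c0] := eqVneq a`_i 0.
        by rewrite rmorph0 mul0r absval0 exprn_ge0 ?absval_ge0.
      by rewrite absvalM vF // mul1r absvalX.
    have [X1|X1] := leP (v (phi 'X)) 1; [left => a|right].
      rewrite phiE; apply: ultrametric_sum => // i _.
      by apply: le_trans (vterm a i) _; rewrite exprn_ile1 ?absval_ge0.
    have X0 : 0 < v (phi 'X) by exact: lt_trans X1.
    (* When [v] exceeds 1 at the variable, the leading term dominates strictly, so [v] is a power of
       the degree absolute value. *)
    have va a : a != 0 -> v (phi a) = v (phi 'X) ^+ (size a).-1.
      move=> a0; have sa : (0 < size a)%N by rewrite size_poly_gt0.
      have top : v (phi (a`_(size a).-1)%:P * phi 'X ^+ (size a).-1) = v (phi 'X) ^+ (size a).-1.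
        by rewrite absvalM vF ?mul1r ?absvalX // -/(lead_coef a) lead_coef_eq0.
      have [n nE] : exists n, size a = n.+1 by exists (size a).-1; rewrite prednK.
      move: (phiE a) top; rewrite nE big_ord_recr => -> top; rewrite -[RHS]top.
      apply: ultrametric_lt => //; rewrite [ltRHS]top /=.
      case: n {nE top} => [|n]; first by rewrite big_ord0 absval0 expr0.
      apply: le_lt_trans (_ : v (phi 'X) ^+ n < _); last by rewrite ltr_eXn2l.
      apply: ultrametric_sum => //; first by rewrite exprn_ge0 // ltW.
      move=> i _; apply: le_trans (vterm a i) _; rewrite ler_eXn2l //.
      by rewrite -ltnS.
    pose s := ln (2 : R) / ln (v (phi 'X)).
    have s0 : 0 < s by rewrite divr_gt0 ?ln_gt0 ?ltr1n.
    have vs : v (phi 'X) `^ s = 2.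
      by rewrite /powR gt_eqF // /s divfK ?gt_eqF ?ln_gt0 // lnK // posrE.
    have vmu a : mu a = v (phi a) `^ s.
      rewrite /mu; case: eqVneq => [->|a0]; first by rewrite rmorph0 absval0 powR0 // gt_eqF.
      by rewrite va // powRX ?absval_ge0 // vs.
    exists s => // y; have [a [b [b0 ->]]] := frac y.
    rewrite absvalM absvalV !winfE !vmu [v (_ / _)]absvalM absvalV powRM ?invr_ge0 ?absval_ge0 //.
    rewrite powR_inv // absval_gt0; apply: contra_neq b0; exact: phi_eq0.
exists {q : {poly F} | monic_irreducible q}, w; split=> // -[i|]; [exact: wS|by rewrite wN].
Qed.

End Realized.

Lemma function_field_base : exists (k : fieldType) (ik : {rmorphism k -> K})
    (I : eqType) (w : option I -> absval R k),
  [/\ range ik = subfield_gen (kappa `|` [set t]), arithmetic_family w (ik @^-1` kappa)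
    & forall o, ultrametric (w o)].
Proof.
have [F [iF iFE]] := subfield_realization kappaP.
have [k [ik ikE]] := subfield_realization (subfield_gen_is_subfield (kappa `|` [set t])).
have gen : kappa `|` [set t] `<=` range ik by rewrite ikE; exact: sub_smallest.
have [rho rhoE] : exists rho : {rmorphism F -> k}, forall x, ik (rho x) = iF x.
  by apply: subfield_factor_rmorphism; rewrite iFE => x kx; apply: gen; left.
have [tk _ tkE] : range ik t by apply: gen; right.
have [I [w [wA wU]]] := function_field_base_realized iFE ikE rhoE tkE.
by exists k, ik, I, w.
Qed.

End FunctionFieldBase.

(** * The product formula over a finite extension *)

Section SimpleExtension.
Variables (k K : fieldType) (ik : {rmorphism k -> K}).
Hypothesis char0 : [pchar k] =i pred0.

Definition generated_by (theta : K) : set K :=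
  [set x | exists p : {poly k}, x = (map_poly ik p).[theta]].

Lemma primitive_element (s : seq K) : (forall x, x \in s -> algebraicOver ik x) ->
  exists2 theta, algebraicOver ik theta & forall x, x \in s -> generated_by theta x.
Proof.
elim: s => [_|x s IHs sA]; first by exists 0 => //; exact: algebraic0.
have [|theta thA thP] := IHs; first by move=> y ys; apply: sA; rewrite inE ys orbT.
have xA : algebraicOver ik x by apply: sA; rewrite mem_head.
have [p p0 pth] := thA; have [q q0 qx] := xA.
have [n /=] := pchar0_PET p0 pth q0 qx char0; set z := _ - _.
move=> [[a aE] [b bE]]; exists z.
  apply: algebraic_sub => //; rewrite -mulr_natr -(rmorph_nat ik).
  by apply: algebraic_mul => //; exact: algebraic_id.
move=> y; rewrite inE => /orP[/eqP->|/thP[c ->]]; first by exists b.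
by exists (c \Po a); rewrite map_comp_poly horner_comp aE.
Qed.

Definition minimal_poly (P : {poly k}) (theta : K) : Prop :=
  [/\ P \is monic, root (map_poly ik P) theta &
      forall p, root (map_poly ik p) theta -> P %| p].

Lemma minimal_poly_ex theta : algebraicOver ik theta -> exists P, minimal_poly P theta.
Proof.
move=> [p p0 pth].
pose T n := `[< exists q : {poly k}, [/\ q != 0, root (map_poly ik q) theta & size q = n] >].
have exT : exists n, T n by exists (size p); apply/asboolP; exists p.
have [n /asboolP[q [q0 qth qn]] nmin] := ex_minnP exT.
have lq : (lead_coef q)^-1 != 0 by rewrite invr_eq0 lead_coef_eq0.
exists ((lead_coef q)^-1 *: q); split.
- by rewrite monicE lead_coefZ mulVf ?lead_coef_eq0.
- by rewrite map_polyZ rootZ // fmorph_eq0.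
move=> r rth; rewrite dvdpZl // /dvdp; apply: contrapT => /negP r0.
have : (n <= size (r %% q)%R)%N.
  apply: nmin; apply/asboolP; exists (r %% q); split=> //.
  have := rth; rewrite {1}(divp_eq r q) rmorphD rmorphM /= !rootE !hornerE.
  by rewrite (rootP qth) mulr0 add0r.
by rewrite leqNgt -qn ltn_modp q0.
Qed.

Lemma minimal_poly_coprime P theta q : minimal_poly P theta ->
  ~~ root (map_poly ik q) theta -> coprimep P q.
Proof.
move=> [Pm Pth Pmin] qth; have P0 := monic_neq0 Pm.
have /dvdpP[E PE] := dvdp_gcdl P q; rewrite /coprimep.
have D0 : gcdp P q != 0 by rewrite gcdp_eq0 negb_and P0.
have : root (map_poly ik P) theta by [].
rewrite {1}PE rmorphM rootM => /orP[Eth|Dth].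
  have E0 : E != 0 by apply: contraNneq P0 => E0; rewrite PE E0 mul0r.
  have := dvdp_leq E0 (Pmin _ Eth); rewrite {1}PE size_mul //.
  move: E0 D0; rewrite -!size_poly_gt0; move: (size E) (size (gcdp P q)) => a b; lia.
have /dvdpP[G GE] := dvdp_gcdr P q.
by case/negP: qth; rewrite GE rmorphM rootM Dth orbT.
Qed.

Lemma deriv_neq0 (F : fieldType) (p : {poly F}) : [pchar F] =i pred0 ->
  (1 < size p)%N -> p^`() != 0.
Proof.
move=> /pcharf0P F0 sp; apply: contraTneq sp => /polyP/(_ (size p).-2).
case sE : (size p) => [|[|n]] //=.
rewrite coef_deriv coef0 /= => /eqP; rewrite -mulr_natr mulf_eq0 F0 orbF.
have -> : p`_n.+1 = lead_coef p by rewrite lead_coefE sE.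
by rewrite lead_coef_eq0 -size_poly_eq0 sE.
Qed.

Lemma minimal_poly_size P theta : minimal_poly P theta -> (1 < size P)%N.
Proof.
move=> [Pm Pth _]; rewrite ltnNge; apply/negP => /size1_polyC PE.
have P0 := monic_neq0 Pm; move: Pth P0; rewrite PE map_polyC rootC polyC_eq0 fmorph_eq0.
by move=> ->.
Qed.

Lemma minimal_poly_deriv P theta : minimal_poly P theta ->
  ~~ root (map_poly ik P^`()) theta.
Proof.
move=> mP; have sP := minimal_poly_size mP; case: mP => Pm Pth Pmin.
apply/negP => /Pmin /dvdp_leq; rewrite deriv_neq0 // => /(_ isT).
by rewrite leqNgt lt_size_deriv // monic_neq0.
Qed.

Lemma minimal_poly_separable P theta : minimal_poly P theta -> separable_poly P.
Proof.
by move=> mP; rewrite separable_poly.unlock; exact: minimal_poly_coprime mP (minimal_poly_deriv mP).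
Qed.

Section Generated.
Variables (P : {poly k}) (theta : K).
Hypothesis mP : minimal_poly P theta.

Lemma generated_by_subfield : is_subfield (generated_by theta).
Proof.
split.
- by exists 1; rewrite rmorph1 hornerE.
- by move=> _ _ [p ->] [q ->]; exists (p - q); rewrite rmorphB !hornerE.
move=> _ _ [p ->] [q ->]; have [q0|q0] := boolP (root (map_poly ik q) theta).
  by exists 0; rewrite (rootP q0) invr0 mulr0 rmorph0 horner0.
have [u [v uv]] := coprimep_bezout (minimal_poly_coprime mP q0).
exists (p * v); rewrite rmorphM hornerM; congr (_ * _).
have /(congr1 (fun r => (map_poly ik r).[theta])) := uv.
rewrite rmorphD !rmorphM rmorph1 /= !hornerE.
have [_ /rootP-> _] := mP; rewrite mulr0 add0r => vq.
by apply: (mulIf (x := (map_poly ik q).[theta])); rewrite ?mulVf ?vq.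
Qed.

Hypothesis gen : forall x, generated_by theta x.

Let rep x := projT1 (cid (gen x)).
Let repE x : x = (map_poly ik (rep x)).[theta].
Proof. exact: projT2 (cid (gen x)). Qed.

Section Conjugate.
Variables (C : fieldType) (iC : {rmorphism k -> C}) (z : C).
Hypothesis Pz : root (map_poly iC P) z.

Let conj_eq p q : (map_poly ik p).[theta] = (map_poly ik q).[theta] ->
  (map_poly iC p).[z] = (map_poly iC q).[z].
Proof.
move=> pq; have [_ _ Pmin] := mP.
have /dvdpP[r rE] : P %| p - q.
  by apply: Pmin; rewrite rmorphB rootE !hornerE pq subrr.
apply/eqP; rewrite -subr_eq0 -hornerN -hornerD -rmorphB rE rmorphM hornerM.
by rewrite (rootP Pz) mulr0.
Qed.

Definition conjugation x := (map_poly iC (rep x)).[z].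

Lemma conjugationE p : conjugation (map_poly ik p).[theta] = (map_poly iC p).[z].
Proof. by apply: conj_eq; rewrite -repE. Qed.

Lemma conjugation_zmod : zmod_morphism conjugation.
Proof.
move=> x y; rewrite {1}[x]repE {1}[y]repE -hornerN -hornerD -rmorphB conjugationE.
by rewrite rmorphB !hornerE.
Qed.

Lemma conjugation_monoid : monoid_morphism conjugation.
Proof.
split; first by have := conjugationE 1; rewrite !rmorph1 !hornerE.
by move=> x y; rewrite {1}[x]repE {1}[y]repE -hornerM -rmorphM conjugationE rmorphM hornerM.
Qed.

HB.instance Definition _ := GRing.isZmodMorphism.Build K C conjugation conjugation_zmod.
HB.instance Definition _ := GRing.isMonoidMorphism.Build K C conjugation conjugation_monoid.

Lemma conjugation_rmorphism : exists sigma : {rmorphism K -> C},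
  forall p, sigma (map_poly ik p).[theta] = (map_poly iC p).[z].
Proof. by exists conjugation; exact: conjugationE. Qed.

End Conjugate.

Variables (n : nat).
Hypothesis sP : size P = n.+2.

(** The norm is the determinant of [g] evaluated at the companion matrix of [P]. It is one element
    of [k] serving all fields [C] at once, which matters because the closed field changes with the
    absolute value of [k]. *)
Lemma norm_product (g : {poly k}) : exists N : k,
  forall (C : fieldType) (iC : {rmorphism k -> C}) (z : 'I_n.+1 -> C),
    injective z -> (forall i, root (map_poly iC P) (z i)) ->
    iC N = \prod_i (map_poly iC g).[z i].
Proof.
pose M : 'M[k]_n.+1 := \matrix_(i, j) if i == ord_max then - P`_j else (i.+1 == j)%:R.
exists (\det (horner_mx M g)) => C iC z zinj zP.
have [Pm _ _] := mP.
rewrite -det_map_mx map_horner_mx; set A := map_mx iC M.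
pose zr : 'rV[C]_n.+1 := \row_j z j.
(* The Vandermonde matrix of the roots diagonalises the companion matrix, and is invertible since
   the roots are distinct. *)
pose V := Vandermonde n.+1 zr.
have Vu : V \in unitmx.
  rewrite unitmxE unitfE det_Vandermonde prodf_seq_neq0; apply/allP => i _ /=.
  rewrite prodf_seq_neq0; apply/allP => j _; apply/implyP => ij.
  by rewrite !mxE subr_eq0 (inj_eq zinj) eq_sym neq_ltn ij.
have AV : A *m V = V *m diag_mx zr.
  apply/matrixP => i j; rewrite mul_mx_diag !mxE.
  have [->|im] := eqVneq i ord_max.
    under eq_bigr do rewrite !mxE eqxx.
    have := rootP (zP j); rewrite horner_coef size_map_poly sP big_ord_recr /=.
    have -> : (map_poly iC P)`_n.+1 = 1.
      by rewrite coef_map /=; move: Pm; rewrite monicE lead_coefE sP => /eqP->; exact: rmorph1.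
    rewrite mul1r => /eqP; rewrite addrC addr_eq0 -exprSr => /eqP->.
    rewrite -sumrN; apply: eq_bigr => l _; by rewrite rmorphN mulNr coef_map.
  have in' : (i.+1 < n.+1)%N.
    by rewrite ltn_neqAle ltn_ord andbT; apply: contra im => /eqP[] h; apply/eqP/val_inj.
  rewrite (bigD1 (Ordinal in')) //= !mxE (negbTE im) /= eqxx rmorph1 mul1r.
  rewrite big1 ?addr0 ?exprSr // => l li; rewrite !mxE (negbTE im).
  case: eqP => h; last by rewrite rmorph0 mul0r.
  by case/eqP: li; apply: val_inj; rewrite /= h.
have AE : A = V *m diag_mx zr *m invmx V by rewrite -AV mulmxK.
rewrite AE horner_mx_uconj // horner_mx_diag !det_mulmx mulrAC -det_mulmx mulmxV //.
rewrite det1 mul1r det_diag; apply: eq_bigr => i _; by rewrite !mxE.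
Qed.

End Generated.

End SimpleExtension.

Section ProductFormulaFacts.
Variables (R : realType) (K : fieldType) (M : eqType) (w : M -> absval R K).
Hypothesis pf : product_formula w.

Lemma pf_support x : exists s : seq M, forall i, i \notin s -> x != 0 -> w i x = 1.
Proof.
have [->|x0] := eqVneq x 0; first by exists [::] => i _.
by have [s [_ s1 _]] := pf x0; exists s => i /s1.
Qed.

Lemma pf_bound (l : seq K) : exists s : seq M, forall i, i \notin s ->
  forall x, x \in l -> w i x <= 1.
Proof.
elim: l => [|y l [s sP]]; first by exists [::].
have [s' s'P] := pf_support y; exists (s' ++ s) => i.
rewrite mem_cat negb_or => /andP[is' /sP h] x; rewrite inE => /orP[/eqP->|/h//].
by have [->|/(s'P _ is')->] := eqVneq y 0; rewrite ?absval0.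
Qed.

Lemma prod_support (F : M -> R) (s t : seq M) : uniq s -> uniq t ->
  (forall i, i \notin s -> F i = 1) -> {subset s <= t} ->
  \prod_(i <- t) F i = \prod_(i <- s) F i.
Proof.
move=> us ut F1 st; rewrite (bigID (mem s)) /= [X in _ * X]big1 ?mulr1; last by move=> i /F1.
rewrite -big_filter; apply: perm_big; apply: uniq_perm; rewrite ?filter_uniq //.
by move=> i; rewrite mem_filter andb_idr //; exact: st.
Qed.

Lemma pf_prod x (t : seq M) : x != 0 -> uniq t -> (forall i, i \notin t -> w i x = 1) ->
  \prod_(i <- t) w i x = 1.
Proof.
move=> x0 ut t1; have [s [us s1 sE]] := pf x0; rewrite -[RHS]sE.
have uu : uniq (undup (s ++ t)) by exact: undup_uniq.
rewrite -(@prod_support (fun i => w i x) t (undup (s ++ t))) //.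
  by rewrite (@prod_support (fun i => w i x) s) // => i si; rewrite mem_undup mem_cat si.
by move=> i it; rewrite mem_undup mem_cat it orbT.
Qed.

End ProductFormulaFacts.

Lemma ultrametric_integral (R : realType) (K : fieldType) (v : absval R K)
    (p : {poly K}) x : ultrametric v -> p \is monic -> root p x ->
  (forall i, v p`_i <= 1) -> v x <= 1.
Proof.
move=> vu pm px p1; rewrite leNgt; apply/negP => x1.
have x0 : 0 < v x by exact: lt_trans x1.
have sp : (0 < size p)%N by rewrite size_poly_gt0 monic_neq0.
have [n nE] : exists n, size p = n.+1 by exists (size p).-1; rewrite prednK.
have := rootP px; rewrite horner_coef nE big_ord_recr /=.
have -> : p`_n = 1 by move: pm; rewrite monicE lead_coefE nE => /eqP.
rewrite mul1r => /eqP; rewrite addr_eq0 => /eqP/(congr1 v).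
rewrite absvalN absvalX; case: n {nE} => [|n].
  by rewrite big_ord0 absval0 expr0 => /esym/eqP; rewrite oner_eq0.
move=> E; have : v x ^+ n.+1 <= v x ^+ n.
  rewrite -E; apply: ultrametric_sum => // [|i _]; first by rewrite exprn_ge0 // ltW.
  rewrite absvalM absvalX; apply: (@le_trans _ _ (v x ^+ i)).
    by rewrite ler_piMl // exprn_ge0 // ltW.
  by rewrite ler_eXn2l // -ltnS.
by rewrite leNgt ltr_eXn2l // ltnSn.
Qed.

Section ExtendProductFormula.
Variables (R : realType) (k K : fieldType) (ik : {rmorphism k -> K}).
Hypothesis char0 : [pchar k] =i pred0.
Variables (P : {poly k}) (theta : K).
Hypothesis mP : minimal_poly ik P theta.
Hypothesis gen : forall x, generated_by ik theta x.
Variables (W : eqType) (w : W -> absval R k) (o0 : W).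
Hypothesis pfw : product_formula w.
Hypothesis wU : exists s : seq W, forall o, o \notin s -> ultrametric (w o).
Hypothesis wext : forall o, exists (C : closedFieldType) (iC : {rmorphism k -> C})
  (V : absval R C), (forall c, V (iC c) = w o c) /\ (ultrametric (w o) -> ultrametric V).

Lemma generated_algebraic x : algebraicOver ik x.
Proof.
have [p ->] := gen x; apply/integral_algebraic; apply: integral_horner.
  by move=> c /(nthP 0)[i _ <-]; rewrite coef_map; exact: integral_id.
by apply/integral_algebraic; exists P; case: mP => // Pm _ _; exact: monic_neq0.
Qed.

(** All embeddings of [K] over [k] are used, even if several induce the same absolute value:
    repetition stands in for the local degree, and the product over the embeddings is the value of
    the norm. *)
Lemma conjugate_absvals n : size P = n.+2 -> exists Nm : {poly k} -> k,
  forall o, exists v : 'I_n.+1 -> absval R K,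
  [/\ forall i c, v i (ik c) = w o c,
      ultrametric (w o) -> forall i, ultrametric (v i)
    & forall g, w o (Nm g) = \prod_i v i (map_poly ik g).[theta]].
Proof.
move=> sP; pose Nm g := projT1 (cid (norm_product mP sP g)).
have NmE g := projT2 (cid (norm_product mP sP g)); exists Nm => o.
have [C [iC [V [Vw VU]]]] := wext o.
have [z zE] := closed_field_poly_normal (map_poly iC P).
have Pm : map_poly iC P \is monic by rewrite map_monic; case: mP.
rewrite (monicP Pm) scale1r in zE.
have uz : uniq z.
  by rewrite -separable_prod_XsubC -zE separable_map; exact: minimal_poly_separable mP.
have sz : size z = n.+1.
  by have := congr1 (fun p : {poly C} => size p) zE; rewrite size_map_poly sP size_prod_XsubC => -[].
have zP (i : 'I_n.+1) : root (map_poly iC P) z`_i.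
  by rewrite zE root_prod_XsubC mem_nth // sz.
have zinj : injective (fun i : 'I_n.+1 => z`_i).
  by move=> i j /eqP; rewrite nth_uniq ?sz // => /eqP/val_inj.
pose sigma i := projT1 (cid (conjugation_rmorphism mP gen (zP i))).
have sigmaE i := projT2 (cid (conjugation_rmorphism mP gen (zP i))).
exists (fun i => absval_pullback (sigma i) V); split.
- move=> i c /=; rewrite -Vw; congr (V _).
  by have := sigmaE i c%:P; rewrite !map_polyC !hornerC.
- by move=> /VU VU' i x y /=; rewrite rmorphD; exact: VU'.
- move=> g; rewrite -Vw (NmE g C iC _ zinj zP) absval_prod.
  by apply: eq_bigr => i _ /=; rewrite -(sigmaE i).
Qed.

(** Over each index of [W] the product is the value of the norm, so the formula is inherited from
    [k]. That almost all single factors equal 1 does not follow from the norm: it comes from [x] and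
    its inverse both being roots of monic polynomials with coefficients integral almost
    everywhere. *)
Theorem extend_product_formula : exists n (v : W * 'I_n.+1 -> absval R K),
  [/\ size P = n.+2, product_formula v, forall p c, v p (ik c) = w p.1 c
    & forall p, ultrametric (w p.1) -> ultrametric (v p)].
Proof.
have [n sP] : exists n, size P = n.+2.
  have := minimal_poly_size mP; case: (size P) => [|[|n]] // _; by exists n.
have [Nm] := conjugate_absvals sP; move=> /choice[v vP].
exists n, (fun p => v p.1 p.2); split=> //; last 2 first.
- by move=> [q i] c; have [h _ _] := vP q; exact: h.
- by move=> [q i] /= oU; have [_ h _] := vP q; exact: h.
have ub x : exists s : seq W, forall o, o \notin s -> forall i, v o i x <= 1.
  have /integral_algebraic[p pm px] := generated_algebraic x.
  have [s sb] := pf_bound pfw p; have [s' s'U] := wU.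
  exists (s ++ s') => o; rewrite mem_cat negb_or => /andP[os os'] i.
  have [vik vU _] := vP o.
  apply: (@ultrametric_integral _ _ _ (map_poly ik p)) => //.
  - exact/vU/s'U.
  - by rewrite map_monic.
  move=> l; rewrite coef_map vik; have [sl|sl] := ltnP l (size p).
    by apply: sb => //; exact: mem_nth.
  by rewrite nth_default // absval0.
move=> x x0; have [s1 h1] := ub x; have [s2 h2] := ub x^-1.
have v1 o i : o \notin s1 ++ s2 -> v o i x = 1.
  rewrite mem_cat negb_or => /andP[os1 os2]; apply/eqP; rewrite eq_le h1 //=.
  by have := h2 o os2 i; rewrite absvalV invf_le1 // absval_gt0.
have [g gE] := gen x.
have N0 : Nm g != 0.
  have [_ _ NE] := vP o0; rewrite -(absval_eq0 (w o0)) NE -gE prodf_seq_neq0.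
  by apply/allP => i _; rewrite absval_eq0 x0.
pose t := undup (s1 ++ s2).
have wN o : o \notin t -> w o (Nm g) = 1.
  by rewrite mem_undup => ot; have [_ _ ->] := vP o; rewrite -gE big1 // => i _; exact: v1.
exists [seq (o, i) | o <- t, i <- enum 'I_n.+1]; split.
- by apply: allpairs_uniq; rewrite ?undup_uniq ?enum_uniq // => -[? ?] [? ?].
- move=> [q i] oi; apply: v1; apply: contra oi => ot.
  by apply/allpairsP; exists (q, i); rewrite mem_undup ot mem_enum.
rewrite big_allpairs -[RHS](pf_prod pfw N0 (undup_uniq _) wN).
apply: eq_bigr => o _ /=; have [_ _ ->] := vP o; rewrite -gE.
by rewrite big_enum.
Qed.

End ExtendProductFormula.

(** * Places above a given absolute value *)

Section IndependenceOfAbsvals.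
Import numFieldNormedType.Exports.
Variables (R : realType) (k K : fieldType) (ik : {rmorphism k -> K}).
Variables (w : absval R k).
Hypothesis wn : absval_nontrivial w.

Lemma nontrivial_lt1 : exists2 x, x != 0 & w x < 1.
Proof.
have [x x0 x1] := wn; have [xlt|xge] := ltP (w x) 1; first by exists x.
exists x^-1; first by rewrite invr_eq0.
by rewrite absvalV invf_lt1 ?absval_gt0 // lt_neqAle eq_sym x1.
Qed.

Lemma small_power (r C : R) : 0 <= r < 1 -> 0 <= C ->
  exists N0 : nat, forall N, (N0 <= N)%N -> r ^+ N * C < 1.
Proof.
move=> /andP[r0 r1] C0.
have cv : (fun N => r ^+ N * C) @ \oo --> 0 * C.
  apply: cvgMl; apply: cvg_expr; by rewrite ger0_norm.
rewrite mul0r in cv.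
have /cvgr_lt /(_ 1 ltr01)[N0 _ h] := cv.
by exists N0 => N NN; exact: h.
Qed.

Lemma uniform_threshold n (Q : nat -> nat -> Prop) :
  (forall i, (i < n)%N -> exists N0, forall N, (N0 <= N)%N -> Q i N) ->
  exists N0, forall N, (N0 <= N)%N -> forall i, (i < n)%N -> Q i N.
Proof.
elim: n => [_|n IHn h]; first by exists 0%N.
have [|N1 h1] := IHn; first by move=> i ni; apply: h; exact: ltnW.
have [N2 h2] := h n (ltnSn n); exists (maxn N1 N2) => N.
rewrite geq_max => /andP[NN1 NN2] i; rewrite ltnS leq_eqVlt => /orP[/eqP->|ni].
  exact: h2.
exact: h1.
Qed.

Lemma ln_absval_exprz (F : fieldType) (v : absval R F) x (m : int) : x != 0 ->
  ln (v (x ^ m)) = m%:~R * ln (v x).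
Proof.
move=> x0; case: m => n.
  by rewrite -exprnP absvalX lnXn ?absval_gt0 // mulr_natl.
rewrite NegzE -exprnN absvalV lnV ?posrE ?absval_gt0 ?expf_neq0 //.
by rewrite absvalX lnXn ?absval_gt0 // -mulr_natl mulrNz mulNr.
Qed.

Definition extends (v : absval R K) := ultrametric v /\ forall c, v (ik c) = w c.

(** [u] and [v] agree on [k], so a power of an element [pi] of [k] can be fitted between the values
    that they take at a high power of [x]. *)
Lemma separate_two (u v : absval R K) x : extends u -> extends v -> u x <> v x ->
  exists z, v z < 1 /\ 1 < u z.
Proof.
move=> [uu uw] [vu vw].
wlog vux : x / v x < u x => [hw uvx|_].
  have /eqP := uvx; rewrite neq_lt => /orP[h|h]; last by apply: (hw x) => // /esym.
  have x0 : x != 0 by rewrite -(absval_gt0 v) (le_lt_trans _ h) ?absval_ge0.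
  have h' : v x^-1 < u x^-1.
    have [u0|u0] := eqVneq (u x) 0; first by move/eqP: u0; rewrite absval_eq0 (negbTE x0).
    by rewrite !absvalV ltf_pV2 ?posrE ?absval_gt0.
  by apply: (hw x^-1) => // E'; rewrite E' ltxx in h'.
have x0 : x != 0 by rewrite -(absval_gt0 u) (le_lt_trans _ vux) ?absval_ge0.
have [pi pi0 pi1] := nontrivial_lt1.
set a := ln (v x); set b := ln (u x); set L := ln (w pi).
have ab : a < b by rewrite /a /b ltr_ln ?posrE ?absval_gt0.
have L0 : L < 0 by rewrite ln_lt0 // absval_gt0 pi0 pi1.
have [n nP] : exists n : nat, - L < n%:R * (b - a).
  exists (Num.bound (- L / (b - a))).
  rewrite -ltr_pdivrMr ?subr_gt0 //; apply: archi_boundP.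
  by rewrite divr_ge0 ?oppr_ge0 ?subr_ge0 // ltW.
(* [m%:~R * L] is the multiple of [L] next below [n%:R * b]; it stays above [n%:R * a] because [n]
   made that gap longer than [- L]. *)
pose m := Num.floor (n%:R * b / L) + 1.
have m1 : m%:~R * L < n%:R * b.
  rewrite -ltr_ndivrMr // /m; exact: floorD1_gt.
have m2 : n%:R * a < m%:~R * L.
  have : n%:R * b + L <= m%:~R * L.
    rewrite /m intrD mulrDl mul1r lerD2r -ler_ndivlMr //; exact: floor_le.
  apply: lt_le_trans; move: nP; rewrite mulrBr; lra.
have ikpi : ik pi != 0 by rewrite fmorph_eq0.
exists (x ^+ n / ik pi ^ m).
have zpos (t : absval R K) : 0 < t (x ^+ n / ik pi ^ m).
  by rewrite absval_gt0 mulf_neq0 ?expf_neq0 // invr_eq0 expfz_neq0.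
have lnz (t : absval R K) : extends t -> ln (t (x ^+ n / ik pi ^ m)) = n%:R * ln (t x) - m%:~R * L.
  move=> [_ tw]; rewrite absvalM absvalV lnM ?posrE ?invr_gt0 ?absval_gt0 ?expf_neq0 ?expfz_neq0 //.
  rewrite lnV ?posrE ?absval_gt0 ?expfz_neq0 // absvalX lnXn ?absval_gt0 //.
  by rewrite ln_absval_exprz // tw mulr_natl.
split.
  by rewrite -ltr_ln ?posrE // ln1 lnz // subr_lt0.
by rewrite -ltr_ln ?posrE // ln1 lnz // subr_gt0.
Qed.

(** The inductive step corrects [z], good for the first [n] absolute values, by a [y] that separates
    [u] from [v n]. If [v n z] is at most 1, a power of [z] times [y] works. Otherwise the power is
    replaced by z^N / (1 + z^N), which has value 1 where [z] is large and is tiny where [z] is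
    small. *)
Lemma weak_approximation (n : nat) (u : absval R K) (v : nat -> absval R K) :
  extends u -> (forall i, (i < n)%N -> extends (v i) /\ exists x, u x <> v i x) ->
  exists z, 1 < u z /\ forall i, (i < n)%N -> v i z < 1.
Proof.
move=> ue; have [uu uw] := ue; elim: n => [_|n IHn h].
  have [pi pi0 pi1] := nontrivial_lt1; exists (ik pi)^-1; split=> //.
  by rewrite absvalV uw invf_gt1 // absval_gt0.
have [|z [uz vz]] := IHn; first by move=> i ni; apply: h; exact: ltnW.
have [vne [x ux]] := h n (ltnSn n); have [vnu _] := vne.
have [y [vy uy]] := separate_two ue vne ux.
have [N0 hN] : exists N0, forall N, (N0 <= N)%N -> forall i, (i < n)%N -> v i z ^+ N * v i y < 1.
  apply: uniform_threshold => i ni; apply: small_power; last exact: absval_ge0.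
  by rewrite absval_ge0 vz.
have hN1 := hN N0.+1 (leqnSn _).
have uz0 : 0 < u z by exact: lt_trans uz.
have [vnz|vnz] := leP (v n z) 1.
  exists (z ^+ N0.+1 * y); split.
    by rewrite absvalM absvalX mulr_egt1 // exprn_egt1.
  move=> i; rewrite absvalM absvalX ltnS leq_eqVlt => /orP[/eqP->|]; last exact: hN1.
  by apply: le_lt_trans vy; rewrite ler_piMl ?absval_ge0 // exprn_ile1 ?absval_ge0.
have big (t : absval R K) : ultrametric t -> 1 < t z -> t (z ^+ N0.+1 / (1 + z ^+ N0.+1) * y) = t y.
  move=> tu tz; have zN : 1 < t (z ^+ N0.+1) by rewrite absvalX exprn_egt1.
  rewrite !absvalM absvalV (ultrametric_lt tu) ?absval1 // divff ?mul1r //.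
  by rewrite gt_eqF // (lt_trans _ zN).
exists (z ^+ N0.+1 / (1 + z ^+ N0.+1) * y); split; first by rewrite big.
move=> i; rewrite ltnS leq_eqVlt => /orP[/eqP->|ni]; first by rewrite big.
have [[viu _] _] := h i (ltnW ni).
rewrite !absvalM absvalV addrC (ultrametric_lt viu).
  by rewrite absval1 invr1 mulr1 absvalX; exact: hN1.
by rewrite absval1 absvalX exprn_ilt1 ?absval_ge0 ?vz.
Qed.

(** Elements large at one extension and small at all the others are linearly independent over [k]:
    in a relation, the term with the largest coefficient dominates at its own absolute value. *)
Lemma extensions_bounded (D m : nat) (b : 'I_D -> K) (v : 'I_m -> absval R K) :
  (forall x, exists c : 'I_D -> k, x = \sum_i ik (c i) * b i) ->
  (forall l, extends (v l)) -> (forall l l', l != l' -> exists x, v l x <> v l' x) ->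
  (m <= D)%N.
Proof.
move=> span ve vd; rewrite leqNgt; apply/negP => Dm.
have zex l : exists z, 1 < v l z /\ forall l', l' != l -> v l' z < 1.
  pose others := [seq i <- enum 'I_m | i != l].
  have [||z [z1 z2]] := @weak_approximation (size others) (v l) (fun i => v (nth l others i)).
  - exact: ve.
  - move=> i io; split=> //; apply: vd.
    by have := mem_nth l io; rewrite mem_filter eq_sym => /andP[].
  exists z; split=> // l' ll'; have lo : l' \in others by rewrite mem_filter ll' mem_enum.
  by have := z2 (index l' others); rewrite index_mem nth_index //; exact.
have /choice[z zP] := zex.
have /choice[c cP] := fun l => span (z l).
pose A : 'M[k]_(m, D) := \matrix_(l, i) c l i.
have : kermx A != 0.
  by rewrite kermx_eq0 /row_free neq_ltn (leq_ltn_trans (rank_leq_col A) Dm).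
move=> /rowV0Pn[u /sub_kermxP uA u0].
have sum0 : \sum_l ik (u 0 l) * z l = 0.
  under eq_bigr do rewrite cP mulr_sumr.
  rewrite exchange_big /= big1 // => i _.
  under eq_bigr do rewrite mulrA -rmorphM.
  rewrite -mulr_suml -rmorph_sum; have /rowP/(_ i) := uA; rewrite !mxE => E'.
  by rewrite (eq_bigr (fun l => u 0 l * A l i)) ?E' ?rmorph0 ?mul0r // => l _; rewrite mxE.
have [l0 ul0] : exists l, u 0 l != 0 by apply/rV0Pn.
pose l := [arg max_(l > l0) w (u 0 l)]%O.
have lmax l' : w (u 0 l') <= w (u 0 l) by rewrite /l; case: arg_maxP => // i _ h; exact: h.
have wl : 0 < w (u 0 l).
  by apply: lt_le_trans (lmax l0); rewrite absval_gt0.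
have [vlu vlw] := ve l; have [zl1 zl2] := zP l.
have big : w (u 0 l) < v l (ik (u 0 l) * z l) by rewrite absvalM vlw ltr_pMr.
move: sum0; rewrite (bigD1 l) //= => /eqP; rewrite addr_eq0 => /eqP/(congr1 (v l)).
rewrite absvalN => E'; move: big; rewrite E' ltNge; apply/negP; rewrite negbK.
apply: ultrametric_sum => //; first exact: ltW.
move=> l' ll'; have [_ h] := zP l'.
rewrite absvalM vlw; apply: le_trans (lmax l'); rewrite ler_piMr ?absval_ge0 // ltW //.
by apply: h; rewrite eq_sym.
Qed.

End IndependenceOfAbsvals.

Lemma bounded_finite_set (T : Type) (A : set T) (D : nat) :
  (forall f : 'I_D.+1 -> T, injective f -> (forall i, A (f i)) -> False) -> finite_set A.
Proof.
move=> h; apply: contrapT => Ainf.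
have [f finj fA] : exists2 f : 'I_D.+1 -> T, injective f & forall i, A (f i).
  move: {h} D.+1 => n; elim: n => [|n [f finj fA]]; first by exists (fun i : 'I_0 => match notF (ltn_ord i) with end) => -[].
  have [x Ax xf] : exists2 x, A x & ~ range f x.
    apply: contrapT => nx; apply: Ainf.
    apply: (@sub_finite_set _ _ (range f)); last exact/finite_image/finite_finset.
    by move=> x Ax; apply: contrapT => xf; apply: nx; exists x.
  exists (fun i => if unlift ord_max i is Some l then f l else x).
    move=> i i'; case: unliftP => [l ->|->]; case: unliftP => [l' ->|->] //.
    - by move=> /finj->.
    - by move=> fx; case: xf; exists l.
    - by move=> fx; case: xf; exists l'.
  by move=> i; case: unliftP.
exact: (h f).
Qed.

Section AbsvalPower.
Variables (R : realType) (K : fieldType) (a : absval R K) (s : R).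
Hypotheses (au : ultrametric a) (s0 : 0 < s).

Let pw x := a x `^ s.

Let pw_ge0 x : 0 <= pw x. Proof. exact: powR_ge0. Qed.

Let pw_eq0 x : (pw x == 0) = (x == 0).
Proof. by rewrite /pw powR_eq0 absval_eq0 (gt_eqF s0) andbT. Qed.

Let pwM x y : pw (x * y) = pw x * pw y.
Proof. by rewrite /pw absvalM powRM ?absval_ge0. Qed.

Let pwU x y : pw (x + y) <= Num.max (pw x) (pw y).
Proof.
have := au x y; rewrite !le_max => /orP[] h; apply/orP; [left|right];
  by rewrite ge0_ler_powR ?nnegrE ?absval_ge0 // ltW.
Qed.

Let pwD x y : pw (x + y) <= pw x + pw y.
Proof. by apply: le_trans (pwU x y) _; rewrite ge_max lerDl lerDr !pw_ge0. Qed.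

Lemma absval_power : exists b : absval R K, ultrametric b /\ forall x, b x = a x `^ s.
Proof. by exists (AbsVal pw_ge0 pw_eq0 pwM pwD). Qed.

End AbsvalPower.

Section EquivalentAbsvals.
Variables (R : realType) (K : fieldType).
Implicit Types v w : absval R K.

Lemma absval_equiv_eq1 v w x : absval_equiv v w -> v x = 1 -> w x = 1.
Proof. by move=> [s _ ->] ->; rewrite powR1. Qed.

Lemma absval_equiv_le1 v w x : absval_equiv v w -> v x <= 1 -> w x <= 1.
Proof.
move=> vw; rewrite !le_eqVlt => /orP[/eqP/(absval_equiv_eq1 vw)->|/(absval_equiv_lt1 vw)->].
  by rewrite eqxx.
by rewrite orbT.
Qed.

Lemma absval_equiv_nontrivial v w : absval_equiv v w ->
  absval_nontrivial v -> absval_nontrivial w.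
Proof.
move=> vw [x x0 vx]; exists x => //; apply: contra_neq vx.
exact/absval_equiv_eq1/absval_equiv_sym.
Qed.

End EquivalentAbsvals.

Section Places.
Variables (R : realType) (K : fieldType) (B : global_field K).
Implicit Types p q : place R B.

Lemma place_ext p q : place_class p = place_class q -> p = q.
Proof.
case: p q => [c cP] [d dP] /= cd; subst d; congr Place; exact: Prop_irrelevance.
Qed.

Lemma place_equiv p a b : place_class p a -> place_class p b <-> absval_equiv a b.
Proof.
have [v _ ->] := place_classP p => /= va; split=> [vb|ab].
  exact: absval_equiv_trans (absval_equiv_sym va) vb.
exact: absval_equiv_trans va ab.
Qed.

Lemma place_nonempty p : exists a, place_class p a.
Proof. by have [v _ ->] := place_classP p; exists v; exact: absval_equiv_refl. Qed.

Lemma place_eq p q a b : place_class p a -> place_class q b -> absval_equiv a b -> p = q.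
Proof.
move=> pa qb ab; apply/place_ext/seteqP; split=> c.
  move=> /(place_equiv c pa) ac; apply/(place_equiv c qb).
  exact: absval_equiv_trans (absval_equiv_sym ab) ac.
move=> /(place_equiv c qb) bc; apply/(place_equiv c pa).
exact: absval_equiv_trans ab bc.
Qed.

Lemma place_nontrivial p a : place_class p a -> absval_nontrivial a.
Proof.
by have [v [vn _] ->] := place_classP p => /absval_equiv_nontrivial; exact.
Qed.

Lemma place_constants p a c : place_class p a -> constants B c -> c != 0 -> a c = 1.
Proof.
have [v [_ vc] ->] := place_classP p => va Bc c0.
by apply: (absval_equiv_eq1 va); exact: vc.
Qed.

End Places.

(** * Places above one place of the base field, and poles *)

Section FiniteFibres.
Variables (R : realType) (K : fieldType) (B : global_field K).
Variables (k : fieldType) (ik : {rmorphism k -> K}) (W : eqType) (w : W -> absval R k).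
Hypothesis wA : arithmetic_family w (ik @^-1` constants B).
Variables (D : nat) (b : 'I_D -> K).
Hypothesis span : forall x, exists c : 'I_D -> k, x = \sum_i ik (c i) * b i.
Hypothesis alg : forall x, algebraicOver ik x.

(** Each such place has a representative extending [w o] exactly, obtained by taking a power.
    Distinct places give distinct extensions, and there are at most [D] of these. *)
Lemma places_over_finite o : finite_set [set p : place R B | is_prime p /\
  exists a, place_class p a /\ absval_equiv (absval_pullback ik a) (w o)].
Proof.
apply: (@bounded_finite_set _ _ D) => f finj fA.
have : forall l, exists a b' : absval R K, [/\ place_class (f l) a, absval_equiv a b' &
    extends ik (w o) b'].
  move=> l; have [pl [a [fa [s s0 h]]]] := fA l.
  have [b' [b'u b'E]] := absval_power (pl a fa) s0.
  exists a, b'; split=> //; first by exists s.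
  by split=> // c; rewrite b'E h.
move=> /choice[a /choice[b' ab]].
have := @extensions_bounded _ _ _ ik _ (af_nontrivial wA o) D D.+1 b b' span.
rewrite ltnn => h; suff : false by []; apply: h.
  by move=> l; have [] := ab l.
move=> l l' ll'; apply: contrapT => /forallNP E.
have {}E x : b' l x = b' l' x by exact: contrapT (E x).
case/eqP: ll'; apply: finj.
have [fl al _] := ab l; have [fl' al' _] := ab l'.
apply: (place_eq fl fl'); apply: absval_equiv_trans al _.
apply: (@absval_equiv_trans _ _ _ (b' l')); last exact: absval_equiv_sym.
by exists 1 => // x; rewrite E powRr1 // absval_ge0.
Qed.

(** [c] is a root of a monic polynomial over [k], hence integral wherever the coefficients are; the
    exceptions lie above finitely many [w o]. *)
Lemma finitely_many_poles c : finite_set [set p : place R B | is_prime p /\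
  exists a, place_class p a /\ 1 < a c].
Proof.
have /integral_algebraic[q qm qc] := alg c.
have [s sb] := pf_bound (af_product wA) q.
have int (a : absval R K) x (r : {poly k}) : ultrametric a -> r \is monic ->
    root (map_poly ik r) x -> (forall i, a (ik r`_i) <= 1) -> a x <= 1.
  move=> au rm rx r1; apply: (@ultrametric_integral _ _ _ (map_poly ik r)) => //.
    by rewrite map_monic.
  by move=> i; rewrite coef_map; exact: r1.
apply: (@sub_finite_set _ _ (\bigcup_(o in [set` s]) [set p : place R B | is_prime p /\
  exists a, place_class p a /\ absval_equiv (absval_pullback ik a) (w o)])); last first.
  by apply: bigcup_finite => // o _; exact: places_over_finite.
move=> p [pp [a [pa ac]]]; have au := pp a pa.
have aku : ultrametric (absval_pullback ik a) by move=> x y /=; rewrite rmorphD; exact: au.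
(* A place trivial on [k] would be at most 1 on everything algebraic over [k], inverses included,
   and so would be trivial on [K]. *)
have akn : absval_nontrivial (absval_pullback ik a).
  have [x x0 ax] := place_nontrivial pa; apply: contrapT => triv.
  have ak1 y : y != 0 -> a (ik y) = 1.
    by move=> y0; apply/eqP; apply: contrapT => /negP ay; apply: triv; exists y.
  have ak y : a (ik y) <= 1.
    by have [->|/ak1->//] := eqVneq y 0; rewrite rmorph0 absval0 ler01.
  have alg1 y : a y <= 1.
    by have /integral_algebraic[r rm ry] := alg y; exact: int ry _.
  case/eqP: ax; apply/eqP; rewrite eq_le alg1 /=.
  by have := alg1 x^-1; rewrite absvalV invf_le1 ?absval_gt0.
have akc d : (ik @^-1` constants B) d -> d != 0 -> absval_pullback ik a d = 1.
  by move=> Bd d0; apply: (place_constants pa Bd); rewrite fmorph_eq0.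
have [l wl] := af_ostrowski wA aku akn akc.
exists l; last by split=> //; exists a.
apply: contrapT => /negP ls; move: ac; rewrite ltNge; case/negP.
apply: (int a c q) => // i.
suff : absval_pullback ik a q`_i <= 1 by [].
apply: (absval_equiv_le1 (absval_equiv_sym wl)).
have [si|si] := ltnP i (size q); first by apply: sb => //; exact: mem_nth.
by rewrite nth_default // absval0 ler01.
Qed.

End FiniteFibres.

Lemma normc_absval (R : realType) : exists V : absval R (complex.complex R),
  forall r : R, V (complex.Complex r 0) = `|r|.
Proof.
pose nc := fun z : complex.complex R => complex.ComplexField.Normc.normc z.
have h1 z : 0 <= nc z by rewrite /nc; case: z => a b; exact: sqrtr_ge0.
have h2 z : (nc z == 0) = (z == 0).
  apply/eqP/eqP => [|->]; first exact: complex.ComplexField.Normc.eq0_normc.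
  exact: complex.ComplexField.Normc.normc0.
have h3 y z : nc (y * z) = nc y * nc z by exact: complex.ComplexField.Normc.normcM.
have h4 y z : nc (y + z) <= nc y + nc z by exact: complex.le_normcD.
exists (AbsVal h1 h2 h3 h4) => r /=.
by rewrite /nc /complex.ComplexField.Normc.normc expr0n /= addr0 sqrtr_sqr.
Qed.

Lemma rat_absval_extension (R : realType) : exists (C : closedFieldType)
  (iC : {rmorphism rat -> C}) (V : absval R C), forall c, V (iC c) = rat_absval R c.
Proof.
have [V VE] := normc_absval R.
exists (complex.complex R), (complex.real_complex R \o ratr), V => c /=.
exact: VE.
Qed.

Lemma algebraic_extension_absval (R : realType) (k K : fieldType) (Kbar : closedFieldType)
    (ik : {rmorphism k -> K}) (j : {rmorphism K -> Kbar}) (w : absval R k) :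
  (forall x, algebraicOver ik x) -> algebraic_closure j -> ultrametric w ->
  exists (C : closedFieldType) (iC : {rmorphism k -> C}) (V : absval R C),
    (forall c, V (iC c) = w c) /\ (ultrametric w -> ultrametric V).
Proof.
move=> alg hj wu; have [W1 [W1u W1E]] := ultrametric_extension wu alg.
have [V [Vu VE]] := ultrametric_extension W1u hj.
by exists Kbar, (j \o ik), V; split=> // c /=; rewrite VE W1E.
Qed.

Lemma poly_preimage (k K : fieldType) (i : {rmorphism k -> K}) (p : {poly K}) :
  (forall l, range i p`_l) -> exists q, p = map_poly i q.
Proof.
move=> h; have /choice[c cE] : forall l, exists c, i c = p`_l.
  by move=> l; have [c _ cE] := h l; exists c.
exists (\poly_(l < size p) c l); apply/polyP => l.
rewrite coef_map coef_poly; case: ltnP => [_|pl]; first exact: esym (cE l).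
exact: etrans (nth_default _ pl) (esym (rmorph0 i)).
Qed.

Lemma is_subfield_add (K : fieldType) (S : set K) x y : is_subfield S -> S x -> S y -> S (x + y).
Proof.
move=> [S1 SB _] Sx Sy; have S0 : S 0 by rewrite -(subrr 1); exact: SB.
by rewrite -[y]opprK; apply: (SB) => //; rewrite -sub0r; exact: SB.
Qed.

Lemma is_subfield_mul (K : fieldType) (S : set K) x y : is_subfield S -> S x -> S y -> S (x * y).
Proof.
move=> [S1 SB SD] Sx Sy; rewrite -[y]invrK; apply: (SD) => //.
by rewrite -[y^-1]mul1r; exact: SD.
Qed.

(** * A family of absolute values on a number field or function field *)

Section GlobalFamily.
Variables (R : realType) (K : fieldType) (B : global_field K).

(** One place may sit at several indices, since several embeddings can induce it. The fourth clause
    bounds this repetition, so that infinitely many indices still mean infinitely many places. *)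
Definition global_places (M : eqType) (v : M -> absval R K) : Prop :=
  [/\ product_formula v,
      exists s : seq M, forall i, i \notin s -> ultrametric (v i),
      forall s : seq M, exists i, i \notin s,
      forall u : absval R K, exists s : seq M, forall i, absval_equiv u (v i) -> i \in s
    & forall i, absval_nontrivial (v i) /\
        forall c, constants B c -> c != 0 -> v i c = 1].

Lemma global_places_from (k : fieldType) (ik : {rmorphism k -> K}) (W : eqType)
    (w : W -> absval R k) (s : seq K) :
  [pchar k] =i pred0 -> arithmetic_family w (ik @^-1` constants B) ->
  constants B `<=` range ik ->
  (forall x, x \in s -> algebraicOver ik x) ->
  (forall S : set K, is_subfield S -> range ik `<=` S -> [set` s] `<=` S -> S = setT) ->
  ((forall x, algebraicOver ik x) ->
    forall o, exists (C : closedFieldType) (iC : {rmorphism k -> C}) (V : absval R C),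
      (forall c, V (iC c) = w o c) /\ (ultrametric (w o) -> ultrametric V)) ->
  (exists (M : eqType) (v : M -> absval R K), global_places v) /\
  forall c, finite_set [set p : place R B | is_prime p /\
    exists a, place_class p a /\ 1 < a c].
Proof.
move=> char0 wA BS sA gen wext.
have [theta thA thP] := primitive_element char0 sA.
have [P mP] := minimal_poly_ex thA.
have genT x : generated_by ik theta x.
  have -> // : generated_by ik theta = setT.
  apply: gen; [exact: generated_by_subfield mP|move=> _ [c _ <-]|exact: thP].
  by exists c%:P; rewrite map_polyC hornerC.
have alg := generated_algebraic mP genT.
have [w0 _] := af_infinite wA [::].
have [n [v [sP pv vw vU]]] := extend_product_formula char0 mP genT w0 (af_product wA)
  (af_ultrametric wA) (wext alg).
split; last first.
  (* The powers of [theta] below [size P], one more than a basis, span [K] over [k]. *)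
  apply: (finitely_many_poles wA (D := size P) (b := fun i => theta ^+ i)) => // x.
  have [p ->] := genT x; have [Pm /rootP Pth _] := mP; have P0 := monic_neq0 Pm.
  exists (fun i => (p %% P)`_i); rewrite {1}(divp_eq p P) rmorphD rmorphM /=.
  rewrite hornerD hornerM Pth mulr0 add0r.
  have sz : (size (map_poly ik (p %% P)) <= size P)%N.
    by rewrite size_map_poly ltnW // ltn_modp.
  by rewrite (horner_coef_wide _ sz); apply: eq_bigr => i _; rewrite coef_map.
exists (W * 'I_n.+1)%type, v; split=> //.
- have [s' s'U] := af_ultrametric wA; exists [seq (o, i) | o <- s', i <- enum 'I_n.+1].
  move=> [q i] qi; apply/vU/s'U; apply: contra qi => qs.
  by apply/allpairsP; exists (q, i); rewrite mem_enum.
- move=> s'; have [q qs] := af_infinite wA [seq p.1 | p <- s'].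
  by exists (q, ord0); apply: contra qs => qs; apply/mapP; exists (q, ord0).
- move=> u; have equivW p : absval_equiv u (v p) -> absval_equiv (absval_pullback ik u) (w p.1).
    by move=> [t t0 h]; exists t => // c /=; rewrite -vw h.
  have [[p up]|np] := pselect (exists p, absval_equiv u (v p)); last first.
    by exists [::] => i ui; case: np; exists i.
  exists [seq (p.1, i) | i <- enum 'I_n.+1] => -[q i] uq.
  have -> : q = p.1.
    apply: (af_inequivalent wA).
    exact: absval_equiv_trans (absval_equiv_sym (equivW _ uq)) (equivW _ up).
  by apply/mapP; exists i; rewrite ?mem_enum.
- move=> p; split.
    have [x x0 wx] := af_nontrivial wA p.1; exists (ik x); first by rewrite fmorph_eq0.
    by rewrite vw.
  move=> c Bc c0; have [d _ dE] := BS c Bc.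
  rewrite -dE vw; apply: (af_constants wA); first by rewrite /= dE.
  by apply: contraNneq c0 => d0; rewrite -dE d0 rmorph0.
Qed.

Lemma global_field_char0 : [pchar K] =i pred0.
Proof.
case: B => [[L [i _]]|kappa [//]].
move=> p; rewrite (fmorph_pchar (i \o in_alg L : {rmorphism rat -> K})).
exact: pchar_num.
Qed.

Theorem global_places_exist (Kbar : closedFieldType) (j : {rmorphism K -> Kbar}) :
  algebraic_closure j ->
  (exists (M : eqType) (v : M -> absval R K), global_places v) /\
  forall c, finite_set [set p : place R B | is_prime p /\
    exists a, place_class p a /\ 1 < a c].
Proof.
move=> hj; have charK := global_field_char0.
case BE : B => [nf|kappa ff].
  have [L [i ibij]] := nf.
  pose ik : {rmorphism rat -> K} := i \o in_alg L.
  have [I [w [wA wN wU]]] := rat_base R.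
  rewrite -BE; apply: (@global_places_from rat ik _ w [seq i b | b <- vbasis {:L}]).
  - exact: pchar_num.
  - by rewrite BE preimage_set0.
  - by rewrite BE.
  - move=> _ /mapP[y _ ->].
    have /polyOver1P[q qE] := minPolyOver 1 y.
    exists q; first by have := monic_neq0 (monic_minPoly 1 y); rewrite qE map_poly_eq0.
    rewrite -(_ : map_poly i (map_poly (in_alg L) q) = map_poly ik q); last by rewrite -map_poly_comp.
    by rewrite fmorph_root -qE root_minPoly.
  - move=> S Ssub rS bS; apply/seteqP; split=> // x _.
    have [i' _ i'K] := ibij; rewrite -(i'K x).
    rewrite (coord_vbasis (memvf (i' x))) rmorph_sum /=.
    elim/big_ind: _ => [|? ?|l _]; [by rewrite -(subrr 1); case: Ssub => S1 SB _; exact: SB|exact: is_subfield_add|].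
    rewrite -[_ *: _]mulr_algl rmorphM; apply: is_subfield_mul => //.
      by apply: rS; eexists.
    by apply: bS => /=; apply: map_f; rewrite mem_nth // size_tuple.
  - move=> alg [l|]; first exact: algebraic_extension_absval hj (wU l).
    rewrite wN; have [C [iC [V VE]]] := rat_absval_extension R.
    (* The usual absolute value of the rationals is not ultrametric, since an ultrametric one is at
       most 1 at 2. *)
    exists C, iC, V; split=> // h; exfalso.
    have := ultrametric_nat 2 h; rewrite -[2%:R]/((2%:Z)%:~R) rat_absval_int.
    by rewrite /= lerz1.
have [_ kappaP _ [s sE] [t tP tA]] := ff.
have [k [ik [I [w [ikE wA wU]]]]] := @function_field_base R K kappa t charK kappaP tP.
have kr : kappa `<=` range ik.
  by rewrite ikE => c kc; apply: (@sub_smallest _ _ _ (kappa `|` [set t])) => //; left.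
rewrite -BE; apply: (@global_places_from k ik _ w s).
- by move=> p; rewrite -(fmorph_pchar ik) charK.
- by rewrite BE.
- by rewrite BE.
- move=> x _; have [p [p0 pk px]] := tA x.
  have [q qE] : exists q, p = map_poly ik q by apply: poly_preimage; rewrite ikE.
  by exists q; rewrite -?qE //; apply: contraNneq p0 => q0; rewrite qE q0 rmorph0.
- move=> S Ssub rS sS; apply/seteqP; split=> // x _.
  have : subfield_gen (kappa `|` [set` s]) x by rewrite sE.
  apply: smallest_sub => // y [/kr/rS//|]; exact: sS.
- by move=> alg o; exact: algebraic_extension_absval hj (wU o).
Qed.

End GlobalFamily.

(** * Orbits at a single absolute value *)

Section LocalDynamics.
Variables (R : realType) (K L : fieldType) (e : {rmorphism K -> L}) (a : absval R L).
Hypothesis au : ultrametric a.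

Definition integral_at (p : {poly K}) : Prop := forall i, a (e p`_i) <= 1.

Definition orbit_seq (f : {poly K}) (alpha : K) (m : nat) : K :=
  iter m (fun y => f.[y]) alpha.

Lemma integral_at_map p : integral_at p -> forall i, a (map_poly e p)`_i <= 1.
Proof. by move=> h i; rewrite coef_map; exact: h. Qed.

Lemma integral_at_horner p (y : L) : integral_at p -> a y <= 1 -> a (map_poly e p).[y] <= 1.
Proof. by move=> /integral_at_map h y1; exact: ultrametric_horner. Qed.

Lemma integral_at_eval p (y : K) : integral_at p -> a (e y) <= 1 -> a (e p.[y]) <= 1.
Proof. by move=> h y1; rewrite -horner_map; exact: integral_at_horner. Qed.

(** Differences of powers factor through [y - z], with an integral cofactor when both points are
    integral. *)
Lemma integral_at_contraction p (y z : L) : integral_at p -> a y <= 1 -> a z <= 1 ->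
  a ((map_poly e p).[y] - (map_poly e p).[z]) <= a (y - z).
Proof.
move=> ip y1 z1; rewrite !horner_coef -sumrB; apply: ultrametric_sum => // [|i _].
  exact: absval_ge0.
rewrite -mulrBr subrXX absvalM; apply: le_trans (ler_piMl (absval_ge0 _ _) _) _.
  exact: integral_at_map.
rewrite absvalM ler_piMr ?absval_ge0 //; apply: ultrametric_sum => // l _.
by rewrite absvalM !absvalX mulr_ile1 ?exprn_ge0 ?absval_ge0 // exprn_ile1 ?absval_ge0.
Qed.

Variables (f : {poly K}) (alpha : K).
Hypotheses (fi : integral_at f) (alphai : a (e alpha) <= 1).
Local Notation x := (orbit_seq f alpha).

Lemma orbit_integral m : a (e (x m)) <= 1.
Proof. by elim: m => [//|m IHm]; rewrite /orbit_seq iterS; exact: integral_at_eval. Qed.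

Lemma near_integral m (b : L) (eps : R) : a (e (x m) - b) < eps -> eps <= 1 -> a b <= 1.
Proof.
move=> xb e1; rewrite -[b]opprK -(addKr (e (x m)) (- b)) opprD opprK.
by apply: ultrametric_sub => //; [exact: orbit_integral|exact/ltW/(lt_le_trans xb)].
Qed.

Section Invariant.
Variables (h q u w : {poly K}).
Hypotheses (hf : h \Po f = h * q) (uw : u * h + w * q = 1).
Hypotheses (hi : integral_at h) (qi : integral_at q) (ui : integral_at u) (wi : integral_at w).

Lemma invariant_next m : h.[x m.+1] = h.[x m] * q.[x m].
Proof. by rewrite /orbit_seq iterS -horner_comp hf hornerM. Qed.

(* The cofactor q is a unit near the zeros of h, so f preserves the size of h there. *)
Lemma invariant_isometry m : a (e h.[x m]) < 1 -> a (e h.[x m.+1]) = a (e h.[x m]).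
Proof.
move=> hm; rewrite invariant_next rmorphM absvalM.
have xi := orbit_integral m.
have q1 : a (e q.[x m]) <= 1 by exact: integral_at_eval.
suff -> : a (e q.[x m]) = 1 by rewrite mulr1.
apply/eqP; rewrite eq_le q1 /=.
have := congr1 (fun p : {poly K} => a (e p.[x m])) uw.
rewrite hornerD !hornerM hornerE rmorph1 absval1 rmorphD !rmorphM => E1.
have := au (e u.[x m] * e h.[x m]) (e w.[x m] * e q.[x m]).
rewrite E1 !absvalM le_max => /orP[E2|E2].
  have : a (e u.[x m]) * a (e h.[x m]) < 1.
    by apply: le_lt_trans hm; rewrite ler_piMl ?absval_ge0 // integral_at_eval.
  by rewrite ltNge E2.
by apply: le_trans E2 _; rewrite ler_piMl ?absval_ge0 // integral_at_eval.
Qed.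

Lemma invariant_constant m n : (m <= n)%N -> a (e h.[x m]) < 1 -> a (e h.[x n]) = a (e h.[x m]).
Proof.
move=> /subnK <-; elim: (n - m)%N => [//|l IHl] hm.
by rewrite addSn invariant_isometry ?IHl.
Qed.

Hypothesis hx : forall m, h.[x m] != 0.

Lemma invariant_lower_bound : exists2 delta, 0 < delta &
  exists M, forall m, (M <= m)%N -> delta <= a (e h.[x m]).
Proof.
have [[m hm]|nm] := pselect (exists m, a (e h.[x m]) < 1).
  exists (a (e h.[x m])); first by rewrite absval_gt0 fmorph_eq0.
  by exists m => n mn; rewrite (invariant_constant mn hm).
exists 1 => //; exists 0%N => m _; rewrite leNgt; apply/negP => hm; by apply: nm; exists m.
Qed.

(** From [m0] on, [h] has constant size along the orbit. Coming closer than this size to a zero of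
    [h] would make [h] smaller still; coming that close to a zero of [g1] would make [h] small at
    that zero, against the Bezout relation. *)
Lemma no_accumulation_at_divisor (g1 u1 w1 : {poly K}) m0 : u1 * h + w1 * g1 = 1 ->
  integral_at u1 -> a (e h.[x m0]) < 1 ->
  forall b, root (map_poly e h) b \/ root (map_poly e g1) b ->
  exists2 eps, 0 < eps & exists M, forall m, (M <= m)%N -> eps <= a (e (x m) - b).
Proof.
move=> uw1 u1i hm0 b hb.
have d0 : 0 < a (e h.[x m0]) by rewrite absval_gt0 fmorph_eq0.
exists (a (e h.[x m0])) => //; exists m0 => m mm; rewrite leNgt; apply/negP => xb.
have hm := invariant_constant mm hm0.
have b1 : a b <= 1 by apply: (near_integral xb (ltW hm0)).
have dist : a (e h.[x m] - (map_poly e h).[b]) < a (e h.[x m0]).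
  rewrite -horner_map; apply: le_lt_trans xb.
  by apply: integral_at_contraction => //; exact: orbit_integral.
case: hb => [/rootP hb|/rootP gb]; first by move: dist; rewrite hb subr0 hm ltxx.
have hb1 : a (map_poly e h).[b] < 1.
  apply: le_lt_trans hm0.
  have -> : (map_poly e h).[b] = e h.[x m] - (e h.[x m] - (map_poly e h).[b]).
    by rewrite opprB addrC subrK.
  by apply: ultrametric_sub => //; [rewrite hm|exact: ltW].
have := congr1 (fun p : {poly K} => a (map_poly e p).[b]) uw1.
rewrite rmorphD !rmorphM rmorph1 !hornerE gb mulr0 addr0 absvalM absval1 => E1.
have : a (map_poly e u1).[b] * a (map_poly e h).[b] < 1.
  by apply: le_lt_trans hb1; rewrite ler_piMl ?absval_ge0 // integral_at_horner.
by rewrite E1 ltxx.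
Qed.

(** In use [c] is an iterate of [f]. It carries an orbit point near [b] to an orbit point, not
    earlier, near a zero of [h], where the lower bound on [h] applies. *)
Lemma no_accumulation_at_preimage c (b : L) : integral_at c ->
  root (map_poly e (h \Po c)) b ->
  (forall m, exists m', c.[x m] = x m' /\ (m <= m')%N) ->
  exists2 eps, 0 < eps & exists M, forall m, (M <= m)%N -> eps <= a (e (x m) - b).
Proof.
move=> ci /rootP hcb cx; have [delta d0 [M hM]] := invariant_lower_bound.
exists (Num.min delta 1); first by rewrite lt_min d0 ltr01.
exists M => m Mm; rewrite leNgt; apply/negP => xb.
have b1 : a b <= 1 by apply: (near_integral xb); rewrite ge_min lexx orbT.
have [m' [cE mm']] := cx m; have := hM m' (leq_trans Mm mm').
rewrite leNgt => /negP; apply; rewrite -cE.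
have xi := orbit_integral m.
have -> : e h.[c.[x m]] = (map_poly e h).[e c.[x m]] - (map_poly e h).[(map_poly e c).[b]].
  move: hcb; rewrite map_comp_poly horner_comp => ->.
  by rewrite subr0 horner_map.
apply: le_lt_trans (integral_at_contraction _ _ _) _ => //.
- exact: integral_at_eval.
- exact: integral_at_horner.
rewrite -horner_map; apply: le_lt_trans (integral_at_contraction _ _ _) _ => //.
by apply: lt_le_trans xb _; rewrite ge_min lexx.
Qed.

End Invariant.

End LocalDynamics.

(** * Growth along the orbit *)

Section Pigeonhole.
Variables (R : realType) (M : eqType).

Lemma uniform_constant (s : seq M) (Q : M -> R -> Prop) :
  (forall i C C', C <= C' -> Q i C -> Q i C') ->
  (forall i, i \in s -> exists C, Q i C) ->
  exists2 C, 0 <= C & forall i, i \in s -> Q i C.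
Proof.
move=> mono; elim: s => [_|i s IHs h]; first by exists 0.
have [|C C0 hC] := IHs; first by move=> l ls; apply: h; rewrite inE ls orbT.
have [C' hC'] := h i (mem_head _ _); exists (Num.max C C'); first by rewrite le_max C0.
move=> l; rewrite inE => /orP[/eqP->|/hC].
  by apply: mono hC'; rewrite le_max lexx orbT.
by apply: mono; rewrite le_max lexx.
Qed.

Lemma exp_unbounded (d : nat) (B c : R) : (1 < d)%N -> 0 < c ->
  exists m0 : nat, forall m, (m0 <= m)%N -> B < c * d%:R ^+ m.
Proof.
move=> d1 c0; exists (Num.bound (B / c)) => m mm.
rewrite mulrC -ltr_pdivrMr //.
have [h|h] := ltP (B / c) 0; first by apply: lt_le_trans h _; rewrite exprn_ge0.
apply: lt_trans (archi_boundP h) _; rewrite -natrX ltr_nat.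
by apply: leq_ltn_trans mm _; exact: ltn_expl.
Qed.

(* The sum being 0, some a i is very negative at each late time m; by the upper and the nearness
   bounds it has crossed -A less than k steps earlier, and it stays below -A for a long time
   afterwards.  So the indices found at the times m, m + k, ..., m + n k are distinct. *)
Lemma growth_pigeonhole (s : seq M) (a : M -> nat -> R) (d : nat) (i0 : M) (H : R) (m0 : nat) :
  uniq s -> (1 < d)%N ->
  (forall m, \sum_(i <- s) a i m = 0) ->
  (forall i, i \in s -> exists C, forall m, a i m <= C * d%:R ^+ m) ->
  (forall i, i \in s -> exists A, forall m, a i m <= - A -> `|a i m.+1 - a i m| <= A) ->
  i0 \in s -> 0 < H -> (forall m, (m0 <= m)%N -> H * d%:R ^+ m <= a i0 m) -> False.
Proof.
move=> us d1 sum0 up near i0s H0 big0.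
have dpos m : 0 < d%:R ^+ m :> R by rewrite exprn_gt0 // ltr0n ltnW.
have [C C0 hC] : exists2 C, 0 <= C & forall i, i \in s -> forall m, a i m <= C * d%:R ^+ m.
  apply: uniform_constant => // i C C' CC' h m; apply: le_trans (h m) _.
  by rewrite ler_pM2r.
have [A A0 hA] : exists2 A, 0 <= A & forall i, i \in s -> forall m, a i m <= - A ->
    `|a i m.+1 - a i m| <= A.
  apply: uniform_constant => // i A A' AA' h m am; apply: le_trans (h m _) _ => //.
  by apply: le_trans am _; rewrite lerN2.
set n := size s.
have n0 : (0 < n)%N by rewrite /n; case: (s) i0s.
have N0 : 0 < n%:R :> R by rewrite ltr0n.
have low i m : i \in s -> - a i m <= n%:R * C * d%:R ^+ m.
  move=> is_; have := sum0 m; rewrite (bigD1_seq i) //= => /eqP.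
  rewrite addr_eq0 => /eqP/(congr1 -%R); rewrite opprK => ->.
  apply: le_trans (_ : \sum_(l <- s) C * d%:R ^+ m <= _); last first.
    by rewrite big_const_seq count_predT iter_addr_0 -[_ *+ size s]mulr_natl mulrA.
  rewrite [leRHS](bigD1_seq i) //=; apply: ler_wpDl; first by rewrite mulr_ge0 // ltW.
  by rewrite big_seq_cond [leRHS]big_seq_cond ler_sum // => l /andP[ls _]; exact: hC.
(* With all terms above [- H' * d^m], the other n - 1 terms could not cancel the term at [i0]. *)
pose H' := H / n%:R; have H'0 : 0 < H' by rewrite divr_gt0.
pose big i m := H' * d%:R ^+ m <= - a i m.
have bigex m : (m0 <= m)%N -> exists2 i, i \in s & big i m.
  move=> mm; apply: contrapT => nb.
  have nb' i : i \in s -> - (H' * d%:R ^+ m) <= a i m.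
    move=> is_; rewrite lerNl; apply/ltW; rewrite ltNge; apply/negP => bi.
    by apply: nb; exists i.
  have := sum0 m; apply/eqP; rewrite gt_eqF // (bigD1_seq i0) //=.
  have le1 : - (n.-1%:R * (H' * d%:R ^+ m)) <= \sum_(i <- s | i != i0) a i m.
    apply: le_trans (_ : \sum_(i <- s | i != i0) - (H' * d%:R ^+ m) <= _); last first.
      by rewrite big_seq_cond [leRHS]big_seq_cond ler_sum // => l /andP[ls _]; exact: nb'.
    rewrite big_const_seq iter_addr_0 -[_ *+ count _ _]mulr_natl.
    have -> : count (fun i => i != i0) s = n.-1.
      by rewrite /n -(count_predC (pred1 i0) s) count_uniq_mem // i0s.
    by rewrite mulrN.
  apply: lt_le_trans (lerD (big0 m mm) le1).
  have -> : H * d%:R ^+ m - n.-1%:R * (H' * d%:R ^+ m) = H' * d%:R ^+ m.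
    have nE : n%:R = n.-1%:R + 1 :> R by rewrite natr1 prednK.
    have HE : H = H' * n%:R by rewrite divfK // gt_eqF.
    by rewrite HE nE; ring.
  by rewrite mulr_gt0.
have H'2 : 0 < H' / 2 by rewrite divr_gt0.
(* [k] steps earlier, the bound [low] is below half of the depth required at time [m]; the remaining
   half is left for the bounded steps. *)
have [k kP] := exp_unbounded (n%:R * C) d1 H'2.
have {}kP := kP k (leqnn k).
(* Beyond [m1], half of the depth also exceeds the total change possible during n + 1 windows of [k]
   steps of size [A]. *)
have [m1 m1P] := exp_unbounded (n.+1%:R * k%:R * A + A) d1 H'2.
pose M0 := (m0 + m1 + k)%N.
have kA m : (m1 <= m)%N -> n.+1%:R * k%:R * A + A < H' / 2 * d%:R ^+ m by exact: m1P.
have k1A : k%:R * A <= n.+1%:R * k%:R * A.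
  by rewrite -[leLHS]mul1r -mulrA ler_wpM2r ?mulr_ge0 // ler1n.
have enter i m : i \in s -> (M0 <= m)%N -> big i m ->
    exists2 t, (t < k)%N & - A < a i (m - k + t)%N.
  move=> is_ mM bi; apply: contrapT => ne.
  have near' t : (t < k)%N -> a i (m - k + t)%N <= - A.
    by move=> tk; rewrite leNgt; apply/negP => h; apply: ne; exists t.
  have step t : (t <= k)%N -> - a i (m - k + t)%N <= - a i (m - k)%N + t%:R * A.
    elim: t => [_|t IHt tk]; first by rewrite addn0 mul0r addr0.
    have := hA i is_ _ (near' t tk); rewrite -addnS => /ler_normlP[h _].
    have := IHt (ltnW tk); rewrite -natr1 mulrDl mul1r; move: h; lra.
  have km : (k <= m)%N by apply: leq_trans mM; rewrite /M0 leq_addl.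
  have := step k (leqnn k); rewrite subnK // => h1.
  have h2 := low i (m - k)%N is_.
  have h3 : n%:R * C * d%:R ^+ (m - k) < H' / 2 * d%:R ^+ m.
    have -> : d%:R ^+ m = d%:R ^+ k * d%:R ^+ (m - k) :> R by rewrite -exprD subnKC.
    by rewrite mulrA ltr_pM2r.
  have h4 := kA m (leq_trans (leq_trans (leq_addl m0 m1) (leq_addr k _)) mM).
  move: bi; rewrite /big => bi; move: h1 h2 h3 h4 bi k1A A0; lra.
have stay i m : i \in s -> (M0 <= m)%N -> big i m ->
    forall t, (t <= n.+1 * k)%N -> a i (m + t)%N <= - A.
  move=> is_ mM bi t tk.
  have h4 := kA m (leq_trans (leq_trans (leq_addl m0 m1) (leq_addr k _)) mM).
  have bd l : (l <= n.+1 * k)%N -> l%:R * A <= n.+1%:R * k%:R * A.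
    by move=> lk; rewrite ler_wpM2r // -natrM ler_nat.
  have [h _] : - (a i (m + t)%N) >= H' * d%:R ^+ m - t%:R * A /\ a i (m + t)%N <= - A.
    elim: t tk => [_|t IHt tk].
      rewrite addn0 mul0r subr0; split=> //; move: bi; rewrite /big => bi.
      have := bd 0%N (leq0n _); rewrite mul0r; have := dpos m; move: bi h4; nra.
    have [h1 h2] := IHt (ltnW tk).
    have := hA i is_ _ h2; rewrite -addnS => /ler_normlP[_ h].
    have bt := bd _ tk; have h5 : - a i (m + t.+1)%N >= H' * d%:R ^+ m - t.+1%:R * A.
      by rewrite -natr1 mulrDl mul1r; move: h h1; lra.
    by split=> //; have := mulr_gt0 H'0 (dpos m); move: bt h5 h4; lra.
  have bt := bd _ tk; have := mulr_gt0 H'0 (dpos m); move: bt h h4; lra.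
have pickr r : exists2 i, i \in s & big i (M0 + r * k)%N.
  by apply: bigex; rewrite /M0 -!addnA leq_addr.
pose I r := projT1 (cid2 (pickr r)).
have Is r : I r \in s by rewrite /I; case: cid2.
have Ib r : big (I r) (M0 + r * k)%N by rewrite /I; case: cid2.
have disj r r' : (r < r')%N -> (r' <= n)%N -> I r <> I r'.
  move=> rr' r'n II.
  have [t tk ht] := enter _ _ (Is r') (leq_addr _ _) (Ib r').
  have rk : (r.+1 * k <= r' * k)%N by rewrite leq_mul2r rr' orbT.
  (* The time at which the term for [r'] is still above [- A], rewritten as a time within the long
     stay below [- A] that starts at [M0 + r * k]. *)
  have := stay _ _ (Is r) (leq_addr _ _) (Ib r) (r' * k - k - r * k + t)%N.
  rewrite II => h; move: ht; rewrite ltNge; apply/negP; rewrite negbK.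
  have E : (M0 + r * k + (r' * k - k - r * k + t) = M0 + r' * k - k + t)%N.
    by move: rk; rewrite mulSn; move: (M0) (r * k)%N (r' * k)%N; clear; lia.
  rewrite -E; apply: h; move: rk; rewrite mulSn => rk.
  have : (r' * k <= n * k)%N by rewrite leq_mul2r r'n orbT.
  by rewrite mulSn; move: (r * k)%N (r' * k)%N (n * k)%N rk; clear -tk; lia.
have : uniq [seq I r | r <- iota 0 n.+1].
  rewrite map_inj_in_uniq ?iota_uniq // => r r'; rewrite !mem_iota !add0n !ltnS /= => rn r'n II.
  by case: (ltngtP r r') => // h; [case: (disj r r')|case: (disj r' r)].
move=> uI; have sub : {subset [seq I r | r <- iota 0 n.+1] <= s} by move=> _ /mapP[r _ ->].
by have := uniq_leq_size uI sub; rewrite size_map size_iota ltnn.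
Qed.

End Pigeonhole.

(** * Estimates along an orbit at an arbitrary absolute value *)

Section PolynomialEstimates.
Variables (R : realType) (K : fieldType) (v : absval R K).

Lemma absval_sum (I : Type) (r : seq I) (P : pred I) (F : I -> K) :
  v (\sum_(i <- r | P i) F i) <= \sum_(i <- r | P i) v (F i).
Proof.
elim/big_rec2: _ => [|i a b _ h]; first by rewrite absval0.
by apply: le_trans (absvalD _ _ _) _; rewrite lerD2l.
Qed.

Lemma absvalB_ge x y : v x - v y <= v (x - y).
Proof. by have := absvalD v (x - y) y; rewrite subrK; lra. Qed.

Lemma horner_upper (p : {poly K}) : exists2 C, 1 <= C &
  forall y, v p.[y] <= C * Num.max 1 (v y) ^+ (size p).-1.
Proof.
exists (1 + \sum_(i < size p) v p`_i).
  by rewrite lerDl sumr_ge0 // => i _; exact: absval_ge0.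
move=> y; rewrite horner_coef; apply: le_trans (absval_sum _ _ _) _.
have m1 : 1 <= Num.max 1 (v y) by rewrite le_max lexx.
rewrite mulrDl mul1r; apply: ler_wpDl; first by rewrite exprn_ge0 // (le_trans ler01).
rewrite mulr_suml; apply: ler_sum => i _.
rewrite absvalM absvalX ler_wpM2l ?absval_ge0 //.
apply: (@le_trans _ _ (Num.max 1 (v y) ^+ i)).
  by rewrite lerXn2r ?nnegrE ?absval_ge0 ?(le_trans ler01) // le_max lexx orbT.
by rewrite ler_weXn2l // -ltnS prednK // (leq_ltn_trans (leq0n i)).
Qed.

Lemma horner_lower (p : {poly K}) : (1 < size p)%N -> exists c rho, [/\ 0 < c, 1 <= rho &
  forall y, rho <= v y -> c * v y ^+ (size p).-1 <= v p.[y]].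
Proof.
move=> sp; have [n nE] : exists n, size p = n.+2.
  by move: sp; case: (size p) => [|[|n]] // _; exists n.
have lp : 0 < v p`_n.+1.
  by rewrite absval_gt0; have := lead_coef_eq0 p; rewrite lead_coefE nE /= => ->; rewrite -size_poly_gt0 nE.
set l := v p`_n.+1 in lp *; pose C := \sum_(i < n.+1) v p`_i.
have C0 : 0 <= C by rewrite sumr_ge0 // => i _; exact: absval_ge0.
exists (l / 2), (Num.max 1 (2 * C / l)); split.
- by rewrite divr_gt0.
- by rewrite le_max lexx.
move=> y; rewrite ge_max => /andP[y1 yC]; rewrite nE horner_coef nE big_ord_recr /=.
have rest : v (\sum_(i < n.+1) p`_i * y ^+ i) <= C * v y ^+ n.
  apply: le_trans (absval_sum _ _ _) _; rewrite mulr_suml; apply: ler_sum => i _.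
  rewrite absvalM absvalX ler_wpM2l ?absval_ge0 // ler_weXn2l // -ltnS; exact: ltn_ord.
have := absvalB_ge (p`_n.+1 * y ^+ n.+1) (- \sum_(i < n.+1) p`_i * y ^+ i).
rewrite opprK absvalN absvalM absvalX -/l addrC => /(le_trans _); rewrite addrC; apply.
have yn : 0 <= v y ^+ n by rewrite exprn_ge0 ?absval_ge0.
have CE : C <= l / 2 * v y.
  by move: yC; rewrite ler_pdivrMr // => h; move: h; lra.
have : C * v y ^+ n <= l / 2 * v y * v y ^+ n by rewrite ler_wpM2r.
by move: rest; rewrite exprS; lra.
Qed.

Section Orbit.
Variables (f : {poly K}) (alpha : K) (d : nat).
Hypotheses (fd : (size f).-1 = d) (d2 : (2 <= d)%N).
Local Notation x := (orbit_seq f alpha).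

Let dR2 : 2 <= d%:R :> R. Proof. by rewrite ler_nat. Qed.
Let d0 m : 0 < d%:R ^+ m :> R. Proof. by rewrite exprn_gt0 // (lt_le_trans _ dR2). Qed.
Let d1 m : 1 <= d%:R ^+ m :> R. Proof. by rewrite exprn_ege1 // (le_trans _ dR2) // ler1n. Qed.

Lemma orbit_height_upper : exists2 C, 0 <= C &
  forall m, ln (Num.max 1 (v (x m))) <= C * d%:R ^+ m.
Proof.
have [C C1 hC] := horner_upper f; rewrite fd in hC.
pose mu m := ln (Num.max 1 (v (x m))).
have m1 m : 1 <= Num.max 1 (v (x m)) by rewrite le_max lexx.
have m0 m : 0 < Num.max 1 (v (x m)) by exact: lt_le_trans (m1 m).
have g0 : 0 <= ln C by rewrite ln_ge0.
have mu0 m : 0 <= mu m by rewrite ln_ge0.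
have step m : mu m.+1 <= d%:R * mu m + ln C.
  rewrite /mu addrC mulr_natl -lnXn // -lnM ?posrE ?exprn_gt0 //; last exact: lt_le_trans C1.
  rewrite ler_ln ?posrE ?mulr_gt0 ?exprn_gt0 //; last exact: lt_le_trans C1.
  rewrite ge_max /orbit_seq iterS hC andbT -[leLHS]mul1r ler_pM //.
  by apply: exprn_ege1; exact: m1.
exists (mu 0%N + ln C); first by rewrite addr_ge0.
(* Adding [ln C] absorbs the additive error: [mu m + ln C] grows by a factor at most [d] at each
   step because [d] is at least 2. *)
move=> m; rewrite -/(mu m); suff : mu m + ln C <= (mu 0%N + ln C) * d%:R ^+ m by move: g0; lra.
elim: m => [|m IHm]; first by rewrite expr0 mulr1.
apply: le_trans (_ : d%:R * (mu m + ln C) <= _).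
  by have := step m; move: g0 dR2; nra.
by rewrite exprS mulrCA ler_pM2l // (lt_le_trans _ dR2).
Qed.

Lemma orbit_poly_upper (h : {poly K}) : (forall m, h.[x m] != 0) ->
  exists C, forall m, ln (v h.[x m]) <= C * d%:R ^+ m.
Proof.
move=> hx; have [C C1 hC] := horner_upper h; have [D D0 hD] := orbit_height_upper.
exists (ln C + (size h).-1%:R * D) => m.
have m0 : 0 < Num.max 1 (v (x m)) by rewrite lt_max ltr01.
have C0 : 0 < C by exact: lt_le_trans C1.
have g0 : 0 <= ln C by rewrite ln_ge0.
apply: le_trans (_ : ln (C * Num.max 1 (v (x m)) ^+ (size h).-1) <= _).
  by rewrite ler_ln ?posrE ?absval_gt0 ?mulr_gt0 ?exprn_gt0.
rewrite lnM ?posrE ?exprn_gt0 // lnXn // -[_ *+ (size h).-1]mulr_natl mulrDl; apply: lerD.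
  by rewrite ler_peMr.
by rewrite -mulrA ler_wpM2l.
Qed.

(** Valid also at archimedean places, where the exact isometry fails: when [h] is small the point is
    bounded, so [q] is bounded above, and the Bezout relation bounds it away from 0. *)
Lemma orbit_poly_near (h q u w : {poly K}) : (1 < size h)%N -> h \Po f = h * q ->
  u * h + w * q = 1 -> (forall m, h.[x m] != 0) ->
  exists A, forall m, ln (v h.[x m]) <= - A -> `|ln (v h.[x m.+1]) - ln (v h.[x m])| <= A.
Proof.
move=> sh hf uw hx.
have [c [rho [c0 rho1 low]]] := horner_lower sh.
pose r := Num.max rho c^-1.
have r1 : 1 <= r by rewrite le_max rho1.
have bounded y : v h.[y] < 1 -> v y <= r.
  move=> h1; rewrite leNgt; apply/negP; rewrite gt_max => /andP[yr yc].
  have y1 : 1 <= v y by exact: le_trans rho1 (ltW yr).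
  have := low y (ltW yr); apply/negP; rewrite -ltNge; apply: lt_le_trans h1 _.
  apply: (@le_trans _ _ (c * v y)); last first.
    by rewrite ler_pM2l // -[leLHS]expr1 ler_weXn2l // -ltnS prednK // ltnW.
  by rewrite -ler_pdivrMl // mulr1 ltW.
have bd (p : {poly K}) : exists2 C, 1 <= C & forall y, v y <= r -> v p.[y] <= C.
  have [C C1 hC] := horner_upper p; exists (C * r ^+ (size p).-1).
    by rewrite -[leLHS]mulr1 ler_pM // exprn_ege1.
  move=> y yr; apply: le_trans (hC y) _; rewrite ler_pM2l; last exact: lt_le_trans C1.
  apply: lerXn2r; rewrite ?nnegrE ?(le_trans ler01 r1) ?ge_max ?r1 //.
  by rewrite le_max ler01.
have [Cq Cq1 hq] := bd q; have [Cu Cu1 hu] := bd u; have [Cw Cw1 hw] := bd w.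
have lCq : 0 <= ln Cq by rewrite ln_ge0.
have Cu2 : 1 < 2 * Cu by move: Cu1; lra.
have Cw2 : 1 < 2 * Cw by move: Cw1; lra.
have pu : 0 < 2 * Cu by exact: lt_trans Cu2.
have pw : 0 < 2 * Cw by exact: lt_trans Cw2.
have puV : 0 < (2 * Cu)^-1 by rewrite invr_gt0.
have pwV : 0 < (2 * Cw)^-1 by rewrite invr_gt0.
have lCu : 0 < ln (2 * Cu) by rewrite ln_gt0.
have lCw : 0 < ln (2 * Cw) by rewrite ln_gt0.
(* The threshold makes [h] at most 1 / (2 Cu), so that [u * h] takes up at most half of the Bezout
   relation and [w * q] the rest. *)
exists (ln Cq + ln (2 * Cu) + ln (2 * Cw)) => m hm.
have hpos : 0 < v h.[x m] by rewrite absval_gt0.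
have hsmall : v h.[x m] <= (2 * Cu)^-1.
  rewrite -ler_ln ?posrE // lnV ?posrE //.
  by move: hm lCq lCw; lra.
have xr : v (x m) <= r.
  by apply: bounded; apply: le_lt_trans hsmall _; rewrite invf_lt1 // (lt_trans ltr01).
have hE : h.[x m.+1] = h.[x m] * q.[x m] by rewrite /orbit_seq iterS -horner_comp hf hornerM.
have qx : q.[x m] != 0 by apply: contraNneq (hx m.+1) => q0; rewrite hE q0 mulr0.
have qpos : 0 < v q.[x m] by rewrite absval_gt0.
have -> : ln (v h.[x m.+1]) - ln (v h.[x m]) = ln (v q.[x m]).
  by rewrite hE absvalM lnM ?posrE // addrC addKr.
have qup : ln (v q.[x m]) <= ln Cq.
  by rewrite ler_ln ?posrE ?hq // (lt_le_trans _ Cq1).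
have qlow : - ln (2 * Cw) <= ln (v q.[x m]).
  rewrite -lnV ?posrE // ler_ln ?posrE // -div1r ler_pdivrMr //.
  have := congr1 (fun p : {poly K} => v p.[x m]) uw.
  rewrite hornerD !hornerM hornerE absval1 => E1.
  have := absvalD v (u.[x m] * h.[x m]) (w.[x m] * q.[x m]); rewrite E1 !absvalM => E2.
  have e1 : v u.[x m] * v h.[x m] <= 2^-1.
    apply: le_trans (ler_pM (absval_ge0 _ _) (absval_ge0 _ _) (hu _ xr) hsmall) _.
    by rewrite invfM mulrCA mulfV ?mulr1 // gt_eqF // (lt_le_trans _ Cu1).
  have e2 : v w.[x m] * v q.[x m] <= Cw * v q.[x m] by rewrite ler_pM2r // hw.
  by move: E2 e1 e2; lra.
by rewrite ler_norml; apply/andP; split; move: qup qlow lCq lCu lCw; lra.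
Qed.

Lemma orbit_poly_growth (h : {poly K}) : (1 < size h)%N ->
  ~ (exists C, forall m, v (x m) <= C) ->
  exists2 H, 0 < H & exists m0, forall m, (m0 <= m)%N -> H * d%:R ^+ m <= ln (v h.[x m]).
Proof.
move=> sh unb.
have sf : (1 < size f)%N by move: d2; rewrite -fd; case: (size f) => [|[]].
have [c [rho [c0 rho1 low]]] := horner_lower sf; rewrite fd in low.
have [ch [rhoh [ch0 rhoh1 lowh]]] := horner_lower sh.
pose g := Num.max 0 (- ln c); pose gh := Num.max 0 (- ln ch).
have g0 : 0 <= g by rewrite le_max lexx.
have gh0 : 0 <= gh by rewrite le_max lexx.
have gc : - g <= ln c by rewrite lerNl le_max lexx orbT.
have ghc : - gh <= ln ch by rewrite lerNl le_max lexx orbT.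
(* Starting height for the induction [key]. The term [g] absorbs [ln c] at each step, [gh] absorbs
   [ln ch] at the end, and the logarithms of [rho] and [rhoh] keep the orbit where the lower bounds
   hold. *)
pose T := g + gh + 1 + ln rho + ln rhoh.
have lr : 0 <= ln rho by rewrite ln_ge0.
have lrh : 0 <= ln rhoh by rewrite ln_ge0.
have [m0 hm0] : exists m0, expR T < v (x m0).
  apply: contrapT => n; apply: unb; exists (expR T) => m; rewrite leNgt.
  by apply/negP => h'; apply: n; exists m.
have T0 : T <= ln (v (x m0)).
  by rewrite -[T]expRK ler_ln ?posrE ?expR_gt0 // ?ltW // (lt_trans _ hm0) ?expR_gt0.
have rho0 : 0 < rho by exact: lt_le_trans rho1.
have rhoh0 : 0 < rhoh by exact: lt_le_trans rhoh1.
have key t : 0 < v (x (m0 + t)%N) /\ g + (gh + 1 + ln rho + ln rhoh) * d%:R ^+ t <= ln (v (x (m0 + t)%N)).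
  elim: t => [|t [IH0 IHt]].
    rewrite addn0 expr0 mulr1; split; last by move: T0; rewrite /T; lra.
    by apply: lt_trans hm0; exact: expR_gt0.
  have big : rho <= v (x (m0 + t)%N).
    rewrite -ler_ln ?posrE //; apply: le_trans IHt.
    have := d1 t; move: g0 gh0 lr lrh; nra.
  have := low _ big; rewrite addnS /orbit_seq iterS -/(x (m0 + t)%N) => lo.
  have pos : 0 < c * v (x (m0 + t)%N) ^+ d by rewrite mulr_gt0 // exprn_gt0.
  split; first exact: lt_le_trans lo.
  apply: le_trans (_ : ln (c * v (x (m0 + t)%N) ^+ d) <= _); last first.
    by rewrite ler_ln ?posrE // (lt_le_trans pos).
  rewrite lnM ?posrE ?exprn_gt0 // lnXn // -[ln _ *+ d]mulr_natl exprS.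
  have : d%:R * (g + (gh + 1 + ln rho + ln rhoh) * d%:R ^+ t) <= d%:R * ln (v (x (m0 + t)%N)).
    by rewrite ler_pM2l // (lt_le_trans _ dR2).
  have : 2 * g <= d%:R * g by rewrite ler_wpM2r.
  by move: gc; lra.
exists (d%:R ^- m0); first by rewrite invr_gt0.
exists m0 => m mm; have [t tE] : exists t, m = (m0 + t)%N by exists (m - m0)%N; rewrite subnKC.
rewrite tE exprD mulKf ?gt_eqF //; have [p0 pt] := key t.
have p1 := d1 t.
have big : rhoh <= v (x (m0 + t)%N).
  rewrite -ler_ln ?posrE //; apply: le_trans pt.
  by move: g0 gh0 lr lrh; nra.
have big1 : 1 <= v (x (m0 + t)%N) by exact: le_trans big.
apply: le_trans (_ : ln (ch * v (x (m0 + t)%N)) <= _).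
  rewrite lnM ?posrE //; move: g0 gh0 lr lrh ghc pt; nra.
rewrite ler_ln ?posrE ?mulr_gt0 //.
  apply: le_trans (lowh _ big); rewrite ler_pM2l // -[leLHS]expr1 ler_weXn2l //.
  by rewrite -ltnS prednK // ltnW.
apply: lt_le_trans (lowh _ big); by rewrite mulr_gt0 // exprn_gt0.
Qed.

End Orbit.
End PolynomialEstimates.

(** * Primes at which the orbit escapes *)

Lemma closed_coprimep (F : closedFieldType) (p q : {poly F}) :
  (forall x, root p x -> ~~ root q x) -> coprimep p q.
Proof. by move=> h; apply/Pdiv.ClosedField.coprimepP. Qed.

(* Otherwise f - X is separable, and its deg f zeros are all zeros of f'. *)
Lemma nonsuperattracting_fixed_point (F : closedFieldType) (f : {poly F}) :
  [pchar F] =i pred0 -> (2 <= (size f).-1)%N ->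
  exists2 c, f.[c] = c & ~~ root f^`() c.
Proof.
move=> F0 hf; apply: contrapT => nc.
have allc c : f.[c] = c -> root f^`() c.
  by move=> fc; apply: contrapT => /negP h; apply: nc; exists c.
have sf : (2 < size f)%N by move: hf; case: (size f).
have sfX : size (f - 'X) = size f by rewrite size_polyDl // size_polyN size_polyX.
have [z zE] := closed_field_poly_normal (f - 'X).
have lc0 : lead_coef (f - 'X) != 0 by rewrite lead_coef_eq0 -size_poly_eq0 sfX; case: (size f) sf.
have sz : (size z).+1 = size f by rewrite -sfX zE size_scale // size_prod_XsubC.
have zr c : c \in z -> f.[c] = c.
  move=> cz; have : root (f - 'X) c by rewrite zE rootZ // root_prod_XsubC.
  by rewrite rootE !hornerE subr_eq0 => /eqP.
have uz : uniq z.
  rewrite -separable_prod_XsubC.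
  have : separable_poly (f - 'X).
    rewrite separable_poly.unlock; apply: closed_coprimep => c.
    rewrite !rootE derivB derivX !hornerE subr_eq0 => /eqP/allc/rootP->.
    by rewrite sub0r oppr_eq0 oner_eq0.
  by rewrite zE separable_poly.unlock derivZ coprimepZl // coprimepZr.
have d0 : f^`() != 0 by rewrite deriv_neq0 // (ltn_trans _ sf).
have := max_poly_roots d0 (_ : all (root f^`()) z) uz.
have -> : all (root f^`()) z by apply/allP => c /zr/allc.
move=> /(_ isT); have f0 : f != 0 by rewrite -size_poly_gt0 (ltn_trans _ sf).
by have := lt_size_deriv f0; rewrite -sz ltnS => h1 h2; have := leq_trans h2 h1; rewrite ltnn.
Qed.

Section InvariantPolynomial.
Variables (K : fieldType) (Kbar : closedFieldType) (j : {rmorphism K -> Kbar}).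
Hypothesis hj : algebraic_closure j.
Hypothesis char0 : [pchar K] =i pred0.

(** Since [h] is a minimal polynomial of the fixed point [c], divisibility by it and coprimality
    with it are both tested at [c]. The last clause ensures that a wandering orbit never meets a
    zero of [h]. *)
Lemma invariant_polynomial (f : {poly K}) : (2 <= (size f).-1)%N ->
  exists h q u w : {poly K}, [/\ (1 < size h)%N, h \Po f = h * q, u * h + w * q = 1
    & forall y, root h y -> f.[y] = y].
Proof.
move=> hf; have charKbar : [pchar Kbar] =i pred0 by move=> p; rewrite (fmorph_pchar j) char0.
have [c fc dc] : exists2 c, (map_poly j f).[c] = c & ~~ root (map_poly j f)^`() c.
  by apply: nonsuperattracting_fixed_point => //; rewrite size_map_poly.
have [h mh] := minimal_poly_ex (hj c); have [hm hc hmin] := mh.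
have /dvdpP[q qE] : h %| h \Po f.
  by apply: hmin; rewrite rootE map_comp_poly horner_comp fc; exact/eqP/rootP.
have hE : h \Po f = h * q by rewrite qE mulrC.
have qc : ~~ root (map_poly j q) c.
  apply: contra dc => qc.
  (* Differentiating the relation at [c], a fixed point and a zero of [h], gives h'(c) f'(c) = h'(c)
     q(c), and h'(c) is nonzero by separability. *)
  have := congr1 (fun p : {poly K} => (map_poly j p^`()).[c]) hE.
  rewrite deriv_comp derivM rmorphD !rmorphM /= !hornerE map_comp_poly horner_comp fc.
  rewrite (rootP qc) (rootP hc) mulr0 mul0r addr0 => /eqP; rewrite mulf_eq0.
  rewrite -!rootE (negbTE (minimal_poly_deriv char0 mh)) /=.
  by rewrite deriv_map.
have [u [w uw]] := coprimep_bezout (minimal_poly_coprime mh qc).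
exists h, q, u, w; split=> //; first exact: minimal_poly_size mh.
move=> y hy; have : root (f - 'X) y.
  have /dvdpP[r ->] : h %| f - 'X.
    by apply: hmin; rewrite rootE rmorphB /= map_polyX !hornerE fc subrr.
  by rewrite rootM hy orbT.
by rewrite rootE !hornerE subr_eq0 => /eqP.
Qed.

(** Coordinates of [V] may happen to be zeros of [h]. The other zeros of [g] belong to a factor
    coprime to [h], for which a Bezout relation is available. *)
Lemma coprime_part (h g : {poly K}) : g != 0 -> exists g1 u1 w1 : {poly K},
  u1 * h + w1 * g1 = 1 /\ forall (L : fieldType) (e : {rmorphism K -> L}) b,
    root (map_poly e g) b -> root (map_poly e h) b \/ root (map_poly e g1) b.
Proof.
move=> g0; have cop : coprimep h (gdcop h g) by rewrite coprimep_sym coprimep_gdco.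
have [u [w uw]] := coprimep_bezout cop; exists (gdcop h g), u, w; split=> // L e b gb.
have [hb|hb] := boolP (root (map_poly e h) b); first by left.
by right; rewrite gdcop_map root_gdco ?map_poly_eq0 // gb.
Qed.

End InvariantPolynomial.

Lemma bernoulli (R : realType) (t : R) n : 0 <= t -> 1 + n%:R * t <= (1 + t) ^+ n.
Proof.
move=> t0; elim: n => [|n IHn]; first by rewrite mul0r addr0 expr0.
rewrite exprS; apply: le_trans (_ : (1 + t) * (1 + n%:R * t) <= _).
  have h : 0 <= n%:R * t * t by rewrite !mulr_ge0.
  by rewrite -natr1; move: h; lra.
by rewrite ler_pM2l // ltr_pwDl.
Qed.

(* Expanding (x + y)^n gives t^n <= n + 1 for t = |x + y| / max (|x|, |y|). *)
Lemma nat_bounded_ultrametric (R : realType) (L : fieldType) (a : absval R L) :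
  (forall n, a n%:R <= 1) -> ultrametric a.
Proof.
move=> a1 x y; set m := Num.max (a x) (a y).
have m0 : 0 <= m by rewrite le_max absval_ge0.
have mx : a x <= m by rewrite le_max lexx.
have my : a y <= m by rewrite le_max lexx orbT.
have pw n : a (x + y) ^+ n <= n.+1%:R * m ^+ n.
  rewrite -absvalX exprDn; apply: le_trans (absval_sum _ _ _ _) _.
  apply: le_trans (_ : \sum_(i < n.+1) m ^+ n <= _).
    apply: ler_sum => i _; rewrite -mulr_natl !absvalM !absvalX.
    have -> : m ^+ n = 1 * (m ^+ (n - i) * m ^+ i).
      by rewrite mul1r -exprD subnK // -ltnS.
    by rewrite !ler_pM ?mulr_ge0 ?exprn_ge0 ?absval_ge0 // lerXn2r ?nnegrE ?absval_ge0.
  by rewrite sumr_const card_ord -[_ *+ n.+1]mulr_natl.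
rewrite leNgt; apply/negP => mlt.
have [m00|m00] := eqVneq m 0.
  by have := pw 1%N; rewrite m00 expr1 expr1 mulr0 leNgt -m00 mlt.
have mp : 0 < m by rewrite lt0r m00.
pose t := a (x + y) / m - 1.
have t0 : 0 < t by rewrite subr_gt0 ltr_pdivlMr // mul1r.
have grow n : (1 + t) ^+ n <= n.+1%:R.
  by rewrite /t addrC subrK expr_div_n ler_pdivrMr ?exprn_gt0.
(* With n t^2 > 2, Bernoulli gives (1 + t)^(2n) >= (1 + n t)^2 > 1 + 2n, against [grow] at n + n. *)
pose n := (Num.bound (2 / (t * t))).+1.
have nb : 2 < n%:R * (t * t).
  rewrite -ltr_pdivrMr ?mulr_gt0 //.
  apply: lt_trans (archi_boundP _) _; last by rewrite ltr_nat.
  by rewrite divr_ge0 // mulr_ge0 // ltW.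
have := grow (n + n)%N; rewrite exprD -addnS natrD -natr1.
have b1 := bernoulli n (ltW t0).
have n1 : 1 <= n%:R :> R by rewrite ler1n.
have : (1 + n%:R * t) * (1 + n%:R * t) <= (1 + t) ^+ n * (1 + t) ^+ n.
  by rewrite ler_pM // addr_ge0 // mulr_ge0 // ltW.
have n1t : 0 <= n%:R * t by rewrite mulr_ge0 // ltW.
have : 2 * n%:R < n%:R * t * (n%:R * t).
  have -> : n%:R * t * (n%:R * t) = n%:R * (t * t) * n%:R by ring.
  by rewrite ltr_pM2r // (lt_le_trans _ n1).
nra.
Qed.

Section Escape.
Variables (R : realType) (K : fieldType) (B : global_field K).

(* Stated for all realizations (L, a) of p, so as to apply to the given completion. *)
Definition escapes (p : place R B) (x : nat -> K) (g : {poly K}) : Prop :=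
  forall (L : fieldType) (e : {rmorphism K -> L}) (a : absval R L),
    place_class p (absval_pullback e a) -> ultrametric a ->
    (exists C, forall m, a (e (x m)) <= C) /\
    forall b, root (map_poly e g) b -> exists2 eps, 0 < eps &
      exists M, forall m, (M <= m)%N -> eps <= a (e (x m) - b).

Variables (M : eqType) (v : M -> absval R K).
Hypothesis gp : global_places B v.

(** Two orbit points near the same [b] would be near each other. *)
Lemma escapes_separated (i : M) (p : place R B) (x : nat -> K) (g : {poly K}) C c :
  place_class p (v i) -> (forall m, v i (x m) <= C) -> 0 < c ->
  (forall m n, m != n -> c <= v i (x m - x n)) -> escapes p x g.
Proof.
move=> pi xC c0 sep L e a pa au.
have [s s0 aE] := proj1 (place_equiv _ pi) pa.
have {}aE y : a (e y) = v i y `^ s by rewrite -aE.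
split.
  exists (C `^ s) => m; rewrite aE; apply: ge0_ler_powR; rewrite ?nnegrE ?absval_ge0 //.
  - exact: ltW.
  - exact: le_trans (absval_ge0 _ _) (xC 0%N).
move=> b _; exists (c `^ s); first exact: powR_gt0.
apply: contrapT => nM.
have close m0 : exists2 m, (m0 <= m)%N & a (e (x m) - b) < c `^ s.
  apply: contrapT => n; apply: nM; exists m0 => m mm; rewrite leNgt.
  by apply/negP => h; apply: n; exists m.
have [m _ hm] := close 0%N; have [n mn hn] := close m.+1.
have : c `^ s <= a (e (x m) - e (x n)).
  rewrite -rmorphB aE; apply: ge0_ler_powR; rewrite ?nnegrE ?absval_ge0 //.
  - exact: ltW.
  - exact: ltW.
  - by apply: sep; rewrite neq_ltn mn.
rewrite leNgt; have -> : e (x m) - e (x n) = (e (x m) - b) - (e (x n) - b).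
  by rewrite opprB addrA subrK.
by move=> /negP; apply; apply: le_lt_trans (au _ _) _; rewrite absvalN gt_max hm.
Qed.

Lemma bounded_orbit_separated (x : nat -> K) (s0 : seq M) : injective x ->
  (forall i, exists C, forall m, v i (x m) <= C) ->
  (forall i, i \notin s0 -> ultrametric (v i) /\ forall m, v i (x m) <= 1) ->
  forall i, exists2 c, 0 < c & forall m n, m != n -> c <= v i (x m - x n).
Proof.
move=> xinj bd s0P i; have [pf _ _ _ _] := gp.
have : forall l, exists C, 1 <= C /\ forall m n, v l (x m - x n) <= C.
  move=> l; have [C hC] := bd l; exists (Num.max 1 (C + C)); split; first by rewrite le_max lexx.
  move=> m n; apply: le_trans (absvalD _ _ _) _.
  by rewrite absvalN le_max lerD ?orbT.
move=> /choice[C hC].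
have C0 l : 0 < C l by have [h _] := hC l; exact: lt_le_trans h.
(* In the product formula for [x m - x n], indices outside [s0] contribute at most 1, and those of
   [s0] other than [i] at most [T] together. *)
pose s1 := undup (i :: s0); pose T := \prod_(l <- s1 | l != i) C l.
have T0 : 0 < T by rewrite /T; elim/big_ind: _ => // y z; exact: mulr_gt0.
exists T^-1; first by rewrite invr_gt0.
move=> m n mn; have y0 : x m - x n != 0 by rewrite subr_eq0 (inj_eq xinj).
have [s [us s1' sE]] := pf _ y0; pose t := undup (s ++ s1).
have ut : uniq t by exact: undup_uniq.
have out l : l \notin t -> v l (x m - x n) = 1.
  by rewrite mem_undup mem_cat negb_or => /andP[/s1'].
have it : i \in t by rewrite mem_undup mem_cat mem_undup mem_head orbT.
have := pf_prod pf y0 ut out; rewrite (bigD1_seq i) //= => E.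
have : 1 <= v i (x m - x n) * T.
  rewrite -{1}E ler_wpM2l ?absval_ge0 //.
  rewrite (bigID (mem s1)) /= -[leRHS]mulr1; apply: ler_pM.
  - by rewrite prodr_ge0 // => l _; exact: absval_ge0.
  - by rewrite prodr_ge0 // => l _; exact: absval_ge0.
  - rewrite /T -big_filter -[leRHS]big_filter.
    have pe : perm_eq [seq l <- t | (l != i) && (l \in s1)] [seq l <- s1 | l != i].
      apply: uniq_perm; rewrite ?filter_uniq ?undup_uniq // => l.
      rewrite !mem_filter; case: (boolP (l \in s1)) => ls; rewrite ?andbF // !andbT.
      by rewrite andb_idr // => _; rewrite mem_undup mem_cat ls orbT.
    rewrite (perm_big _ pe) /=; apply: ler_prod => l _; rewrite absval_ge0 /=.
    by have [_ h] := hC l; exact: h.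
  - apply: prodr_ile1 => l /andP[_ ls]; rewrite absval_ge0 /=.
    have lt0 : l \notin s0.
      by apply: contra ls => ls; rewrite /= mem_undup inE ls orbT.
    by have [lu l1] := s0P l lt0; exact: ultrametric_sub.
by rewrite -ler_pdivrMr // div1r.
Qed.

End Escape.

Lemma integral_at_mem (R : realType) (K L : fieldType) (e : {rmorphism K -> L}) (a : absval R L)
    (p : {poly K}) : (forall c, c \in (p : seq K) -> a (e c) <= 1) -> integral_at e a p.
Proof.
move=> h i; have [ip|pi] := ltnP i (size p); first by apply: h; rewrite mem_nth.
by rewrite nth_default // rmorph0 absval0.
Qed.

Lemma ln_prod_seq (R : realType) (M : eqType) (F : M -> R) (s : seq M) :
  (forall i, 0 < F i) -> ln (\prod_(i <- s) F i) = \sum_(i <- s) ln (F i).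
Proof.
move=> F0; elim: s => [|i s IHs]; first by rewrite !big_nil ln1.
rewrite !big_cons lnM ?IHs // posrE //.
by elim/big_ind: _ => // y z; exact: mulr_gt0.
Qed.

Section EscapingIndex.
Variables (R : realType) (K : fieldType) (B : global_field K).
Variables (Kbar : closedFieldType) (j : {rmorphism K -> Kbar}).
Hypothesis hj : algebraic_closure j.
Variables (M : eqType) (v : M -> absval R K).
Hypothesis gp : global_places B v.
Variables (f : {poly K}) (alpha : K).
Hypothesis hf : (2 <= (size f).-1)%N.
Local Notation x := (orbit_seq f alpha).
Hypothesis xinj : injective x.

(** The list [s] is arbitrary: this is how infinitely many good indices are obtained, the
    exceptional indices of either case being added to it. *)
Lemma escaping_index (g : {poly K}) (s : seq M) : g != 0 ->
  exists i, [/\ i \notin s, ultrametric (v i) & forall p : place R B, place_class p (v i) -> escapes p x g].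
Proof.
move=> g0; have [pf [s1 s1u] inf _ _] := gp.
have [bd|/existsNP[i0 unb]] := pselect (forall i, exists C, forall m, v i (x m) <= C).
  have [s2 s2P] := pf_bound pf (alpha :: f).
  have s0P i : i \notin s1 ++ s2 -> ultrametric (v i) /\ forall m, v i (x m) <= 1.
    rewrite mem_cat negb_or => /andP[/s1u iu /s2P ib]; split=> // m.
    apply: (@orbit_integral _ _ _ (idfun : {rmorphism K -> K}) _ iu).
      by apply: integral_at_mem => c cf; apply: ib; rewrite inE cf orbT.
    by apply: ib; rewrite mem_head.
  have [i] := inf (s ++ s1); rewrite mem_cat negb_or => /andP[is_ /s1u iu].
  exists i; split=> // p pi.
  have [c c0 sep] := bounded_orbit_separated gp xinj bd s0P i.
  have [C hC] := bd i; by have := escapes_separated g pi hC c0 sep.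
have [h [q [u [w [sh hE uw hfix]]]]] := invariant_polynomial hj (global_field_char0 B) hf.
have [g1 [u1 [w1 [uw1 groot]]]] := coprime_part h g0.
(* A zero of [h] in the orbit would be a fixed point of [f], and the orbit would repeat. *)
have hx m : h.[x m] != 0.
  apply/negP => /hfix fx; have /xinj/eqP : x m.+1 = x m by rewrite -[RHS]fx.
  by rewrite -[X in _ == X]addn0 -addn1 eqn_add2l.
have [s2 s2P] := pf_bound pf (alpha :: f ++ h ++ q ++ u ++ w ++ u1).
pose t := undup (i0 :: s ++ s1 ++ s2).
have tP i : i \notin t -> [/\ i \notin s, ultrametric (v i) &
    forall c, c \in alpha :: f ++ h ++ q ++ u ++ w ++ u1 -> v i c <= 1].
  rewrite mem_undup inE !mem_cat !negb_or => /and4P[_ ? /s1u ? /s2P ?]; by split.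
have [[i [it [m0 hm0]]]|none] := pselect (exists i, i \notin t /\ exists m, v i h.[x m] < 1).
  have [is_ iu i1] := tP i it; exists i; split=> // p pi L e a pa au.
  have eqv := proj1 (place_equiv _ pi) pa.
  have i1e c : c \in alpha :: f ++ h ++ q ++ u ++ w ++ u1 -> a (e c) <= 1.
    by move/i1; exact: (absval_equiv_le1 eqv).
  have int (r : {poly K}) : {subset (r : seq K) <= alpha :: f ++ h ++ q ++ u ++ w ++ u1} ->
      integral_at e a r.
    by move=> rs; apply: integral_at_mem => c /rs; exact: i1e.
  have fi : integral_at e a f by apply: int => c cf; rewrite !(inE, mem_cat) cf !orbT.
  have ai : a (e alpha) <= 1 by apply: i1e; rewrite mem_head.
  split; first by exists 1 => m; exact: orbit_integral.
  move=> b /groot hb.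
  apply: (@no_accumulation_at_divisor _ _ _ e a au f alpha fi ai h q u w hE uw _ _ _ _ hx g1 u1 w1 m0 uw1) => //.
  - by apply: int => c cf; rewrite !(inE, mem_cat) cf !orbT.
  - by apply: int => c cf; rewrite !(inE, mem_cat) cf !orbT.
  - by apply: int => c cf; rewrite !(inE, mem_cat) cf !orbT.
  - by apply: int => c cf; rewrite !(inE, mem_cat) cf !orbT.
  - by apply: int => c cf; rewrite !(inE, mem_cat) cf !orbT.
  - exact: (absval_equiv_lt1 eqv).
exfalso; have unit i m : i \notin t -> v i h.[x m] = 1.
  move=> it; have [_ iu i1] := tP i it; apply/eqP; rewrite eq_le; apply/andP; split.
    have int (r : {poly K}) : {subset (r : seq K) <= alpha :: f ++ h ++ q ++ u ++ w ++ u1} ->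
      integral_at (idfun : {rmorphism K -> K}) (v i) r.
      by move=> rs; apply: integral_at_mem => c /rs; exact: i1.
    apply: (@integral_at_eval _ _ _ (idfun : {rmorphism K -> K}) _ iu).
      by apply: int => c cf; rewrite !(inE, mem_cat) cf !orbT.
    apply: (@orbit_integral _ _ _ (idfun : {rmorphism K -> K}) _ iu).
      by apply: int => c cf; rewrite !(inE, mem_cat) cf !orbT.
    by apply: i1; rewrite mem_head.
  by rewrite leNgt; apply/negP => lt1; apply: none; exists i; split=> //; exists m.
have [H H0 [m0 hm0]] := orbit_poly_growth erefl hf sh unb.
apply: (@growth_pigeonhole _ _ t (fun i m => ln (v i h.[x m])) (size f).-1 i0 H m0) => //.
- exact: undup_uniq.
- move=> m; rewrite -ln_prod_seq; last by move=> i; rewrite absval_gt0.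
  by rewrite (pf_prod pf (hx m)) ?ln1 ?undup_uniq // => i; exact: unit.
- by move=> i _; exact: orbit_poly_upper.
- by move=> i _; exact: (orbit_poly_near (v i) sh hE uw hx).
- by rewrite mem_undup mem_head.
Qed.

End EscapingIndex.

Section InfinitelyManyPlaces.
Variables (R : realType) (K : fieldType) (B : global_field K).
Variables (M : eqType) (v : M -> absval R K).
Hypothesis gp : global_places B v.

(** Finitely many places occupy only finitely many indices, and the hypothesis provides a good index
    outside these. *)
Lemma infinitely_many_places (Q : place R B -> Prop) :
  (forall s : seq M, exists i, [/\ i \notin s, ultrametric (v i) &
     forall p : place R B, place_class p (v i) -> Q p]) ->
  infinite_set [set p : place R B | is_prime p /\ Q p].
Proof.
move=> h fin; have [_ _ _ eqs nt] := gp.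
have /finite_seqP[s sE] : finite_set
    (\bigcup_(p in [set p : place R B | is_prime p /\ Q p]) [set i | place_class p (v i)]).
  apply: bigcup_finite => // p _; have [u pu] := place_nonempty p; have [s sP] := eqs u.
  apply: sub_finite_set (finite_seq s) => i /= /(place_equiv _ pu); exact: sP.
have [i [is_ iu iQ]] := h s; have [nti ci] := nt i.
have cP : exists2 w : absval R K, absval_nontrivial w /\ (forall c, constants B c -> c != 0 -> w c = 1)
    & [set w | absval_equiv (v i) w] = [set u | absval_equiv w u] by exists (v i).
pose p := Place cP.
have pi : place_class p (v i) by exact: absval_equiv_refl.
have : [set` s] i.
  rewrite -sE; exists p => //; split; last exact: iQ.
  by move=> a pa; exact: (absval_equiv_ultrametric pa).
by rewrite /= (negbTE is_).
Qed.

End InfinitelyManyPlaces.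

Theorem infinitely_many_escaping (R : realType) (K : fieldType) (B : global_field K)
    (Kbar : closedFieldType) (j : {rmorphism K -> Kbar}) (f : {poly K}) (alpha : K) (g : {poly K}) :
  algebraic_closure j -> (2 <= (size f).-1)%N -> injective (orbit_seq f alpha) -> g != 0 ->
  infinite_set [set p : place R B | is_prime p /\ escapes p (orbit_seq f alpha) g].
Proof.
move=> hj hf xinj g0; have [[M [v gp]] _] := global_places_exist R B hj.
by apply: (infinitely_many_places gp) => s; exact: (escaping_index hj gp).
Qed.

Theorem infinitely_many_primes (R : realType) (K : fieldType) (B : global_field K)
    (Kbar : closedFieldType) (j : {rmorphism K -> Kbar}) : algebraic_closure j ->
  infinite_set [set p : place R B | is_prime p].
Proof.
move=> hj; have [[M [v gp]] _] := global_places_exist R B hj.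
suff : infinite_set [set p : place R B | is_prime p /\ True].
  by apply: contra_not; apply: sub_finite_set => p [].
apply: (infinitely_many_places gp) => s; have [_ [s1 s1u] inf _ _] := gp.
have [i] := inf (s ++ s1); rewrite mem_cat negb_or => /andP[is_ /s1u iu].
by exists i.
Qed.

(** Being at most 1 on the natural numbers already forces an absolute value to be ultrametric, and
    these numbers come from [K]; no density argument is made. *)
Lemma completion_ultrametric (R : realType) (K : fieldType) (B : global_field K) (p : place R B)
  (L : fieldType) (e : {rmorphism K -> L}) (a : absval R L) :
  is_prime p -> place_class p (absval_pullback e a) -> ultrametric a.
Proof.
move=> pp /pp eu; apply: nat_bounded_ultrametric => n.
by have := ultrametric_nat n eu; rewrite /= rmorph_nat.
Qed.

(** * Special polynomials *)

Lemma closed_poly_eq0 (F : closedFieldType) (p : {poly F}) : (forall x, p.[x] = 0) -> p = 0.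
Proof.
move=> p0; have /negPn/size_poly1P[c c0 pc] : ~~ (size (p + 1%:P) != 1%N).
  by apply/negP => /closed_rootP[x]; rewrite rootE hornerD p0 add0r hornerC oner_eq0.
have pE : p = (c - 1)%:P by rewrite polyCB -pc addrK.
by have := p0 0; rewrite pE hornerC => ->.
Qed.

(* Either L(oo) is finite, and then L^-1(oo) is totally invariant under f, or L is affine. *)
Lemma conjugate_dichotomy (F : fieldType) (f g : {poly F}) : conjugate f g ->
  (exists e, forall x, f.[x] = e <-> x = e) \/
  (exists a b, a != 0 /\ forall x, a * f.[x] + b = g.[a * x + b]).
Proof.
move=> [a [b [c [d [D0 cj]]]]].
have [c0|c0] := eqVneq c 0.
  right; move: D0; rewrite c0 mulr0 subr0 mulf_eq0 negb_or => /andP[a0 d0].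
  exists (a / d), (b / d); split; first by rewrite mulf_neq0 ?invr_eq0.
  move=> x; have := cj (Some x); rewrite /mobius /= c0 !mul0r !add0r !mulr1 /P1_of_coord (negbTE d0) /=.
  by move=> [E]; rewrite -[a / d * x]mulrAC -mulrDl -E mulrDl mulrAC.
left; exists (- d / c).
have mob x : mobius a b c d (Some x) = None <-> x = - d / c.
  rewrite /mobius /= /P1_of_coord mulr1; case: eqVneq => E; split=> // H.
    by apply: (mulfI c0); rewrite [RHS]mulrC divfK //; apply/eqP; rewrite -addr_eq0 E.
  by exfalso; move/eqP: E; apply; rewrite H mulrC divfK // addNr.
have fE x : f.[x] = - d / c <-> x = - d / c.
  rewrite -2!mob; have := cj (Some x) => /= ->.
  by case: (mobius _ _ _ _ _).
exact: fE.
Qed.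

Lemma totally_invariant_form (F : closedFieldType) (f : {poly F}) (e : F) : (1 < size f)%N ->
  (forall x, f.[x] = e -> x = e) ->
  f = lead_coef f *: ('X - e%:P) ^+ (size f).-1 + e%:P.
Proof.
move=> sf fe; have sE : size (f - e%:P) = size f.
  by rewrite size_polyDl // size_polyN (leq_ltn_trans (size_polyC_leq1 _)).
have lE : lead_coef (f - e%:P) = lead_coef f.
  by rewrite lead_coefDl // size_polyN (leq_ltn_trans (size_polyC_leq1 _)).
have [r rE] := closed_field_poly_normal (f - e%:P); rewrite lE in rE.
have l0 : lead_coef f != 0 by rewrite lead_coef_eq0 -size_poly_gt0 ltnW.
have re : r = nseq (size r) e.
  apply/all_pred1P/allP => x xr; apply/eqP/fe.
  have : root (f - e%:P) x by rewrite rE rootZ // root_prod_XsubC.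
  by rewrite rootE !hornerE subr_eq0 => /eqP.
have sr : (size r).+1 = size f by rewrite -sE rE size_scale // size_prod_XsubC.
rewrite -[LHS](subrK e%:P) rE re -sr /=; congr (_ *: _ + _).
by rewrite big_nseq iter_mulr_1.
Qed.

(** The point is rational because it can be read off the coefficient of degree d - 1, which is minus
    d times the leading coefficient times [e]; as d is at least 2, the added constant does not
    interfere. *)
Lemma totally_invariant_rational (K : fieldType) (F : closedFieldType) (j : {rmorphism K -> F})
    (f : {poly K}) (e : F) : [pchar K] =i pred0 -> (2 <= (size f).-1)%N ->
  (forall x, (map_poly j f).[x] = e -> x = e) ->
  exists c e0, c != 0 /\ f = c *: ('X - e0%:P) ^+ (size f).-1 + e0%:P.
Proof.
move=> char0 hf fe; have sf : (2 < size f)%N by move: hf; case: (size f).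
have := totally_invariant_form _ fe; rewrite size_map_poly lead_coef_map.
move=> /(_ (ltnW sf)) E; set d := (size f).-1 in hf E *.
have l0 : lead_coef f != 0 by rewrite lead_coef_eq0 -size_poly_gt0 (ltn_trans _ sf).
have d0 : d%:R != 0 :> K by rewrite -[0]/(0%:R) (inj_eq (natr_inj_char0 char0)) -lt0n (leq_trans _ hf).
have [e0 eE] : exists e0, e = j e0.
  exists (- f`_d.-1 / (d%:R * lead_coef f)).
  have := congr1 (fun p : {poly F} => p`_d.-1) E.
  rewrite coef_map coefD coefZ coefC.
  have -> : (d.-1 == 0)%N = false by rewrite -subn1 subn_eq0 leqNgt hf.
  have -> : ('X - e%:P) ^+ d = \prod_(x <- nseq d e) ('X - x%:P) by rewrite big_nseq iter_mulr_1.
  have := @coefPn_prod_XsubC _ (nseq d e); rewrite size_nseq => ->; last by rewrite -lt0n (leq_trans _ hf).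
  rewrite big_nseq iter_addr_0 addr0 => E1.
  rewrite fmorph_div rmorphN E1 rmorphM rmorph_nat; field.
  by rewrite fmorph_eq0 l0 -(rmorph_nat j) fmorph_eq0.
exists (lead_coef f), e0; split=> //; apply: (map_poly_inj j).
by rewrite [LHS]E rmorphD /= map_polyZ rmorphXn rmorphB /= map_polyX !map_polyC /= eE.
Qed.

(** * Chebyshev polynomials have no critical periodic points *)

Section Chebyshev.
Variable F : closedFieldType.
Hypothesis char0 : [pchar F] =i pred0.

Lemma joukowski_surjective (y : F) : exists2 w, w != 0 & y = w + w^-1.
Proof.
have [w] := @solve_monicpoly F 2 (nth 0 [:: -1; y]) isT.
rewrite !big_ord_recl big_ord0 /= expr0 expr1 mulr1 addr0 => E.
have w0 : w != 0.
  by apply: contra_eq_neq E => ->; rewrite expr0n mulr0 addr0 eq_sym oppr_eq0 oner_neq0.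
exists w => //; apply: (mulIf w0); rewrite mulrDl mulVf // -expr2.
by rewrite E; ring.
Qed.

Lemma joukowski_clear (q : {poly F}) : exists n (Q : {poly F}), forall w, w != 0 ->
  q.[w + w^-1] * w ^+ n = Q.[w].
Proof.
elim/poly_ind: q => [|q c [n [Q hQ]]]; first by exists 0%N, 0 => w _; rewrite !horner0 mul0r.
exists n.+1, (Q * ('X^2 + 1) + c *: 'X^(n.+1)) => w w0.
rewrite !hornerE exprS -hQ // exprS; field; exact: w0.
Qed.

Variables (d : nat) (C : {poly F}).
Hypotheses (d0 : (0 < d)%N) (hC : is_chebyshev d C).

(* A double zero of C - C(y0) pulls back under w + 1/w to a double zero of
   (w^d - w0^d) (w0^d w^d - 1), of order 4 if w0 = 1 or w0 = -1. *)
Lemma chebyshev_critical (w0 : F) : w0 != 0 -> root C^`() (w0 + w0^-1) ->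
  w0 ^+ d * w0 ^+ d = 1 /\ w0 ^+ 2 != 1.
Proof.
move=> w00 crit; set y0 := w0 + w0^-1 in crit.
have dF : d%:R != 0 :> F by rewrite -[0]/(0%:R) (inj_eq (natr_inj_char0 char0)) -lt0n.
have [q qE] : exists q, C - (C.[y0])%:P = q * ('X - y0%:P) ^+ 2.
  have /factor_theorem[q1 q1E] : root (C - (C.[y0])%:P) y0 by rewrite rootE !hornerE subrr.
  have /factor_theorem[q qE] : root q1 y0.
    have := congr1 (fun p : {poly F} => p^`().[y0]) q1E.
    by rewrite /= derivB derivC derivM derivXsubC !hornerE (rootP crit) subr0 subrr mulr0 add0r => /esym/eqP.
  by exists q; rewrite q1E qE -mulrA -expr2.
have [n [Q hQ]] := joukowski_clear q.
(* The quotient of X^d - w0^d by X - w0, which takes the nonzero value d w0^(d-1) at [w0]. *)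
pose S : {poly F} := \sum_(i < d) 'X^(d.-1 - i) * w0%:P ^+ i.
have SE : 'X^d - (w0 ^+ d)%:P = ('X - w0%:P) * S.
  by rewrite polyC_exp subrXX.
have S0 : S.[w0] = d%:R * w0 ^+ d.-1.
  rewrite /S horner_sum mulr_natl -[X in _ = _ *+ X]card_ord -sumr_const; apply: eq_bigr => i _.
  rewrite !hornerE -exprD subnK //.
  by rewrite -ltnS prednK.
(* Up to monomials, C(w + 1/w) - C(y0) is (w^d - w0^d)(w0^d w^d - 1) and w + 1/w - y0 is (w - w0)(w0
   w - 1); one factor X - w0 is cancelled. The proof restores it, and multiplies by X to dispose of
   w = 0, where w + 1/w has no meaning. *)
have main : S * (w0 ^+ d *: 'X^d - 1) * 'X^(n + 2) * (w0 ^+ 2)%:P =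
  (w0 ^+ d)%:P * 'X^d * ('X - w0%:P) * (w0 *: 'X - 1) ^+ 2 * Q.
  apply: (mulfI (_ : 'X * ('X - w0%:P) != 0 :> {poly F})).
    by rewrite mulf_neq0 ?polyX_eq0 ?polyXsubC_eq0.
  apply/eqP; rewrite -subr_eq0; apply/eqP/closed_poly_eq0 => w.
  have [->|wn0] := eqVneq w 0; first by rewrite -mulrBr hornerM (hornerM 'X) hornerX !mul0r.
  have := congr1 (fun p : {poly F} => p.[w + w^-1]) qE.
  have := congr1 (fun p : {poly F} => p.[w]) SE.
  rewrite !hornerE -hQ // /y0 !hC // => E1 E2.
  have A0 : w ^+ d != 0 by rewrite expf_neq0.
  have B0 : w0 ^+ d != 0 by rewrite expf_neq0.
  rewrite !exprD.
  move: A0 B0 E1 E2; set A := w ^+ d; set B := w0 ^+ d; set W := w ^+ n; set qv := q.[_].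
  move=> A0 B0 E1 E2.
  set sv := S.[w] in E1 *.
  transitivity (w * ((w - w0) * sv) * (B * A - 1) * W * w ^+ 2 * w0 ^+ 2
    - w * (w - w0) * B * A * (w - w0) * (w0 * w - 1) ^+ 2 * (qv * W)).
    by rewrite /=; ring.
  rewrite -E1.
  have {}E2 : A + A^-1 - (B + B^-1) - qv * (w + w^-1 - (w0 + w0^-1)) ^+ 2 = 0.
    by rewrite E2 /= expr2 mulrA subrr.
  transitivity (w ^+ 3 * w0 ^+ 2 * W * A * B *
    (A + A^-1 - (B + B^-1) - qv * (w + w^-1 - (w0 + w0^-1)) ^+ 2)).
    by field; rewrite w00 wn0 A0 B0.
  by rewrite E2 mulr0.
have X0 : 'X - w0%:P != 0 :> {poly F} by rewrite polyXsubC_eq0.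
have ww : w0 ^+ d * w0 ^+ d = 1.
  have := congr1 (fun p : {poly F} => p.[w0]) main.
  rewrite /= !hornerE /= S0 subrr ?(mulr0, mul0r) => /eqP.
  rewrite !mulf_eq0 (negbTE dF) !expf_eq0 (negbTE w00) !andbF !orbF /= subr_eq0.
  by move/eqP.
split=> //; apply/eqP => w2.
(* When w0^2 = 1 the factors w0^d X^d - 1 and w0 X - 1 also vanish at [w0]. Another X - w0 cancels,
   and evaluation at [w0] gives a nonzero left side and a zero right side. *)
have f1 : w0 ^+ d *: 'X^d - 1 = (w0 ^+ d)%:P * (('X - w0%:P) * S).
  by rewrite -SE mulrBr -polyCM ww mul_polyC.
have f2 : w0 *: 'X - 1 = w0%:P * ('X - w0%:P).
  by rewrite mulrBr -polyCM -expr2 w2 mul_polyC.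
move: main; rewrite f1 f2 w2 => main.
have : S * S * 'X^(n + 2) = 'X^d * (w0%:P ^+ 2 * ('X - w0%:P) ^+ 2) * Q.
  apply: (mulfI X0); apply: (@mulfI _ (w0 ^+ d)%:P).
    by rewrite polyC_eq0 expf_eq0 (negbTE w00) andbF.
  transitivity (S * ((w0 ^+ d)%:P * (('X - w0%:P) * S)) * 'X^(n + 2) * 1%:P).
    by rewrite mulr1; ring.
  by rewrite main; ring.
move/(congr1 (fun p : {poly F} => p.[w0])).
rewrite /= !hornerE /= S0 subrr ?(expr0n, mulr0, mul0r) => /eqP.
by rewrite !mulf_eq0 (negbTE dF) !expf_eq0 (negbTE w00) !andbF.
Qed.

(** A critical point w + 1/w has w^(2d) = 1, so its image is 2 or -2, and these two values are
    preserved by [g]. If it were periodic it would itself be 2 or -2, which forces w^2 = 1. *)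
Lemma chebyshev_noncritical (g : {poly F}) (y : F) (m : nat) : g = C \/ g = - C ->
  iter m.+1 (fun z => g.[z]) y = y -> ~~ root g^`() y.
Proof.
move=> gC gy; apply/negP => crit; have {crit} : root C^`() y.
  by case: gC crit => ->; rewrite ?derivN ?rootN.
have [w w0 yE] := joukowski_surjective y; rewrite yE => /(chebyshev_critical w0)[ww].
move/eqP; apply; pose two z := z = 2 \/ z = - 2 :> F.
have gz z : two C.[z] -> two g.[z].
  by case: gC => -> //; rewrite hornerN => -[] ->; rewrite ?opprK; [right|left].
have sq (t : F) : t * t = 1 -> t = 1 \/ t = -1.
  by rewrite -expr2 => /eqP; rewrite sqrf_eq1 => /orP[] /eqP; [left|right].
have two_gy : two g.[y].
  apply: gz; rewrite yE hC //; case: (sq _ ww) => ->; rewrite ?invrN invr1; first by left.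
  by right; rewrite -opprD.
have two_g z : two z -> two g.[z].
  move=> tz; apply: gz; case: tz => ->.
    by have := hC (oner_neq0 _); rewrite invr1 expr1n invr1 => ->; left.
  have N0 : -1 != 0 :> F by rewrite oppr_eq0 oner_neq0.
  have := hC N0; rewrite invrN invr1 -opprD => ->.
  by rewrite -signr_odd; case: odd; rewrite ?expr1 ?expr0 ?invrN invr1; [right; rewrite -opprD|left].
have : two y by rewrite -gy iterSr; elim: m {gy} => [//|m IHm]; rewrite iterS; exact: two_g.
have wy : y * w = w ^+ 2 + 1 by rewrite yE mulrDl mulVf.
have sqr0 (t : F) : t ^+ 2 = 0 -> t = 0 by move=> /eqP; rewrite sqrf_eq0 => /eqP.
case=> y2; move: wy; rewrite y2 => wy.
  have /sqr0/eqP : (w - 1) ^+ 2 = 0.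
    by transitivity (w ^+ 2 + 1 - 2 * w); [ring|rewrite wy subrr].
  by rewrite subr_eq0 => /eqP->; rewrite expr1n.
have /sqr0/eqP : (w + 1) ^+ 2 = 0.
  by transitivity (w ^+ 2 + 1 - (- 2 * w)); [ring|rewrite wy subrr].
by rewrite addr_eq0 => /eqP->; rewrite sqrrN expr1n.
Qed.

End Chebyshev.

(** The second case covers the power maps and also every conjugation that moves infinity, since
    either produces a finite totally invariant point; Chebyshev polynomials up to affine change are
    left for the first. *)
Lemma special_dichotomy (K : fieldType) (F : closedFieldType) (j : {rmorphism K -> F})
    (f : {poly K}) : [pchar K] =i pred0 -> (2 <= (size f).-1)%N -> special j f ->
  (forall y m, iter m.+1 (fun z => (map_poly j f).[z]) y = y -> ~~ root (map_poly j f)^`() y) \/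
  exists c e, c != 0 /\ f = c *: ('X - e%:P) ^+ (size f).-1 + e%:P.
Proof.
move=> char0 hf; have charF : [pchar F] =i pred0 by move=> p; rewrite (fmorph_pchar j) char0.
have inv e : (forall x, (map_poly j f).[x] = e <-> x = e) ->
    exists c e0, c != 0 /\ f = c *: ('X - e0%:P) ^+ (size f).-1 + e0%:P.
  by move=> h; apply: (totally_invariant_rational (j := j) char0 hf (e := e)) => x /h.
case=> [/conjugate_dichotomy[[e /inv]|[a [b [a0 E]]]]|[C hC cj]]; first by right.
  right; apply: (totally_invariant_rational (j := j) char0 hf (e := - b / a)) => x fx.
  have := E x; rewrite fx hornerXn mulrC divfK // addNr => /esym/eqP.
  rewrite expf_eq0 addr_eq0 => /andP[_ /eqP ax].
  by apply: (mulfI a0); rewrite ax [RHS]mulrC divfK.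
have [g gC /conjugate_dichotomy[[e /inv]|[a [b [a0 E]]]]] :
    exists2 g, g = C \/ g = - C & conjugate (map_poly j f) g.
  by case: cj => cj; [exists C|exists (- C)] => //; [left|right].
  by right.
left=> y m ym; have d0 : (0 < (size f).-1)%N by exact: ltnW.
have cheb := chebyshev_noncritical charF d0 hC (m := m) gC.
have gm l : iter l (fun z => g.[z]) (a * y + b) = a * iter l (fun z => (map_poly j f).[z]) y + b.
  by elim: l => [//|l IHl]; rewrite !iterS IHl E.
have := cheb (a * y + b); rewrite gm ym => /(_ erefl); apply: contra.
have : a *: map_poly j f + b%:P = g \Po (a *: 'X + b%:P).
  apply/eqP; rewrite -subr_eq0; apply/eqP/closed_poly_eq0 => x.
  by rewrite hornerD hornerN horner_comp !hornerE E subrr.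
move/(congr1 (fun p : {poly F} => p^`().[y])).
rewrite /= deriv_comp !derivD !derivZ !derivC derivX !addr0 hornerM horner_comp !hornerE => E1 /rootP E2.
by move: E1; rewrite E2 /= mulr0 mulr1 => /esym/eqP; rewrite mulf_eq0 (negbTE a0) orbF.
Qed.

(** * Preperiodicity of the coordinates of V *)

Section Preperiods.

Lemma values_repeat (T : eqType) (h : nat -> T) (s : seq T) : (forall l, h l \in s) ->
  exists l1 l2, (l1 < l2)%N /\ h l1 = h l2.
Proof.
move=> hs; apply: contrapT => nr.
have hinj : injective h.
  move=> l1 l2 E; apply/eqP; rewrite eqn_leq.
  by apply/andP; split; rewrite leqNgt; apply/negP => lt; apply: nr; [exists l2, l1|exists l1, l2].
have := @uniq_leq_size _ [seq h l | l <- iota 0 (size s).+1] s.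
rewrite map_inj_uniq // iota_uniq size_map size_iota ltnn => /(_ isT) sub.
by suff /sub : {subset [seq h l | l <- iota 0 (size s).+1] <= s} by []; move=> _ /mapP[l _ ->].
Qed.

Lemma iter_period (T : Type) (F : T -> T) (y : T) a N m q : iter (a + N) F y = iter a F y ->
  iter (a + m + N * q) F y = iter (a + m) F y.
Proof.
move=> E; have E1 q' : iter (a + N * q') F y = iter a F y.
  elim: q' => [|q' IHq]; first by rewrite muln0 addn0.
  by rewrite mulnS addnA addnC iterD E -iterD addnC IHq.
by rewrite addnAC addnC iterD E1 -iterD [in RHS]addnC.
Qed.

Lemma common_preperiod (T : eqType) (F : T -> T) (s : seq T) : exists a N, forall b, b \in s ->
  (exists l1 l2, (l1 < l2)%N /\ iter l1 F b = iter l2 F b) -> iter (a + N.+1) F b = iter a F b.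
Proof.
elim: s => [|c s [a [N hs]]]; first by exists 0%N, 0%N.
have [[l1 [l2 [lt E]]]|nc] := pselect (exists l1 l2, (l1 < l2)%N /\ iter l1 F c = iter l2 F c).
  have [P PE] : exists P, l2 = (l1 + P.+1)%N by exists (l2 - l1).-1; rewrite prednK ?subn_gt0 // subnKC // ltnW.
  exists (a + l1)%N, (N.+1 * P.+1).-1 => b; rewrite prednK // inE => /orP[/eqP->|bs] bp.
    by rewrite (addnC a) mulnC; apply: iter_period; rewrite -PE.
  by apply: iter_period; exact: hs.
by exists a, N => b; rewrite inE => /orP[/eqP->//|]; exact: hs.
Qed.

End Preperiods.

Lemma iter_diag_map (n : nat) (K : fieldType) (f : {poly K}) (Q : P1n n K) k m :
  iter m (diag_map f) Q k = omap (fun b => iter m (fun y => f.[y]) b) (Q k).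
Proof.
elim: m => [|m IHm]; first by rewrite /=; case: (Q k).
by rewrite iterS {1}/diag_map IHm; case: (Q k).
Qed.

(** Applying the equality of images repeatedly, each f^(k0 + l M)(b) equals f^k0 of a coordinate of
    some point of [V]. These coordinates are finitely many, so two of the iterates coincide, and the
    finitely many [b] have a common preperiod and period. *)
Lemma preperiodic_coord (n : nat) (K : fieldType) (Kbar : closedFieldType) (j : {rmorphism K -> Kbar})
    (f : {poly K}) (V : subvariety n K) (k : 'I_n) :
  algebraic_closure j -> dimension_zero j V -> preperiodic j f V ->
  exists a N, forall Q, points V j Q -> forall b, Q k = Some b ->
    iter (a + N.+1) (fun y => (map_poly j f).[y]) b = iter a (fun y => (map_poly j f).[y]) b.
Proof.
move=> hj hV [k0 [M [M1 hE]]]; have [g g0 hg] := dimension_zero_coord_algebraic k hj hV.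
set F := horner (map_poly j f).
have gj0 : map_poly j g != 0 by rewrite map_poly_eq0.
have [rs rsP] : exists rs : seq Kbar, forall b, root (map_poly j g) b -> b \in rs.
  have [rs rE] := closed_field_poly_normal (map_poly j g); exists rs => b.
  by rewrite rE rootZ ?lead_coef_eq0 // root_prod_XsubC.
have step Q b : points V j Q -> Q k = Some b -> forall l, exists Q' b', [/\ points V j Q', Q' k = Some b'
    & iter (k0 + l * M) F b = iter k0 F b'].
  move=> VQ Qb; elim=> [|l [Q' [b' [VQ' Qb' E]]]]; first by exists Q, b; rewrite mul0n addn0.
  have : (iter (k0 + M) (diag_map (map_poly j f)) @` points V j) (iter (k0 + M) (diag_map (map_poly j f)) Q').
    by exists Q'.
  rewrite hE => -[Q2 VQ2 /(congr1 (fun P => P k))]; rewrite !iter_diag_map Qb' /=.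
  case Q2b : (Q2 k) => [b2|//] /= [E2]; exists Q2, b2; split=> //.
  by rewrite mulSn addnCA iterD E -iterD addnC -E2.
have [a [N hN]] := common_preperiod F rs; exists a, N => Q VQ b Qb.
apply: hN; first by apply: rsP; exact: hg Qb.
have [l1 [l2 [lt E]]] : exists l1 l2, (l1 < l2)%N /\ iter (k0 + l1 * M) F b = iter (k0 + l2 * M) F b.
  apply: (@values_repeat _ _ [seq iter k0 F b' | b' <- rs]) => l.
  have [Q' [b' [VQ' Qb' ->]]] := step _ _ VQ Qb l.
  by apply: map_f; apply: rsP; exact: hg Qb'.
by exists (k0 + l1 * M)%N, (k0 + l2 * M)%N; rewrite ltn_add2l ltn_pmul2r.
Qed.

(** * Iterates of f and escape in the special case *)

Section IteratedPolynomial.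

Definition iter_poly (K : nzRingType) (f : {poly K}) m : {poly K} := iter m (fun q => f \Po q) 'X.

Variables (K : fieldType) (f : {poly K}).

Lemma horner_iter_poly m y : (iter_poly f m).[y] = iter m (fun z => f.[z]) y.
Proof. by elim: m => [|m IHm]; rewrite /iter_poly ?hornerX // !iterS horner_comp -IHm. Qed.

Lemma map_iter_poly (L : fieldType) (e : {rmorphism K -> L}) m :
  map_poly e (iter_poly f m) = iter_poly (map_poly e f) m.
Proof. elim: m => [|m IHm]; first by rewrite /iter_poly /= map_polyX.
by have := map_comp_poly e f (iter_poly f m); rewrite IHm. Qed.

Lemma iter_polySr m : iter_poly f m \Po f = iter_poly f m.+1.
Proof.
elim: m => [|m IHm]; first by rewrite /iter_poly /= comp_polyX comp_polyXr.
by rewrite /iter_poly iterS -comp_polyA [X in f \Po X]IHm.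
Qed.

End IteratedPolynomial.

Section SpecialEscape.
Variables (R : realType) (K : fieldType) (B : global_field K).
Variables (F : closedFieldType) (j : {rmorphism K -> F}) (f : {poly K}) (alpha : K).
Hypothesis hf : (2 <= (size f).-1)%N.
Local Notation x := (orbit_seq f alpha).
Local Notation d := (size f).-1.
Hypothesis xinj : injective x.
Variables (a N : nat).
Local Notation Fa := (iter_poly f a).
Local Notation FN := (iter_poly f N.+1).

Let orbit_iter_poly l m : (iter_poly f l).[x m] = x (l + m)%N.
Proof. by rewrite horner_iter_poly /orbit_seq iterD. Qed.

Let periodic_orbit m : (FN - 'X).[x m] != 0.
Proof.
rewrite !hornerE orbit_iter_poly subr_eq0; apply/eqP => /xinj/eqP.
by rewrite -[X in _ == X]add0n eqn_add2r.
Qed.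

Let int_mem (L : fieldType) (e : {rmorphism K -> L}) (b : absval R L) (l : seq K) (p : {poly K}) :
  (forall c, c \in l -> b (e c) <= 1) -> {subset (p : seq K) <= l} -> integral_at e b p.
Proof. by move=> h pl; apply: integral_at_mem => c /pl; exact: h. Qed.

Lemma escapes_separable :
  (forall y m, iter m.+1 (fun z => (map_poly j f).[z]) y = y -> ~~ root (map_poly j f)^`() y) ->
  exists l : seq K, forall p : place R B, (forall c, c \in l -> forall b, place_class p b -> b c <= 1) ->
    escapes p x ((FN - 'X) \Po Fa).
Proof.
move=> nc; pose H := FN - 'X.
(* The difference quotient of [f] between [FN] and 'X. As [f] commutes with its iterates, [H \Po f]
   is f(FN) - f, which is [H * T]; on the zeros of [H] the two arguments coincide and [T] becomes
   the derivative. *)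
pose T := \sum_(i < size f) f`_i *: \sum_(l < i) FN ^+ (i.-1 - l) * 'X^l.
have fE : f = \sum_(i < size f) f`_i *: 'X^i by rewrite -poly_def coefK.
have HT : H \Po f = H * T.
  rewrite comp_polyB comp_polyX iter_polySr /iter_poly iterS -/(iter_poly f N.+1).
  rewrite comp_polyE [X in _ - X]fE -sumrB mulr_sumr; apply: eq_bigr => i _.
  by rewrite -scalerBr subrXX scalerAr.
have Ty y : root (map_poly j H) y -> (map_poly j T).[y] = (map_poly j f)^`().[y].
  move=> Hy; have Fy : (map_poly j FN).[y] = y.
    by apply/eqP; move: Hy; rewrite rootE rmorphB /= map_polyX !hornerE subr_eq0.
  have -> : map_poly j f = \sum_(i < size f) j f`_i *: 'X^i.
    rewrite [X in map_poly j X]fE rmorph_sum /=; apply: eq_bigr => i _.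
    by rewrite map_polyZ /= map_polyXn.
  rewrite rmorph_sum raddf_sum /= !horner_sum; apply: eq_bigr => i _.
  rewrite map_polyZ derivZ !hornerZ derivXn hornerMn hornerXn; congr (_ * _).
  rewrite rmorph_sum horner_sum -[X in _ = _ *+ X]card_ord -sumr_const; apply: eq_bigr => l _.
  rewrite rmorphM !rmorphXn /= map_polyX hornerM !horner_exp hornerX Fy -exprD subnK //.
  by rewrite -ltnS (leq_trans (ltn_ord l)) // leqSpred.
have [u [w uw]] : exists u w, u * H + w * T = 1.
  apply: coprimep_bezout; rewrite -(coprimep_map j); apply: closed_coprimep => y Hy.
  rewrite rootE (Ty _ Hy) -rootE; apply: (nc _ N).
  rewrite -horner_iter_poly -map_iter_poly; apply/eqP.
  by move: Hy; rewrite rootE rmorphB /= map_polyX !hornerE subr_eq0.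
pose l : seq K := alpha :: f ++ H ++ T ++ u ++ w ++ Fa; exists l => p pl L e b pb bu.
have bl c : c \in l -> b (e c) <= 1 by move=> cl; exact: (pl c cl _ pb).
have fi : integral_at e b f by apply: (int_mem bl) => c cf; rewrite !(inE, mem_cat) cf !orbT.
have ai : b (e alpha) <= 1 by apply: bl; rewrite mem_head.
split; first by exists 1 => m; exact: orbit_integral.
move=> y Hy.
apply: (@no_accumulation_at_preimage _ _ _ e b bu f alpha fi ai H T u w HT uw _ _ _ _ _ Fa) => //.
- by apply: (int_mem bl) => c cf; rewrite !(inE, mem_cat) cf !orbT.
- by apply: (int_mem bl) => c cf; rewrite !(inE, mem_cat) cf !orbT.
- by apply: (int_mem bl) => c cf; rewrite !(inE, mem_cat) cf !orbT.
- by apply: (int_mem bl) => c cf; rewrite !(inE, mem_cat) cf !orbT.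
- by apply: (int_mem bl) => c cf; rewrite !(inE, mem_cat) cf !orbT.
- by move=> m; exists (a + m)%N; rewrite orbit_iter_poly leq_addl.
Qed.

(** The zero [e0] of [FN - 'X] is critical and is split off as the factor [Y]. The orbit avoids it
    because [x m - e0] is a product of powers of [c] and [alpha - e0], units at almost all primes;
    the cofactor [H1] is coprime to its multiplier and is treated like [H] in the separable case. *)
Lemma escapes_totally_invariant c e0 : c != 0 -> f = c *: ('X - e0%:P) ^+ d + e0%:P ->
  exists l : seq K, forall p : place R B, (forall c, c \in l -> forall b, place_class p b -> b c <= 1) ->
    escapes p x ((FN - 'X) \Po Fa).
Proof.
move=> c0 fE; pose Y := 'X - e0%:P; pose E m := (\sum_(i < m) d ^ i)%N.
have d0 : (0 < d)%N by exact: ltnW.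
have fy t : f.[t] = c * (t - e0) ^+ d + e0 by rewrite [X in X.[_]]fE !hornerE.
have fC g : f \Po g = c *: (g - e0%:P) ^+ d + e0%:P.
  rewrite [X in X \Po _]fE comp_polyD comp_polyC comp_polyZ rmorphXn /=.
  by rewrite comp_polyB comp_polyX comp_polyC.
have iterE m : iter_poly f m = c ^+ E m *: Y ^+ (d ^ m) + e0%:P.
  elim: m => [|m IHm]; first by rewrite /iter_poly /E big_ord0 expr0 scale1r expn0 expr1 subrK.
  transitivity (f \Po iter_poly f m); first by [].
  rewrite fC IHm addrK exprZn scalerA -!exprM -expnSr -exprS.
  by rewrite /E big_ord_recl expn0 add1n mulnC big_distrr; under [in RHS]eq_bigr => i _ do rewrite expnS.
pose C := c ^+ E N.+1; pose D := (d ^ N.+1)%N.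
pose z := C *: Y ^+ D.-1; pose H1 := z - 1.
have D0 : (0 < D)%N by rewrite expn_gt0 d0.
have HE : FN - 'X = Y * H1.
  rewrite iterE -/C -/D mulrBr mulr1 /z -scalerAr -exprS prednK //.
  by rewrite opprB addrA.
pose S : {poly K} := \sum_(i < d) 'X^i; pose q := S \Po z.
(* [z] semiconjugates [f] to the power map of degree d: the exponents of [c] agree because (d - 1) E
   = D - 1. Hence [H1], being z - 1, has multiplier S(z). *)
have zf : z \Po f = z ^+ d.
  rewrite {1}/z comp_polyZ rmorphXn /= comp_polyB comp_polyX comp_polyC [X in X - _]fE addrK.
  rewrite exprZn scalerA -exprM [in RHS]/z exprZn -exprM mulnC; congr (_ *: _); last by rewrite exprM.
  rewrite /C -exprD; congr (_ ^+ _).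
  by rewrite predn_exp -/(E N.+1) mulnC -[X in (X + _)%N]muln1 -mulnDr add1n prednK.
have H1f : H1 \Po f = H1 * q.
  rewrite comp_polyB zf comp_polyC subrX1 /q /S rmorph_sum /=; congr (_ * _).
  by apply: eq_bigr => i _; rewrite comp_Xn_poly.
have char0 := global_field_char0 B.
(* Coprimality amounts to S(1) = d being nonzero, which holds in characteristic 0. *)
have [u0 [w0 uw0]] : exists u w, u * ('X - 1%:P) + w * S = 1.
  apply: coprimep_bezout; rewrite coprimep_sym coprimep_XsubC /root /S horner_sum.
  under eq_bigr => i _ do rewrite hornerXn expr1n.
  by rewrite sumr_const card_ord -[0]/(0%:R) (inj_eq (natr_inj_char0 char0)) -lt0n.
pose u := u0 \Po z; pose w := w0 \Po z.
have uw : u * H1 + w * q = 1.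
  have := congr1 (fun p => p \Po z) uw0.
  by rewrite /= rmorphD !rmorphM rmorphB /= comp_polyX comp_polyC rmorph1.
have H1x m : H1.[x m] != 0.
  by have := periodic_orbit m; rewrite HE hornerM mulf_eq0 negb_or => /andP[].
(* Listing the inverses as well makes [c] and [alpha - e0] units, not merely integral. For
   [alpha - e0 = 0] the orbit would be constant, which injectivity excludes. *)
pose l : seq K := [:: alpha, c, c^-1, alpha - e0, (alpha - e0)^-1 & f ++ H1 ++ q ++ u ++ w ++ Fa].
exists l => p pl L e b pb bu.
have bl t : t \in l -> b (e t) <= 1 by move=> tl; exact: (pl t tl _ pb).
have unit t : t != 0 -> t \in l -> t^-1 \in l -> b (e t) = 1.
  move=> t0 /bl t1 /bl; rewrite fmorphV absvalV invr_le1 ?unitfE ?absval_eq0 ?absval_gt0 ?fmorph_eq0 //.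
  by move=> t2; apply/eqP; rewrite eq_le t1.
have fi : integral_at e b f by apply: (int_mem bl) => t tf; rewrite !(inE, mem_cat) tf !orbT.
have ai : b (e alpha) <= 1 by apply: bl; rewrite mem_head.
split; first by exists 1 => m; exact: orbit_integral.
move=> y; rewrite HE comp_polyM rmorphM rootM => /orP[|Hy].
  have YE k : map_poly e (Y ^+ k) = ('X - (e e0)%:P) ^+ k.
    by rewrite rmorphXn rmorphB /= map_polyX map_polyC.
  rewrite rootE comp_polyB comp_polyX comp_polyC iterE addrK /= map_polyZ hornerZ YE.
  rewrite horner_exp !hornerE mulf_eq0 fmorph_eq0 !expf_eq0.
  rewrite (negbTE c0) andbF /= subr_eq0 => /andP[_ /eqP->].
  exists 1 => //; exists 0%N => m _; rewrite -rmorphB.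
  have ae0 : alpha - e0 != 0.
    rewrite subr_eq0; apply/eqP => ae.
    suff /xinj : x 1 = x 0 by [].
    by rewrite /orbit_seq /= fy ae subrr expr0n (gtn_eqF d0) mulr0 add0r.
  have c1 : b (e c) = 1 by apply: unit; rewrite // !inE eqxx !orbT.
  suff -> : b (e (x m - e0)) = 1 by [].
  elim: m => [|m IHm]; first by apply: unit; rewrite // !inE eqxx !orbT.
  have -> : x m.+1 - e0 = c * (x m - e0) ^+ d by rewrite /orbit_seq iterS fy addrK.
  by rewrite rmorphM rmorphXn absvalM absvalX IHm expr1n c1 mulr1.
apply: (@no_accumulation_at_preimage _ _ _ e b bu f alpha fi ai H1 q u w H1f uw _ _ _ _ _ Fa) => //.
- by apply: (int_mem bl) => t tf; rewrite !(inE, mem_cat) tf !orbT.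
- by apply: (int_mem bl) => t tf; rewrite !(inE, mem_cat) tf !orbT.
- by apply: (int_mem bl) => t tf; rewrite !(inE, mem_cat) tf !orbT.
- by apply: (int_mem bl) => t tf; rewrite !(inE, mem_cat) tf !orbT.
- by apply: (int_mem bl) => t tf; rewrite !(inE, mem_cat) tf !orbT.
- by move=> m; exists (a + m)%N; rewrite orbit_iter_poly leq_addl.
Qed.

End SpecialEscape.

Theorem special_finitely_many_nonescaping (R : realType) (K : fieldType) (B : global_field K)
    (Kbar : closedFieldType) (j : {rmorphism K -> Kbar}) (f : {poly K}) (n : nat)
    (V : subvariety n K) (k : 'I_n) :
  algebraic_closure j -> (2 <= (size f).-1)%N -> dimension_zero j V -> special j f ->
  preperiodic j f V ->
  exists2 g : {poly K},
    forall (L : fieldType) (i : {rmorphism K -> L}) Q, points V i Q ->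
      forall b, Q k = Some b -> root (map_poly i g) b
    & forall alpha, injective (orbit_seq f alpha) ->
      finite_set [set p : place R B | is_prime p /\ ~ escapes p (orbit_seq f alpha) g].
Proof.
move=> hj hf hV sp pre; have [a [N hN]] := preperiodic_coord k hj hV pre.
exists ((iter_poly f N.+1 - 'X) \Po iter_poly f a).
  apply: (points_coord_root (j := j)) => Q VQ b Qb; have := hN Q VQ b Qb.
  move: N.+1 => M; rewrite rootE map_comp_poly rmorphB /= map_polyX !map_iter_poly horner_comp hornerD hornerN hornerX.
  by rewrite !horner_iter_poly -iterD addnC => ->; rewrite subrr.
move=> alpha xinj.
have [l hl] : exists l : seq K, forall p : place R B,
    (forall c, c \in l -> forall b, place_class p b -> b c <= 1) ->
    escapes p (orbit_seq f alpha) ((iter_poly f N.+1 - 'X) \Po iter_poly f a).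
  have [nc|[c [e0 [c0 fE]]]] := special_dichotomy (global_field_char0 B) hf sp.
    exact: (escapes_separable R B xinj a N nc).
  exact: (escapes_totally_invariant R B hf xinj a N c0 fE).
have [_ poles] := global_places_exist R B hj.
apply: (@sub_finite_set _ _ (\bigcup_(c in [set` l]) [set p : place R B | is_prime p /\
    exists b, place_class p b /\ 1 < b c])); last first.
  by apply: bigcup_finite => // c _; exact: poles.
move=> p [pp ne]; apply: contrapT => nb; apply: ne; apply: hl => c cl b pb.
by rewrite leNgt; apply/negP => c1; apply: nb; exists c => //; split=> //; exists b.
Qed.

(** * Closures of orbits *)

Lemma P1_of_coord_affine (F : fieldType) (t : F) : P1_of_coord t 1 = Some t.
Proof. by rewrite /P1_of_coord oner_eq0 divr1. Qed.

Lemma P1_of_coord_infinity (F : fieldType) (t : F) :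
  P1_of_coord 1 t = if t == 0 then None else Some t^-1.
Proof. by rewrite /P1_of_coord div1r. Qed.

(** * Neighbourhoods in the adic projective line *)

Section AdicOpen.
Variables (R : realType) (L : fieldType) (a : absval R L).

Lemma adic_openP (U : set (adic a)) :
  (forall t : adic a, U t -> exists2 d, 0 < d & forall s : adic a, a (t - s) < d -> U s) -> open U.
Proof.
move=> h; rewrite openE => t Ut; apply/nbhs_ballP; have [d d0 hd] := h t Ut.
by exists d => // s; rewrite ballEmdist /=; exact: hd.
Qed.

Lemma adic_open_neq (c : L) : open [set t : adic a | t <> c].
Proof.
apply: adic_openP => t tc; exists (a (t - c)); first by rewrite absval_gt0 subr_eq0; apply/eqP.
by move=> s + sc; rewrite sc ltxx.
Qed.

Lemma adic_P1_open_neq (q : adic_P1 a) : open (~` [set q]).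
Proof.
split; case: q => [b|].
- rewrite (_ : [set _ | _] = [set t : adic a | t <> b]); first exact: adic_open_neq.
  apply/seteqP; split=> t /=; rewrite P1_of_coord_affine => h E; apply: h; first by rewrite E.
  by case: E.
- rewrite (_ : [set _ | _] = setT); first exact: openT.
  by apply/seteqP; split=> t //= _; rewrite P1_of_coord_affine.
- have [->|b0] := eqVneq b 0.
    rewrite (_ : [set _ | _] = setT); first exact: openT.
    apply/seteqP; split=> t //= _; rewrite P1_of_coord_infinity; case: eqVneq => // t0 [/eqP].
    by rewrite invr_eq0 (negbTE t0).
  rewrite (_ : [set _ | _] = [set t : adic a | t <> b^-1]); first exact: adic_open_neq.
  apply/seteqP; split=> t /=; rewrite P1_of_coord_infinity.
    by move=> + tb; apply; rewrite tb invr_eq0 (negbTE b0) invrK.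
  by case: eqVneq => // t0 h [E]; apply: h; rewrite -E invrK.
rewrite (_ : [set _ | _] = [set t : adic a | t <> 0]); first exact: adic_open_neq.
apply/seteqP; split=> t /=; rewrite P1_of_coord_infinity; first by move=> h t0; apply: h; rewrite t0 eqxx.
by case: eqVneq.
Qed.

Lemma adic_P1_nbhs_Some (b : L) (eps : R) : 0 < eps ->
  nbhs (Some b : adic_P1 a) [set q : adic_P1 a | exists2 t, q = Some t & a (t - b) < eps].
Proof.
move=> eps0; apply: open_nbhs_nbhs; split; last by exists b; rewrite // subrr absval0.
split; apply: adic_openP => t /= [t' E tb].
  move: E; rewrite P1_of_coord_affine => -[E]; move: tb; rewrite -E => tb.
  exists (eps - a (t - b)); first by rewrite subr_gt0.
  move=> s ts; exists s; rewrite ?P1_of_coord_affine //.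
  have := absvalD a (s - t) (t - b); rewrite addrA subrK -[a (s - t)]absvalN opprB => h.
  by apply: le_lt_trans h _; rewrite -ltrBrDr.
move: E; rewrite P1_of_coord_infinity; case: eqVneq => // t0 [E].
have at0 : 0 < a t by rewrite absval_gt0.
(* In the chart at infinity |1/s - 1/t| = |t - s| / (|s| |t|). The first bound gives |s| > |t| / 2,
   and the second makes the quotient less than the room left around [b]. *)
exists (Num.min (a t / 2) ((eps - a (t' - b)) * (a t * a t) / 2)).
  by rewrite lt_min !divr_gt0 // !mulr_gt0 // subr_gt0.
move=> s; rewrite lt_min => /andP[s1 s2].
have as0 : a t / 2 < a s.
  have := absvalD a (t - s) s; rewrite subrK; move: s1; lra.
have s0 : s != 0 by rewrite -(absval_gt0 a) (lt_trans _ as0) // divr_gt0.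
have as1 : 0 < a s by rewrite absval_gt0.
exists s^-1; first by rewrite P1_of_coord_infinity (negbTE s0).
have inv : a (s^-1 - t') < eps - a (t' - b).
  have -> : s^-1 - t' = (t - s) / (s * t) by rewrite -E; field; rewrite t0 s0.
  rewrite absvalM absvalV absvalM ltr_pdivrMr ?mulr_gt0 //.
  have e1 : 0 < eps - a (t' - b) by rewrite subr_gt0.
  apply: lt_trans s2 _; rewrite -mulrA ltr_pM2l //.
  by rewrite mulrAC ltr_pM2r.
have := absvalD a (s^-1 - t') (t' - b); rewrite addrA subrK; move: inv; lra.
Qed.

Lemma adic_P1_nbhs_None (C : R) : 0 < C ->
  nbhs (None : adic_P1 a) [set q : adic_P1 a | forall t, q = Some t -> C < a t].
Proof.
move=> C0; apply: open_nbhs_nbhs; split; last by [].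
split; apply: adic_openP => t /= h.
  have {}h : C < a t by apply: h; rewrite P1_of_coord_affine.
  exists (a t - C); first by rewrite subr_gt0.
  move=> s ts t'; rewrite P1_of_coord_affine => -[<-].
  have := absvalD a (t - s) s; rewrite subrK; move: ts; lra.
have {}h : C * a t < 1.
  have [->|t0] := eqVneq t 0; first by rewrite absval0 mulr0.
  have := h t^-1; rewrite P1_of_coord_infinity (negbTE t0) => /(_ erefl).
  by rewrite absvalV -[_^-1]mul1r ltr_pdivlMr // absval_gt0.
exists ((1 - C * a t) / C); first by rewrite divr_gt0 // subr_gt0.
move=> s ts t'; rewrite P1_of_coord_infinity; case: eqVneq => // s0 [<-].
rewrite absvalV -[_^-1]mul1r ltr_pdivlMr ?absval_gt0 //.
move: ts; rewrite ltr_pdivlMr // => ts.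
have : C * a s <= C * (a t + a (t - s)).
  rewrite ler_pM2l //; have := absvalD a t (s - t); rewrite addrC subrK -[a (s - t)]absvalN opprB //.
move: ts; lra.
Qed.

End AdicOpen.

Lemma proj_continuous_Type (I : Type) (T : I -> topologicalType) (i : I) :
  continuous (proj i : prod_topology T -> T i).
Proof. exact: (@proj_continuous {classic I} T i). Qed.

Lemma prod_open_neq (I : Type) (T : I -> topologicalType) :
  (forall i (q : T i), open (~` [set q])) -> forall q : prod_topology T, open (~` [set q]).
Proof.
move=> h q; rewrite (_ : ~` [set q] = \bigcup_(i in [set: I]) (proj i @^-1` (~` [set q i]))).
  apply: bigcup_open => i _; apply: open_comp; last exact: h.
  by move=> x _; exact: proj_continuous_Type.
apply/seteqP; split=> [x xq|x [i _ xi] xq]; last by apply: xi; rewrite xq.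
apply: contrapT => n; apply: xq; apply: functional_extensionality_dep => i.
by apply: contrapT => xi; apply: n; exists i.
Qed.

(* Points other than y can be removed one at a time, so y is approached by late terms. *)
Lemma closure_sequence (T : topologicalType) (u : nat -> T) (y : T) (B : set T) (M : nat) :
  (forall q : T, open (~` [set q])) -> closure (range u) y -> (forall m, y <> u m) ->
  nbhs y B -> exists m, B (u m) /\ forall m', (m' < M)%N -> u m <> u m'.
Proof.
move=> T1 cl yu By.
have : nbhs y (B `&` [set z | forall m', (m' < M)%N -> z <> u m']).
  elim: M => [|M IHM]; first by apply: filterS By => z Bz; split.
  have yM : nbhs y (~` [set u M]) by apply: open_nbhs_nbhs; split; [exact: T1|exact: yu].
  apply: filterS (filterI IHM yM) => z [[Bz zM] zu]; split=> // m'.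
  by rewrite ltnS leq_eqVlt => /orP[/eqP->|/zM].
by move=> /cl[_ [[m _ <-] [Bm um]]]; exists m.
Qed.

Lemma points_map (n : nat) (K L : fieldType) (i : {rmorphism K -> L}) (V : subvariety n K)
    (P : P1n n K) :
  points V i (P1n_map i P) <-> points V (idfun : {rmorphism K -> K}) P.
Proof.
have E F : mpoly.mmap i (P1n_coord (P1n_map i P)) F =
    i (mpoly.mmap (idfun : {rmorphism K -> K}) (P1n_coord P) F).
  rewrite rmorph_mmap; apply: mmap_ext => k.
  rewrite /P1n_coord /P1n_map /=; case: fintype.split => k'; case: (P k') => [b|] /=;
  by rewrite ?rmorph1 ?rmorph0.
split=> h F VF; last by rewrite E h // rmorph0.
by apply: (fmorph_inj i); rewrite rmorph0 -E; exact: h.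
Qed.

(** Infinity is fixed by a polynomial, so if no finite coordinate wanders, all coordinates are
    preperiodic with a common preperiod and period, and the orbit is finite. *)
Lemma orbit_dichotomy (n : nat) (K : fieldType) (f : {poly K}) (P : P1n n K) :
  (exists k alpha, P k = Some alpha /\ injective (orbit_seq f alpha)) \/
  exists M, forall m, exists2 m', (m' < M)%N & iter m (diag_map f) P = iter m' (diag_map f) P.
Proof.
have [?|nw] := pselect (exists k alpha, P k = Some alpha /\ injective (orbit_seq f alpha)); [by left|right].
have [a [N hN]] := common_preperiod (T := option K) (poly_P1 f) [seq P k | k <- enum 'I_n].
have per : iter (a + N.+1) (diag_map f) P = iter a (diag_map f) P.
  have E m k : iter m (diag_map f) P k = iter m (poly_P1 f) (P k).
    by elim: m => [//|m IHm]; rewrite !iterS -IHm.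
  apply: functional_extensionality_dep => k; rewrite !E; apply: hN.
    by apply: map_f; rewrite mem_enum.
  case Pk : (P k) => [alpha|]; last by exists 0%N, 1%N.
  apply: contrapT => nr; apply: nw; exists k, alpha; split=> // m1 m2 E12.
  have S m : iter m (poly_P1 f) (Some alpha) = Some (orbit_seq f alpha m).
    by elim: m => [//|m IHm]; rewrite iterS IHm.
  apply/eqP; rewrite eqn_leq; apply/andP; split; rewrite leqNgt; apply/negP => lt; apply: nr.
    by exists m2, m1; rewrite !S E12.
  by exists m1, m2; rewrite !S E12.
exists (a + N.+1)%N => m; have [k] := ubnP m; elim: k m => [//|k IHk] m; rewrite ltnS => mk.
have [lt|ge] := ltnP m (a + N.+1); first by exists m.
have -> : iter m (diag_map f) P = iter (m - N.+1) (diag_map f) P.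
  rewrite -{1}(subnK ge) iterD per -iterD; congr (iter _ _ _); lia.
by apply: IHk; lia.
Qed.

Section Separation.
Variables (R : realType) (K : fieldType) (B : global_field K).
Variable Kv : forall v : place R B, completion v.
Variables (n : nat) (f : {poly K}).

Lemma adic_P1n_open_neq (v : place R B) (q : adic_P1n Kv n v) : open (~` [set q]).
Proof. by move: q; apply: prod_open_neq => k q; exact: adic_P1_open_neq. Qed.

Lemma adelic_P1n_open_neq (S : set (place R B)) (q : adelic_P1n Kv n S) : open (~` [set q]).
Proof. by move: q; apply: prod_open_neq => v q; exact: adic_P1n_open_neq. Qed.

Lemma forward_orbit_image (T : Type) (u : P1n n K -> T) (P : P1n n K) :
  u @` forward_orbit (diag_map f) P = range (fun m => u (iter m (diag_map f) P)).
Proof. by rewrite /forward_orbit image_comp. Qed.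

(** One coordinate suffices: if that of [Q] is infinite, boundedness of the orbit separates it; if
    finite, it is a zero of [g] and the orbit eventually keeps its distance. *)
Lemma escaping_neighbourhood (p : place R B) (P : P1n n K) k alpha g (V : subvariety n K)
    (Q : adic_P1n Kv n p) :
  is_prime p -> P k = Some alpha -> escapes p (orbit_seq f alpha) g ->
  (forall (L : fieldType) (i : {rmorphism K -> L}) Q, points V i Q ->
      forall b, Q k = Some b -> root (map_poly i g) b) ->
  points_at Kv V p Q ->
  exists2 U, nbhs Q U &
    exists M, forall m, (M <= m)%N -> ~ U (embed_at Kv p (iter m (diag_map f) P)).
Proof.
move=> pp Pk esc hg VQ.
pose a := compl_abs (Kv p); pose e := compl_emb (Kv p).
have pa : place_class p (absval_pullback e a) := compl_place (Kv p).
have [[C xC] sep] := esc _ e a pa (completion_ultrametric pp pa).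
have coord m : embed_at Kv p (iter m (diag_map f) P) k = Some (e (orbit_seq f alpha m)).
  by rewrite /embed_at /P1n_map iter_diag_map Pk.
have near (U : set (adic_P1 a)) : nbhs (Q k : adic_P1 a) U -> nbhs Q (proj k @^-1` U).
  by move=> QU; apply: (@proj_continuous _ (fun _ : 'I_n => adic_P1 a) k Q).
case Qk : (Q k) => [b|].
  have [eps eps0 [M hM]] := sep b (hg _ _ _ VQ _ Qk).
  eexists; first by apply: near; rewrite Qk; exact: adic_P1_nbhs_Some eps0.
  exists M => m mM /= [t]; rewrite /proj coord => -[<-].
  by rewrite ltNge hM.
have C0 : 0 < Num.max 1 C by rewrite lt_max ltr01.
eexists; first by apply: near; rewrite Qk; exact: adic_P1_nbhs_None C0.
exists 0%N => m _ /= /(_ _ (coord m)).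
by rewrite ltNge le_max xC orbT.
Qed.

End Separation.

Section ClosureInOrbit.
Variables (R : realType) (K : fieldType) (B : global_field K).
Variable Kv : forall v : place R B, completion v.
Variables (n : nat) (f : {poly K}) (P : P1n n K).

Lemma closure_finite_orbit (T : topologicalType) (u : P1n n K -> T) y M :
  (forall q : T, open (~` [set q])) ->
  (forall m, exists2 m', (m' < M)%N & iter m (diag_map f) P = iter m' (diag_map f) P) ->
  closure (u @` forward_orbit (diag_map f) P) y -> exists m, y = u (iter m (diag_map f) P).
Proof.
move=> T1 fin cl; apply: contrapT => ny.
rewrite forward_orbit_image in cl.
have [|m [_ hm]] := closure_sequence (B := setT) M T1 cl _ filterT.
  by move=> m ym; apply: ny; exists m.
by have [m' lt E] := fin m; apply: (hm m' lt); rewrite E.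
Qed.

Lemma closure_late_orbit (T : topologicalType) (u : P1n n K -> T) y (U : set T) M :
  (forall q : T, open (~` [set q])) -> nbhs y U ->
  (forall m, (M <= m)%N -> ~ U (u (iter m (diag_map f) P))) ->
  closure (u @` forward_orbit (diag_map f) P) y -> exists m, y = u (iter m (diag_map f) P).
Proof.
move=> T1 yU out cl; apply: contrapT => ny.
rewrite forward_orbit_image in cl.
have [|m [Um hm]] := closure_sequence M T1 cl _ yU.
  by move=> m ym; apply: ny; exists m.
have [mM|Mm] := ltnP m M; first exact: (hm m mM erefl).
exact: out Um.
Qed.

Variables (V : subvariety n K).

Lemma orbit_point_in_variety (v : place R B) m :
  points_at Kv V v (embed_at Kv v (iter m (diag_map f) P)) ->
  (points V (idfun : {rmorphism K -> K}) `&` forward_orbit (diag_map f) P) (iter m (diag_map f) P).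
Proof. by move=> /points_map VP; split=> //; exists m. Qed.

Lemma adic_separated (v : place R B) :
  points V (idfun : {rmorphism K -> K}) `&` forward_orbit (diag_map f) P = set0 ->
  (forall Q, points_at Kv V v Q -> adic_closure Kv v (forward_orbit (diag_map f) P) Q ->
     exists m, Q = embed_at Kv v (iter m (diag_map f) P)) ->
  points_at Kv V v `&` adic_closure Kv v (forward_orbit (diag_map f) P) = set0.
Proof.
move=> E h; apply/seteqP; split=> // Q [VQ cQ]; have [m QE] := h Q VQ cQ.
have : (points V (idfun : {rmorphism K -> K}) `&` forward_orbit (diag_map f) P) (iter m (diag_map f) P).
  by apply: (@orbit_point_in_variety v); rewrite -QE.
by rewrite E.
Qed.

Lemma escaping_separated (v : place R B) k alpha g :
  points V (idfun : {rmorphism K -> K}) `&` forward_orbit (diag_map f) P = set0 ->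
  is_prime v -> P k = Some alpha -> escapes v (orbit_seq f alpha) g ->
  (forall (L : fieldType) (i : {rmorphism K -> L}) Q, points V i Q ->
      forall b, Q k = Some b -> root (map_poly i g) b) ->
  points_at Kv V v `&` adic_closure Kv v (forward_orbit (diag_map f) P) = set0.
Proof.
move=> E vp Pk esc hg; apply: adic_separated => // Q VQ.
have [U QU [M hM]] := escaping_neighbourhood vp Pk esc hg VQ.
by apply: closure_late_orbit QU hM; exact: adic_P1n_open_neq.
Qed.

End ClosureInOrbit.

Theorem theorem3p4 (R : realType) (K : fieldType) (B : global_field K)
    (Kv : forall v : place R B, completion v)
    (Kbar : closedFieldType) (j : {rmorphism K -> Kbar})
    (hj : algebraic_closure j)
    (f : {poly K}) (hf : (2 <= (size f).-1)%N)
    (n : nat) (hn : (2 <= n)%N)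
    (V : subvariety n K) (hV : dimension_zero j V) :
  let phi : P1n n K -> P1n n K := diag_map f in
  let VK := points V (idfun : {rmorphism K -> K}) in
  (forall P : P1n n K, VK `&` forward_orbit phi P = set0 ->
    infinite_set [set p : place R B | is_prime p /\
      points_at Kv V p `&` adic_closure Kv p (forward_orbit phi P) = set0])
  /\
  (forall S : set (place R B), finite_set S ->
    (forall v, ~ is_prime v -> S v) ->
    forall P : P1n n K,
      embed_diag Kv S @` (VK `&` forward_orbit phi P) =
      adelic_points Kv V S `&` adelic_closure Kv S (forward_orbit phi P))
  /\
  (special j f -> preperiodic j f V ->
    forall P : P1n n K, VK `&` forward_orbit phi P = set0 ->
    finite_set [set p : place R B | is_prime p /\
      points_at Kv V p `&` adic_closure Kv p (forward_orbit phi P) <> set0]).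
Proof.
move=> phi VK.
have coord k : exists2 g : {poly K}, g != 0 &
    forall (L : fieldType) (i : {rmorphism K -> L}) Q, points V i Q ->
      forall b, Q k = Some b -> root (map_poly i g) b.
  have [g g0 hg] := dimension_zero_coord_algebraic k hj hV.
  by exists g => //; exact: points_coord_root hg.
have preper P v M : VK `&` forward_orbit phi P = set0 ->
    (forall m, exists2 m', (m' < M)%N & iter m phi P = iter m' phi P) ->
    points_at Kv V v `&` adic_closure Kv v (forward_orbit phi P) = set0.
  move=> E fin; apply: adic_separated => // Q _.
  by apply: closure_finite_orbit fin; exact: adic_P1n_open_neq.
have esc k alpha : injective (orbit_seq f alpha) ->
    exists2 g : {poly K}, infinite_set [set p : place R B | is_prime p /\ escapes p (orbit_seq f alpha) g]
    & forall (L : fieldType) (i : {rmorphism K -> L}) Q, points V i Q ->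
      forall b, Q k = Some b -> root (map_poly i g) b.
  move=> xinj; have [g g0 hg] := coord k; exists g => //.
  exact: (@infinitely_many_escaping R K B Kbar j f alpha g hj hf xinj g0).
have primes := @infinitely_many_primes R K B Kbar j hj.
split; last split.
- move=> P E; have [[k [alpha [Pk xinj]]]|[M fin]] := orbit_dichotomy f P.
    have [g inf hg] := esc k alpha xinj; apply: contra_not inf; apply: sub_finite_set => p [pp pe].
    by split=> //; exact: (escaping_separated Kv E pp Pk pe hg).
  apply: contra_not primes; apply: sub_finite_set => p pp; split=> //.
  exact: preper fin.
- move=> S finS SP P; apply/seteqP; split=> [_ [Q [VQ OQ] <-]|x [Vx cx]].
    split; last by apply: subset_closure; exists Q.
    by move=> v; apply/points_map.
  (* A finite [S] cannot contain an infinite set of primes. *)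
  have pick (A : set (place R B)) : infinite_set A -> exists2 v, A v & ~ S v.
    move=> infA; apply: contrapT => nv; apply: infA; apply: sub_finite_set finS => v Av.
    by apply: contrapT => nS; apply: nv; exists v.
  (* Some place outside [S] is needed to read off from the components of [x] that the orbit point
     itself lies in [V]. *)
  have [v0 _ nSv0] := pick _ primes.
  suff [m xE] : exists m, x = embed_diag Kv S (iter m phi P).
    exists (iter m phi P) => //; apply: (@orbit_point_in_variety _ _ _ Kv _ f P V v0).
    by have := Vx (exist _ v0 nSv0); rewrite xE.
  have [[k [alpha [Pk xinj]]]|[M fin]] := orbit_dichotomy f P; last first.
    by apply: closure_finite_orbit fin cx; exact: adelic_P1n_open_neq.
  (* At one escaping prime outside [S], the component of [x] has a neighbourhood free of late orbit
     points. Its preimage in the product is a neighbourhood of [x] with the same property, so [x] is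
     an early orbit point. *)
  have [g inf hg] := esc k alpha xinj; have [p [pp pe] nSp] := pick _ inf.
  pose v : {v | ~ S v} := exist _ p nSp.
  have [U xU [M hM]] := escaping_neighbourhood pp Pk pe hg (Vx v).
  have xU' : nbhs x (proj v @^-1` U) by apply: (@proj_continuous_Type _ _ v x).
  by apply: closure_late_orbit xU' hM cx; exact: adelic_P1n_open_neq.
move=> sp pre P E; have [[k [alpha [Pk xinj]]]|[M fin]] := orbit_dichotomy f P; last first.
  rewrite (_ : [set _ | _] = set0); first exact: finite_set0.
  by apply/seteqP; split=> // p [_]; apply; exact: preper fin.
have [g hg fing] := special_finitely_many_nonescaping R B k hj hf hV sp pre.
apply: sub_finite_set (fing alpha xinj) => p [pp ne]; split=> // pe; apply: ne.
exact: (escaping_separated Kv E pp Pk pe hg).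
Qed.
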